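(* Let $\Gamma$ be a group and let $F$ be a $\Gamma$-field, i.e. a field equipped with a group homomorphism from $\Gamma$ to its group of field automorphisms. Then one has an isomorphism $$K^{M,\Gamma}_{2}(F)\cong (K_{2}(F))_{\Gamma}$$ and an exact sequence $$0\to (K_{2}(F)\cap \Gamma St(F))/\Gamma K_{2}(F)\to K^{M,\Gamma}_{2}(F)\to K^{\Gamma}_{2}(F)\to 0 .$$
   Context: For a group $G$ on which $\Gamma$ acts by automorphisms, $\Gamma G$ denotes the normal subgroup of $G$ generated by all ${}^{\gamma}g\,g^{-1}$ ($g\in G,\gamma\in\Gamma$), and $G_\Gamma=G/\Gamma G$. For $n\ge2$, the Milnor K-group of a ring $A$ with unit is $K^M_n(A)=(A^{*})^{\otimes n}/\{a_1\otimes\cdots\otimes a_n: a_i+a_{i+1}=1\}$, the quotient of $(A^* )^{\otimes n}$ ($A^*$ the group of units) by the subgroup generated by all $a_1\otimes\cdots\otimes a_n$ with $a_i\in A^*$ and $a_i+a_{i+1}=1$ for some $i$. If $\Gamma$ acts on $A$, it acts on $K^M_n(A)$ componentwise, and $K^{M,\Gamma}_n(A)=(K^M_n(A))_\Gamma$. $E(A)$ is the stable elementary group (with $\Gamma$ acting entrywise); $St(A)$ is the stable Steinberg group with generators $x_{ij}(a)$ and action ${}^{\gamma}x_{ij}(a)=x_{ij}({}^{\gamma}a)$; $\phi:St(A)\to E(A)$, $x_{ij}(a)\mapsto e_{ij}(a)$, is the canonical surjection of $\Gamma$-groups; $K_2(A)=\operatorname{Ker}\phi$ is a $\Gamma$-subgroup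 of $St(A)$; and $K_2^{\Gamma}(A)=\operatorname{Ker}(\phi_\Gamma:St(A)_\Gamma\to E(A)_\Gamma)$. *)

(* Defs.v *)
From HB Require Import structures.
From mathcomp Require Import all_boot all_order all_algebra.
From mathcomp Require Import generic_quotient finmap.
From mathcomp Require Import boolp classical_sets cardinality fsbigop.

Set Implicit Arguments.
Unset Strict Implicit.
Unset Printing Implicit Defensive.

Import GRing.Theory.
Local Open Scope group_scope.

(* Group homomorphisms are [{multiplicative G -> H}]: between groups such a   *)
(* map automatically preserves 1 and inverses.                                *)
Section HomTheory.
Variables (G H : groupType) (f : {multiplicative G -> H}).

Lemma hom1 : f 1 = 1.
Proof. by apply: (@mulgI _ (f 1)); rewrite -gmulfM !mulg1. Qed.

Lemma homV x : f x^-1 = (f x)^-1.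
Proof. by apply: (@mulgI _ (f x)); rewrite -gmulfM !mulgV hom1. Qed.

End HomTheory.

Section Subgroups.
Variable G : groupType.

Section SubgroupType.
Variable S : groupClosed G.

Lemma groupClosed_closed : group_closed S.
Proof. by split=> [|x y xS yS]; [exact: gpred1 | exact: gpredF]. Qed.

Definition subgrp : Type := {x : G | x \in S}.
HB.instance Definition _ := SubChoice.on subgrp.
HB.instance Definition _ :=
  SubChoice_isSubGroup.Build G _ subgrp groupClosed_closed.

Definition incl : subgrp -> G := val.
HB.instance Definition _ :=
  isMultiplicative.Build subgrp G incl (fun _ _ => erefl).

Lemma incl_inj : injective incl. Proof. exact: val_inj. Qed.

End SubgroupType.

Inductive genP (S : set G) : G -> Prop :=
| genP_in x : S x -> genP S x
| genP_1 : genP S 1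
| genP_M x y : genP S x -> genP S y -> genP S (x * y)
| genP_V x : genP S x -> genP S x^-1.

Section Gen.
Variable S : set G.

Definition gen_pred : {pred G} := fun x => `[< genP S x >].
Fact gen_pred1 : 1 \in gen_pred. Proof. by apply/asboolP; exact: genP_1. Qed.
Fact gen_predM : mulg_closed gen_pred.
Proof. by move=> x y /asboolP Sx /asboolP Sy; apply/asboolP; exact: genP_M. Qed.
Fact gen_predV : invg_closed gen_pred.
Proof. by move=> x /asboolP Sx; apply/asboolP; exact: genP_V. Qed.
Definition gen : groupClosed G := HB.pack_for (groupClosed G) gen_pred
  (isMul1Closed.Build G gen_pred gen_pred1)
  (isMulClosed.Build G gen_pred gen_predM)
  (isInvClosed.Build G gen_pred gen_predV).

Lemma genE x : (x \in gen) = `[< genP S x >]. Proof. by []. Qed.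

Lemma mem_gen x : S x -> x \in gen.
Proof. by move=> Sx; rewrite genE; apply/asboolP; exact: genP_in. Qed.

End Gen.

Record normalSubgroup := NormalSubgroup {
  nsub :> groupClosed G;
  nsubJ : forall x y, x \in nsub -> x ^ y \in nsub }.

(* The normal subgroup generated by a set. *)
Definition conjugates (S : set G) : set G :=
  [set z | exists x y, S x /\ z = x ^ y]%classic.

Lemma ncl_subproof (S : set G) x y :
  x \in gen (conjugates S) -> x ^ y \in gen (conjugates S).
Proof.
rewrite genE => /asboolP.
elim=> {x} [x [u [v [Su ->]]]||x1 x2 _ h1 _ h2|x _ h].
- by apply: mem_gen; exists u, (v * y); rewrite conjgM.
- by rewrite conj1g gpred1.
- by rewrite conjMg gpredM.
- by rewrite conjVg gpredVr.
Qed.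

Definition ncl (S : set G) : normalSubgroup :=
  @NormalSubgroup (gen (conjugates S)) (@ncl_subproof S).

Lemma mem_ncl (S : set G) x : S x -> x \in ncl S.
Proof. by move=> Sx; apply: mem_gen; exists x, 1; rewrite conjg1. Qed.

Lemma ncl_min (S : set G) (N : normalSubgroup) :
  (forall x, S x -> x \in N) -> forall x, x \in ncl S -> x \in N.
Proof.
move=> SN x; rewrite genE => /asboolP.
elim=> {x} [_ [u [v [Su ->]]]||x1 x2 _ h1 _ h2|x _ h].
- exact/nsubJ/SN.
- exact: gpred1.
- exact: gpredM.
- exact: gpredVr.
Qed.

(* In an abelian group the subgroup generated by a set is normal. *)
Lemma abelian_gen_subproof (abG : forall x y : G, x * y = y * x)
  (S : set G) x y : x \in gen S -> x ^ y \in gen S.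
Proof. by move=> Sx; rewrite /conjg abG -mulgA mulgV mulg1. Qed.

Definition abelian_gen abG (S : set G) : normalSubgroup :=
  @NormalSubgroup (gen S) (abelian_gen_subproof abG (S := S)).

End Subgroups.

Section Preimage.
Variables (G H : groupType) (f : {multiplicative G -> H}).

Section PreimClosed.
Variable S : groupClosed H.
Definition preim_pred : {pred G} := fun x => f x \in S.
Fact preim_pred1 : 1 \in preim_pred.
Proof. by rewrite -[_ \in _]/(f 1 \in S) hom1 gpred1. Qed.
Fact preim_predM : mulg_closed preim_pred.
Proof.
move=> x y Sx Sy; rewrite -[_ \in _]/(f (x * y) \in S) gmulfM.
exact: gpredM Sx Sy.
Qed.
Fact preim_predV : invg_closed preim_pred.
Proof.
by move=> x Sx; rewrite -[_ \in _]/(f x^-1 \in S) homV; exact: gpredVr Sx.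
Qed.
Definition hom_preim : groupClosed G := HB.pack_for (groupClosed G) preim_pred
  (isMul1Closed.Build G preim_pred preim_pred1)
  (isMulClosed.Build G preim_pred preim_predM)
  (isInvClosed.Build G preim_pred preim_predV).

Lemma hom_preimE x : (x \in hom_preim) = (f x \in S). Proof. by []. Qed.
End PreimClosed.

Lemma preim_normal_subproof (N : normalSubgroup H) x y :
  x \in hom_preim N -> x ^ y \in hom_preim N.
Proof. by rewrite !hom_preimE /conjg !gmulfM homV; exact: nsubJ. Qed.

Definition preim_normal (N : normalSubgroup H) : normalSubgroup G :=
  @NormalSubgroup _ (hom_preim N) (@preim_normal_subproof N).

Definition ker_pred : {pred G} := fun x => f x == 1.
Fact ker_pred1 : 1 \in ker_pred.
Proof. by rewrite unfold_in hom1. Qed.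
Fact ker_predM : mulg_closed ker_pred.
Proof.
by move=> x y; rewrite !unfold_in gmulfM => /eqP-> /eqP->; rewrite mulg1.
Qed.
Fact ker_predV : invg_closed ker_pred.
Proof. by move=> x; rewrite !unfold_in homV => /eqP->; rewrite invg1. Qed.
Definition hom_ker : groupClosed G := HB.pack_for (groupClosed G) ker_pred
  (isMul1Closed.Build G ker_pred ker_pred1)
  (isMulClosed.Build G ker_pred ker_predM)
  (isInvClosed.Build G ker_pred ker_predV).

Lemma hom_kerE x : (x \in hom_ker) = (f x == 1). Proof. by []. Qed.

End Preimage.

Section Quotient.
Variables (G : groupType) (N : normalSubgroup G).

Definition coset_eq : rel G := fun x y => x^-1 * y \in N.

Fact coset_eq_refl : reflexive coset_eq.
Proof. by move=> x; rewrite /coset_eq mulVg gpred1. Qed.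
Fact coset_eq_sym : symmetric coset_eq.
Proof. by move=> x y; rewrite /coset_eq -gpredV invgM invgK. Qed.
Fact coset_eq_trans : transitive coset_eq.
Proof.
move=> y x z; rewrite /coset_eq => xy yz.
by have := gpredM _ _ xy yz; rewrite mulgA mulgK.
Qed.
Canonical coset_equiv :=
  EquivRel coset_eq coset_eq_refl coset_eq_sym coset_eq_trans.

Definition quo : Type := {eq_quot coset_equiv}%qT.
HB.instance Definition _ := Choice.on quo.

Definition qpi (x : G) : quo := (\pi_({eq_quot coset_equiv}) x)%qT.
Definition qrepr (u : quo) : G := repr (u : {eq_quot coset_equiv}%qT).

Lemma qreprK u : qpi (qrepr u) = u. Proof. exact: reprK. Qed.

Lemma qpiP x y : qpi x = qpi y <-> x^-1 * y \in N.
Proof. by split=> [/eqmodP //|h]; apply/eqmodP. Qed.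

Definition qone : quo := qpi 1.
Definition qmul (u v : quo) : quo := qpi (qrepr u * qrepr v).
Definition qinv (u : quo) : quo := qpi (qrepr u)^-1.

Lemma qpi_mul x y : qmul (qpi x) (qpi y) = qpi (x * y).
Proof.
apply/qpiP; set x' := qrepr _; set y' := qrepr _.
have hx : x'^-1 * x \in N by apply/qpiP; rewrite qreprK.
have hy : y'^-1 * y \in N by apply/qpiP; rewrite qreprK.
have -> : (x' * y')^-1 * (x * y) = (x'^-1 * x) ^ y' * (y'^-1 * y).
  by rewrite invgM /conjg !mulgA mulgK.
by rewrite gpredM ?nsubJ.
Qed.

Lemma qpi_inv x : qinv (qpi x) = qpi x^-1.
Proof.
apply/qpiP; set x' := qrepr _.
have hx : x'^-1 * x \in N by apply/qpiP; rewrite qreprK.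
rewrite invgK; have -> : x' * x^-1 = ((x'^-1 * x) ^ x^-1)^-1.
  by rewrite /conjg invgK -!mulgA mulgV mulg1 invgM invgK.
by rewrite gpredVr ?nsubJ.
Qed.

Fact qmulA : associative qmul.
Proof.
by move=> u v w; rewrite -(qreprK u) -(qreprK v) -(qreprK w) !qpi_mul mulgA.
Qed.
Fact qmul1 : left_id qone qmul.
Proof. by move=> u; rewrite -(qreprK u) qpi_mul mul1g. Qed.
Fact qmulr1 : right_id qone qmul.
Proof. by move=> u; rewrite -(qreprK u) qpi_mul mulg1. Qed.
Fact qmulV : left_inverse qone qinv qmul.
Proof. by move=> u; rewrite -(qreprK u) qpi_inv qpi_mul mulVg. Qed.
Fact qmulrV : right_inverse qone qinv qmul.
Proof. by move=> u; rewrite -(qreprK u) qpi_inv qpi_mul mulgV. Qed.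
HB.instance Definition _ :=
  isGroup.Build quo qmulA qmul1 qmulr1 qmulV qmulrV.

Fact qpiM : {morph qpi : x y / x * y}.
Proof. by move=> x y; rewrite -qpi_mul. Qed.
HB.instance Definition _ := isMultiplicative.Build G quo qpi qpiM.

Lemma qpi_eq1 x : qpi x = 1 <-> x \in N.
Proof. by split=> [/qpiP|h]; [|apply/qpiP]; rewrite mulg1 gpredV. Qed.

Section Lift.
Variables (H : groupType) (f : {multiplicative G -> H}).
Hypothesis fN : forall x, x \in N -> f x = 1.

Definition qlift (u : quo) : H := f (qrepr u).

Lemma qliftE x : qlift (qpi x) = f x.
Proof.
rewrite /qlift; apply: (@mulgI _ (f (qrepr (qpi x)))^-1).
by rewrite mulVg -homV -gmulfM fN //; apply/qpiP; rewrite qreprK.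
Qed.

Fact qliftM : {morph qlift : u v / u * v}.
Proof.
move=> u v; rewrite -(qreprK u) -(qreprK v) -qpiM !qliftE; exact: gmulfM.
Qed.

Definition quo_lift : {multiplicative quo -> H} :=
  HB.pack_for {multiplicative quo -> H} qlift
    (isMultiplicative.Build quo H qlift qliftM).

End Lift.

End Quotient.

Record gaction (Gam G : groupType) := GAction {
  gact :> Gam -> G -> G;
  gactM : forall g, {morph gact g : x y / x * y};
  gact1 : forall x, gact 1 x = x;
  gactA : forall g h x, gact (g * h) x = gact g (gact h x) }.

Section ActionTheory.
Variables (Gam G : groupType) (a : gaction Gam G).

Definition act_hom g : {multiplicative G -> G} :=
  HB.pack_for {multiplicative G -> G} (a g)
    (isMultiplicative.Build G G (a g) (gactM a g)).

Lemma gact_one g : a g 1 = 1. Proof. exact: (hom1 (act_hom g)). Qed.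
Lemma gactV g : {morph a g : x / x^-1}. Proof. exact: (homV (act_hom g)). Qed.

(* The normal subgroup [\Gamma G] and the coinvariants [G_\Gamma].           *)
Definition Gamma_sub : normalSubgroup G :=
  ncl [set z | exists g x, z = a g x * x^-1]%classic.
Definition coinv : groupType := quo Gamma_sub.

Section Restriction.
Variable S : groupClosed G.
Hypothesis aS : forall g x, x \in S -> a g x \in S.

Definition restr_fun g (x : subgrp S) : subgrp S :=
  exist _ (a g (val x)) (aS g (valP x)).
Fact restr_funM g : {morph restr_fun g : x y / x * y}.
Proof. by move=> x y; apply: val_inj => /=; rewrite gactM. Qed.
Fact restr_fun1 x : restr_fun 1 x = x.
Proof. by apply: val_inj => /=; rewrite gact1. Qed.
Fact restr_funA g h x : restr_fun (g * h) x = restr_fun g (restr_fun h x).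
Proof. by apply: val_inj => /=; rewrite gactA. Qed.
Definition restr_act : gaction Gam (subgrp S) :=
  GAction restr_funM restr_fun1 restr_funA.
End Restriction.

Section QuotientAction.
Variable N : normalSubgroup G.
Hypothesis aN : forall g x, x \in N -> a g x \in N.

Fact quo_act_ker g x : x \in N -> @qpi G N (a g x) = 1.
Proof. by move=> /(aN g) xN; apply/qpi_eq1. Qed.

Fact qpi_actM g : {morph (fun x => @qpi G N (a g x)) : x y / x * y}.
Proof. by move=> x y; rewrite gactM qpiM. Qed.
Definition qpi_act g : {multiplicative G -> quo N} :=
  HB.pack_for {multiplicative G -> quo N} (fun x => @qpi G N (a g x))
    (isMultiplicative.Build G (quo N) _ (qpi_actM g)).

Definition quo_fun g : {multiplicative quo N -> quo N} :=
  quo_lift (f := qpi_act g) (@quo_act_ker g).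
Fact quo_funE g x : quo_fun g (qpi N x) = qpi N (a g x).
Proof. exact: (qliftE (f := qpi_act g) (@quo_act_ker g)). Qed.
Fact quo_fun1 u : quo_fun 1 u = u.
Proof. by rewrite -(qreprK u) quo_funE gact1. Qed.
Fact quo_funA g h u : quo_fun (g * h) u = quo_fun g (quo_fun h u).
Proof. by rewrite -(qreprK u) !quo_funE gactA. Qed.
Definition quo_act : gaction Gam (quo N) := 
  GAction (fun g => @gmulfM _ _ (quo_fun g)) quo_fun1 quo_funA.
End QuotientAction.

End ActionTheory.

Section CoinvariantMap.
Variables (Gam G H : groupType) (a : gaction Gam G) (b : gaction Gam H).
Variable f : {multiplicative G -> H}.
Hypothesis fab : forall g x, f (a g x) = b g (f x).

Fact coinv_map_kerM :
  {morph (fun x => @qpi H (Gamma_sub b) (f x)) : x y / x * y}.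
Proof. by move=> x y; rewrite gmulfM qpiM. Qed.
Definition coinv_pre : {multiplicative G -> coinv b} :=
  HB.pack_for {multiplicative G -> coinv b}
    (fun x => qpi (Gamma_sub b) (f x))
    (isMultiplicative.Build G (coinv b) _ coinv_map_kerM).

Fact coinv_pre_ker x : x \in Gamma_sub a -> coinv_pre x = 1.
Proof.
move=> xa; apply/qpi_eq1; rewrite -hom_preimE.
apply: (ncl_min (N := preim_normal f (Gamma_sub b))) xa => _ [g [y ->]].
by rewrite hom_preimE gmulfM homV fab; apply: mem_ncl; exists g, (f y).
Qed.

Definition coinv_map : {multiplicative coinv a -> coinv b} :=
  quo_lift coinv_pre_ker.

End CoinvariantMap.

Section Presentation.
Variable X : choiceType.

(* Words in the letters x and x^-1; the letter [(true, x)] stands for x^-1.   *)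
Definition word := seq (bool * X).
Definition wgen (x : X) : word := [:: (false, x)].
Definition winv (w : word) : word := [seq (~~ l.1, l.2) | l <- rev w].
Definition wcomm (u v : word) : word := u ++ v ++ winv u ++ winv v.

Variable R : word -> word -> Prop.

Inductive presP : word -> word -> Prop :=
| presP_refl w : presP w w
| presP_sym u v : presP u v -> presP v u
| presP_trans u v w : presP u v -> presP v w -> presP u w
| presP_cat u u' v v' : presP u u' -> presP v v' -> presP (u ++ v) (u' ++ v')
| presP_cancel l : presP [:: l; (~~ l.1, l.2)] [::]
| presP_rel u v : R u v -> presP u v.

Definition pres_eq : rel word := fun u v => `[< presP u v >].
Fact pres_eq_refl : reflexive pres_eq.
Proof. by move=> w; apply/asboolP; exact: presP_refl. Qed.
Fact pres_eq_sym : symmetric pres_eq.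
Proof.
by move=> u v; apply/idP/idP => /asboolP h; apply/asboolP; exact: presP_sym.
Qed.
Fact pres_eq_trans : transitive pres_eq.
Proof.
by move=> v u w /asboolP uv /asboolP vw; apply/asboolP; exact: presP_trans vw.
Qed.
Canonical pres_equiv :=
  EquivRel pres_eq pres_eq_refl pres_eq_sym pres_eq_trans.

Definition pres : Type := {eq_quot pres_equiv}%qT.
HB.instance Definition _ := Choice.on pres.

Definition ppi (w : word) : pres := (\pi_({eq_quot pres_equiv}) w)%qT.
Definition prepr (u : pres) : word := repr (u : {eq_quot pres_equiv}%qT).
Lemma preprK u : ppi (prepr u) = u. Proof. exact: reprK. Qed.
Lemma ppiP u v : ppi u = ppi v <-> presP u v.
Proof.
by split=> [/eqmodP /asboolP //|h]; apply/eqmodP; apply/asboolP.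
Qed.

Lemma winv_cat u v : winv (u ++ v) = winv v ++ winv u.
Proof. by rewrite /winv rev_cat map_cat. Qed.

Lemma winv_cons l w : winv (l :: w) = winv w ++ [:: (~~ l.1, l.2)].
Proof. by rewrite -cat1s winv_cat. Qed.

Lemma winvK : involutive winv.
Proof.
move=> w; rewrite /winv -map_rev revK -map_comp map_id_in //= => -[b x] _ /=.
by rewrite negbK.
Qed.

Lemma presP_mulV w : presP (w ++ winv w) [::].
Proof.
elim: w => [|l w IH]; first exact: presP_refl.
rewrite winv_cons -cat1s -catA [X in _ ++ X]catA.
apply: presP_trans (presP_cancel l).
rewrite -[[:: l; _]]/([:: l] ++ ([::] ++ [:: (~~ l.1, l.2)])).
by do 2?[apply: presP_cat => //; try exact: presP_refl].
Qed.

Lemma presP_Vmul w : presP (winv w ++ w) [::].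
Proof. by have := presP_mulV (winv w); rewrite winvK. Qed.

Lemma presP_winv u v : presP u v -> presP (winv u) (winv v).
Proof.
move=> uv; apply: (@presP_trans _ (winv u ++ (v ++ winv v))).
  rewrite -{1}[winv u]cats0; apply: presP_cat; first exact: presP_refl.
  exact/presP_sym/presP_mulV.
rewrite catA -{2}[winv v]cat0s; apply: presP_cat; last exact: presP_refl.
apply: presP_trans (presP_Vmul u).
by apply: presP_cat; [exact: presP_refl | exact: presP_sym].
Qed.

Definition pone : pres := ppi [::].
Definition pmul (u v : pres) : pres := ppi (prepr u ++ prepr v).
Definition pinv (u : pres) : pres := ppi (winv (prepr u)).

Lemma ppi_cat u v : pmul (ppi u) (ppi v) = ppi (u ++ v).
Proof. by apply/ppiP; apply: presP_cat; apply/ppiP; rewrite preprK. Qed.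
Lemma ppi_inv u : pinv (ppi u) = ppi (winv u).
Proof. by apply/ppiP/presP_winv/ppiP; rewrite preprK. Qed.

Fact pmulA : associative pmul.
Proof.
by move=> u v w; rewrite -(preprK u) -(preprK v) -(preprK w) !ppi_cat catA.
Qed.
Fact pmul1 : left_id pone pmul.
Proof. by move=> u; rewrite -(preprK u) ppi_cat. Qed.
Fact pmulr1 : right_id pone pmul.
Proof. by move=> u; rewrite -(preprK u) ppi_cat cats0. Qed.
Fact pmulV : left_inverse pone pinv pmul.
Proof.
move=> u; rewrite -(preprK u) ppi_inv ppi_cat.
by apply/ppiP; exact: presP_Vmul.
Qed.
Fact pmulrV : right_inverse pone pinv pmul.
Proof.
move=> u; rewrite -(preprK u) ppi_inv ppi_cat.
by apply/ppiP; exact: presP_mulV.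
Qed.
HB.instance Definition _ :=
  isGroup.Build pres pmulA pmul1 pmulr1 pmulV pmulrV.

Lemma ppiM u v : ppi (u ++ v) = ppi u * ppi v.
Proof. by rewrite -ppi_cat. Qed.
Lemma ppiV u : ppi (winv u) = (ppi u)^-1.
Proof. by rewrite -ppi_inv. Qed.

Definition pgen (x : X) : pres := ppi (wgen x).

Lemma pres_ind (P : pres -> Prop) : P 1 -> (forall x, P (pgen x)) ->
  (forall u v, P u -> P v -> P (u * v)) -> (forall u, P u -> P u^-1) ->
  forall u, P u.
Proof.
move=> P1 Pg PM PV u; rewrite -(preprK u); elim: (prepr u) => [//|[b x] w IH].
rewrite -cat1s ppiM; apply: PM => //; case: b; last exact: Pg.
by rewrite -[[:: _]]/(winv (wgen x)) ppiV; exact/PV/Pg.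
Qed.

Section Lift.
Variables (H : groupType) (f : X -> H).

Definition weval (w : word) : H :=
  foldr (fun l h => (if l.1 then (f l.2)^-1 else f l.2) * h) 1 w.

Lemma weval_cat u v : weval (u ++ v) = weval u * weval v.
Proof. by elim: u => [|l u IH] /=; rewrite ?mul1g // IH mulgA. Qed.

Lemma weval_gen x : weval (wgen x) = f x.
Proof. by rewrite /= mulg1. Qed.

Lemma weval_inv w : weval (winv w) = (weval w)^-1.
Proof.
elim: w => [|[b x] w IH]; first by rewrite /= invg1.
rewrite winv_cons weval_cat IH /= mulg1 invgM; congr (_ * _).
by case: b; rewrite /= ?invgK.
Qed.

Lemma weval_comm u v :
  weval (wcomm u v) = weval u * weval v * (weval u)^-1 * (weval v)^-1.
Proof. by rewrite /wcomm !weval_cat !weval_inv !mulgA. Qed.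

Hypothesis fR : forall u v, R u v -> weval u = weval v.

Fact weval_presP u v : presP u v -> weval u = weval v.
Proof.
elim=> {u v} [//|u v _ -> //|u v w _ -> _ -> //|u u' v v' _ h _ h'|[[] x]|//].
- by rewrite !weval_cat h h'.
- by rewrite /= mulg1 mulVg.
- by rewrite /= mulg1 mulgV.
Qed.

Definition plift (u : pres) : H := weval (prepr u).

Lemma plift_ppi w : plift (ppi w) = weval w.
Proof. by apply: weval_presP; apply/ppiP; rewrite preprK. Qed.

Fact pliftM : {morph plift : u v / u * v}.
Proof.
move=> u v; rewrite -(preprK u) -(preprK v) -ppiM !plift_ppi.
exact: weval_cat.
Qed.

Definition pres_lift : {multiplicative pres -> H} :=
  HB.pack_for {multiplicative pres -> H} plift
    (isMultiplicative.Build pres H plift pliftM).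

Lemma pres_liftE x : pres_lift (pgen x) = f x.
Proof. by rewrite [LHS]plift_ppi weval_gen. Qed.

End Lift.

Lemma pres_hom_ext (H : groupType) (f f' : {multiplicative pres -> H}) :
  (forall x, f (pgen x) = f' (pgen x)) -> f =1 f'.
Proof.
move=> ff'; apply: pres_ind => [||u v hu hv|u hu].
- by rewrite !hom1.
- exact: ff'.
- by rewrite !gmulfM hu hv.
- by rewrite !homV hu.
Qed.

Lemma weval_pgen w : weval pgen w = ppi w.
Proof.
elim: w => [//|[b x] w IH]; rewrite -cat1s ppiM /= IH; congr (_ * _).
by case: b => //; rewrite -[[:: _]]/(winv (wgen x)) ppiV.
Qed.

Section PresAction.
Variables (Gam : groupType) (s : Gam -> X -> X).
Hypothesis s1 : forall x, s 1 x = x.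
Hypothesis sM : forall g h x, s (g * h) x = s g (s h x).
Definition wmap (t : X -> X) : word -> word := map (fun l => (l.1, t l.2)).
Hypothesis sR : forall g u v, R u v -> R (wmap (s g) u) (wmap (s g) v).

Lemma weval_wmap (H : groupType) (f : X -> H) t w :
  weval (fun x => f (t x)) w = weval f (wmap t w).
Proof. by elim: w => //= l w ->. Qed.

Fact pres_act_rel g u v : R u v ->
  weval (fun x => pgen (s g x)) u = weval (fun x => pgen (s g x)) v.
Proof.
by move=> uv; rewrite !weval_wmap !weval_pgen; apply/ppiP/presP_rel/sR.
Qed.

Definition pres_fun g : {multiplicative pres -> pres} :=
  pres_lift (@pres_act_rel g).
Fact pres_fun1 u : pres_fun 1 u = u.
Proof.
elim/pres_ind: u => [|x|u v hu hv|u hu].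
- exact: hom1.
- by rewrite pres_liftE s1.
- by rewrite gmulfM hu hv.
- by rewrite homV hu.
Qed.
Fact pres_funA g h u : pres_fun (g * h) u = pres_fun g (pres_fun h u).
Proof.
elim/pres_ind: u => [|x|u v hu hv|u hu].
- by rewrite !hom1.
- by rewrite !pres_liftE sM.
- by rewrite !gmulfM hu hv.
- by rewrite !homV hu.
Qed.
Definition pres_act : gaction Gam pres :=
  GAction (fun g => @gmulfM _ _ (pres_fun g)) pres_fun1 pres_funA.

Lemma pres_actE g x : pres_act g (pgen x) = pgen (s g x).
Proof. exact: pres_liftE. Qed.

End PresAction.

End Presentation.

(* A group acting on a ring; by [ract1] and [ractA] every [ract g] is an       *)
(* automorphism.                                                              *)
Record raction (Gam : groupType) (A : nzRingType) := RAction {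
  ract :> Gam -> {rmorphism A -> A};
  ract1 : forall x, ract 1 x = x;
  ractA : forall g h x, ract (g * h) x = ract g (ract h x) }.

Section MonoidUnits.
Variable M : monoidType.

Definition minv_of (x y : M) : Prop := x * y = 1 /\ y * x = 1.
Definition munits : Type := {x : M | `[< exists y, minv_of x y >]}.
HB.instance Definition _ := SubChoice.on munits.

Definition MUnit (x y : M) (xy : minv_of x y) : munits :=
  exist _ x (introT (asboolP _) (ex_intro _ y xy)).

Lemma munitsP (x : munits) : {y | minv_of (val x) y}.
Proof. by apply: cid; apply/asboolP; exact: valP x. Qed.

Definition mu_one : munits := MUnit (conj (mul1g 1) (mul1g 1)).
Fact mu_mulP (x y : munits) : minv_of (val x * val y)
  (sval (munitsP y) * sval (munitsP x)).
Proof.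
case: (munitsP x) (munitsP y) => [x' [xx' x'x]] [y' [yy' y'y]] /=; split.
  by rewrite mulgA -(mulgA (val x)) yy' mulg1.
by rewrite mulgA -(mulgA y') x'x mulg1.
Qed.
Definition mu_mul (x y : munits) : munits := MUnit (mu_mulP x y).
Fact mu_invP (x : munits) : minv_of (sval (munitsP x)) (val x).
Proof. by case: (munitsP x) => [y []]. Qed.
Definition mu_inv (x : munits) : munits := MUnit (mu_invP x).

Fact mu_mulA : associative mu_mul.
Proof. by move=> x y z; apply: val_inj; exact: mulgA. Qed.
Fact mu_mul1 : left_id mu_one mu_mul.
Proof. by move=> x; apply: val_inj; exact: mul1g. Qed.
Fact mu_mulr1 : right_id mu_one mu_mul.
Proof. by move=> x; apply: val_inj; exact: mulg1. Qed.
Fact mu_mulV : left_inverse mu_one mu_inv mu_mul.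
Proof. by move=> x; apply: val_inj; exact: (mu_invP x).1. Qed.
Fact mu_mulrV : right_inverse mu_one mu_inv mu_mul.
Proof. by move=> x; apply: val_inj; exact: (mu_invP x).2. Qed.
HB.instance Definition _ :=
  isGroup.Build munits mu_mulA mu_mul1 mu_mulr1 mu_mulV mu_mulrV.

End MonoidUnits.

Section StableMatrices.
Variable A : nzRingType.
Local Open Scope ring_scope.

(* Matrices indexed by N x N that differ from the identity only in a finite   *)
(* upper-left block; those that are invertible form the direct limit GL(A) of *)
(* the groups GL_n(A).                                                        *)
Definition stable_from (n : nat) (M : nat -> nat -> A) : Prop :=
  forall i j, (n <= i)%N || (n <= j)%N -> M i j = (i == j)%:R.
Definition smx : Type :=
  {M : nat -> nat -> A | `[< exists n, stable_from n M >]}.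
HB.instance Definition _ := SubChoice.on smx.

Definition smx_mul_fun (M N : nat -> nat -> A) i j : A :=
  \sum_(k \in [set: nat]) M i k * N k j.

Lemma stable_fromW m n M : (m <= n)%N -> stable_from m M -> stable_from n M.
Proof.
move=> mn Mm i j nij; apply: Mm.
by case/orP: nij => h; rewrite (leq_trans mn h) ?orbT.
Qed.

Lemma smx_mul_funE n M N i j : stable_from n M -> (i < n)%N ->
  smx_mul_fun M N i j = \sum_(k < n) M i k * N k j.
Proof.
move=> Mn lin; rewrite [RHS](fsbig_ord _ n (fun k => M i k * N k j)).
apply/esym/fsbig_widen => // k [_ /negP nk].
rewrite -leqNgt in nk.
rewrite /preimage /= Mn ?nk ?orbT // (_ : (i == k) = false) ?mul0r //.
by apply/negbTE; rewrite neq_ltn (leq_trans lin nk).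
Qed.

Lemma smx_mul_stable n M N : stable_from n M -> stable_from n N ->
  stable_from n (smx_mul_fun M N).
Proof.
move=> Mn Nn i j nij.
pose m := maxn n (maxn i.+1 j.+1).
have nm : (n <= m)%N by rewrite leq_maxl.
have im : (i < m)%N by rewrite !leq_max leqnn orbT.
have jm : (j < m)%N by rewrite !leq_max leqnn !orbT.
rewrite (smx_mul_funE _ _ (stable_fromW nm Mn) im).
case/orP: nij => h.
  rewrite (bigD1 (Ordinal im)) //= Mn ?h // eqxx mul1r big1 ?addr0 ?Nn ?h //.
  move=> k /negbTE ki; rewrite Mn ?h // -[i]/(val (Ordinal im)).
  by rewrite (inj_eq val_inj) eq_sym ki mul0r.
rewrite (bigD1 (Ordinal jm)) //= Nn ?h ?orbT // eqxx mulr1.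
rewrite big1 ?addr0 ?Mn ?h ?orbT //.
move=> k /negbTE kj; rewrite Nn ?h ?orbT // -[j]/(val (Ordinal jm)).
by rewrite (inj_eq val_inj) kj mulr0.
Qed.

Lemma smxP (M : smx) : exists n, stable_from n (val M).
Proof. by apply/asboolP; exact: valP M. Qed.

Definition SMx M n (h : stable_from n M) : smx :=
  exist _ M (introT (asboolP _) (ex_intro _ n h)).

Fact smx_one_subproof : stable_from 0 (fun i j => (i == j)%:R).
Proof. by []. Qed.
Definition smx_one : smx := SMx smx_one_subproof.

Fact smx_mul_subproof (M N : smx) :
  `[< exists n, stable_from n (smx_mul_fun (val M) (val N)) >].
Proof.
apply/asboolP; have [m Mm] := smxP M; have [n Nn] := smxP N.
exists (maxn m n); apply: smx_mul_stable.
- exact: stable_fromW (leq_maxl _ _) Mm.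
- exact: stable_fromW (leq_maxr _ _) Nn.
Qed.
Definition smx_mul (M N : smx) : smx :=
  exist _ (smx_mul_fun (val M) (val N)) (smx_mul_subproof M N).

Lemma smx_eqP (M N : smx) : (forall i j, val M i j = val N i j) -> M = N.
Proof. by move=> MN; apply/val_inj/funext => i; apply/funext => j. Qed.

Fact smx_mulA : associative smx_mul.
Proof.
move=> L M N; apply: smx_eqP => i j /=.
have [l Ll] := smxP L; have [m Mm] := smxP M.
pose n := maxn i.+1 (maxn l m).
have lin : (i < n)%N by rewrite leq_max leqnn.
have Ln : stable_from n (val L).
  by apply: stable_fromW Ll; rewrite !leq_max leqnn !orbT.
have Mn : stable_from n (val M).
  by apply: stable_fromW Mm; rewrite !leq_max leqnn !orbT.
rewrite (smx_mul_funE _ _ Ln lin) (smx_mul_funE _ _ (smx_mul_stable Ln Mn) lin).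
under eq_bigr => k _ do rewrite (smx_mul_funE _ _ Mn (ltn_ord k)) mulr_sumr.
under [RHS]eq_bigr => k _ do rewrite (smx_mul_funE _ _ Ln lin) mulr_suml.
rewrite exchange_big /=; apply: eq_bigr => k _; apply: eq_bigr => k' _.
by rewrite mulrA.
Qed.

Fact smx_mul1 : left_id smx_one smx_mul.
Proof.
move=> M; apply: smx_eqP => i j /=.
have h : stable_from i.+1 (fun i j => (i == j)%:R : A) by [].
rewrite (smx_mul_funE _ _ h (ltnSn i)) (bigD1 ord_max) //= eqxx mul1r.
rewrite big1 ?addr0 // => k /negbTE ki.
by rewrite -[i in i == _]/(val (@ord_max i)) (inj_eq val_inj) eq_sym ki mul0r.
Qed.

Fact smx_mulr1 : right_id smx_one smx_mul.
Proof.
move=> M; apply: smx_eqP => i j /=.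
have [m Mm] := smxP M; pose n := maxn m (maxn i.+1 j.+1).
have im : (i < n)%N by rewrite !leq_max leqnn orbT.
have jm : (j < n)%N by rewrite !leq_max leqnn !orbT.
rewrite (smx_mul_funE _ _ (stable_fromW (leq_maxl _ _ : (m <= n)%N) Mm) im).
rewrite (bigD1 (Ordinal jm)) //= eqxx mulr1 big1 ?addr0 // => k /negbTE kj.
by rewrite -[j]/(val (Ordinal jm)) (inj_eq val_inj) kj mulr0.
Qed.

HB.instance Definition _ := isMonoid.Build smx smx_mulA smx_mul1 smx_mulr1.

Definition GL : groupType := munits smx.

Definition offdiag : Type := {p : nat * nat | p.1 != p.2}.
HB.instance Definition _ := SubChoice.on offdiag.

(* The elementary matrix e_ij(a), equal to a at (i, j) and to the identity    *)
(* elsewhere.                                                                 *)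
Definition elem_fun (p : offdiag) (a : A) (i j : nat) : A :=
  if (i, j) == val p then a else (i == j)%:R.

Fact elem_stable p a : stable_from (maxn (val p).1 (val p).2).+1 (elem_fun p a).
Proof.
move=> i j nij; rewrite /elem_fun; case: eqP => // pij.
by move: nij; rewrite -pij /= !gtn_max !ltnn ?andbF.
Qed.
Definition elem_smx (p : offdiag) (a : A) : smx := SMx (@elem_stable p a).

Lemma elem_smxE p a i j : val (elem_smx p a) i j =
  (i == j)%:R + (if (i == (val p).1) && (j == (val p).2) then a else 0).
Proof.
rewrite /= /elem_fun -pair_eqE /pair_eq /=.
case: ifP => [/andP[/eqP-> /eqP->]|_]; last by rewrite addr0.
by rewrite (negbTE (valP p)) add0r.
Qed.

Lemma elem_mulE p a (M : smx) i j : val (elem_smx p a * M)%g i j =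
  val M i j + (if i == (val p).1 then a * val M (val p).2 j else 0).
Proof.
set p1 := (val p).1; set p2 := (val p).2.
pose n := maxn i.+1 (maxn p1 p2).+1.
have lin : (i < n)%N by rewrite leq_max leqnn.
have lp2 : (p2 < n)%N by apply: leq_trans (leq_maxr _ _); rewrite ltnS leq_maxr.
have h : stable_from n (val (elem_smx p a)).
  exact: stable_fromW (leq_maxr _ _) (@elem_stable p a).
rewrite [LHS](smx_mul_funE _ _ h lin).
under eq_bigr => k _ do rewrite elem_smxE mulrDl.
rewrite big_split /=; congr (_ + _).
  rewrite (bigD1 (Ordinal lin)) //= eqxx mul1r big1 ?addr0 // => k /negbTE ki.
  rewrite -[i in i == _]/(val (Ordinal lin)) (inj_eq val_inj) eq_sym ki.
  exact: mul0r.
rewrite (bigD1 (Ordinal lp2)) //= eqxx andbT.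
rewrite big1 ?addr0; first by case: ifP => // _; rewrite mul0r.
move=> k /negbTE kp.
by rewrite -[(val p).2]/(val (Ordinal lp2)) (inj_eq val_inj) kp andbF mul0r.
Qed.

Lemma elem_add p a b : (elem_smx p a * elem_smx p b)%g = elem_smx p (a + b).
Proof.
apply: smx_eqP => i j; rewrite elem_mulE !elem_smxE.
rewrite [(val p).2 == (val p).1]eq_sym (negbTE (valP p)) addr0 -addrA.
congr (_ + _); case: (i == _) => /=; last by rewrite addr0.
rewrite [_ == j]eq_sym; case: (j == _) => /=; first by rewrite mulr1 addrC.
by rewrite mulr0 addr0.
Qed.

Lemma elem_0 p : elem_smx p 0 = 1%g.
Proof. by apply: smx_eqP => i j; rewrite elem_smxE if_same addr0. Qed.

Fact elem_inv p a : minv_of (elem_smx p a) (elem_smx p (- a)).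
Proof. by split; rewrite elem_add ?subrr ?addNr elem_0. Qed.

Definition elem_GL (p : offdiag) (a : A) : GL := MUnit (elem_inv p a).

(* The stable elementary group, generated by all e_ij(a).                     *)
Definition E_sub : groupClosed GL :=
  gen [set x | exists p a, x = elem_GL p a]%classic.
Definition E : groupType := subgrp E_sub.

Fact elem_GL_in p a : elem_GL p a \in E_sub.
Proof. by apply: mem_gen; exists p, a. Qed.
Definition elem (p : offdiag) (a : A) : E :=
  exist _ (elem_GL p a) (elem_GL_in p a).

(* [st_word i j h a] is the generator x_ij(a); indices are counted from 0.    *)
Definition st_word (i j : nat) (h : i != j) (a : A) :
  word (offdiag * A)%type :=
  wgen (exist _ (i, j) h, a).

Inductive st_rel : word (offdiag * A)%type -> word (offdiag * A)%type -> Prop :=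
| st_rel_add (i j : nat) (h : i != j) a b :
    st_rel (st_word h a ++ st_word h b) (st_word h (a + b))
| st_rel_comm (i j k : nat) (hij : i != j) (hjk : j != k) (hik : i != k) a b :
    st_rel (wcomm (st_word hij a) (st_word hjk b)) (st_word hik (a * b))
| st_rel_comm1 (i j k l : nat) (hij : i != j) (hkl : k != l) a b :
    j != k -> i != l -> st_rel (wcomm (st_word hij a) (st_word hkl b)) [::].

Definition St : groupType := pres st_rel.

(* The generator x_ij(a) of the Steinberg group, for the position p = (i, j). *)
Definition st_gen (p : offdiag) (a : A) : St := pgen st_rel (p, a).

Lemma elem_comm (i j k : nat) (hij : i != j) (hjk : j != k) (hik : i != k) a b :
  (elem_smx (exist _ (i, j) hij) a * elem_smx (exist _ (j, k) hjk) b =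
   elem_smx (exist _ (i, k) hik) (a * b) *
   (elem_smx (exist _ (j, k) hjk) b * elem_smx (exist _ (i, j) hij) a))%g.
Proof.
apply: smx_eqP => x y; rewrite !elem_mulE !elem_smxE /=.
rewrite eqxx [k == i]eq_sym (negbTE hik) [k == j]eq_sym (negbTE hjk) /= !addr0.
rewrite ![_ == y]eq_sym; case: (eqVneq x i) => [->|xi] /=; last first.
  rewrite !addr0; case: (x == j) => //=.
  by case: (y == k); rewrite ?mulr1 ?mulr0.
rewrite (negbTE hij) /= !addr0 mulrDr addrA; congr (_ + _ + _).
  by case: (y == j); rewrite ?mulr1 ?mulr0.
by case: (y == k); rewrite ?mulr1 ?mulr0.
Qed.

Lemma elem_comm1 (i j k l : nat) (hij : i != j) (hkl : k != l) a b :
  j != k -> i != l ->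
  (elem_smx (exist _ (i, j) hij) a * elem_smx (exist _ (k, l) hkl) b =
   elem_smx (exist _ (k, l) hkl) b * elem_smx (exist _ (i, j) hij) a)%g.
Proof.
move=> jk il; apply: smx_eqP => x y; rewrite !elem_mulE !elem_smxE /=.
rewrite (negbTE jk) [l == i]eq_sym (negbTE il) /= !addr0.
rewrite -!addrA; congr (_ + _).
case: (x == k); case: (x == i) => /=; rewrite ?addr0 ?add0r //.
- rewrite addrC !(eq_sym _ y).
  by congr (_ + _); case: (y == _); rewrite ?mulr1 ?mulr0.
- by rewrite !(eq_sym _ y); case: (y == _); rewrite ?mulr1 ?mulr0.
- by rewrite !(eq_sym _ y); case: (y == _); rewrite ?mulr1 ?mulr0.
Qed.

End StableMatrices.

Section Phi.
Variable A : nzRingType.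

Fact elem_rel (u v : word (offdiag * A)%type) : st_rel u v ->
  weval (fun x => elem x.1 x.2) u = weval (fun x => elem x.1 x.2) v.
Proof.
case=> {u v} [i j h x y|i j k hij hjk hik x y|i j k l hij hkl x y jk il].
- rewrite weval_cat !weval_gen.
  by apply/val_inj/val_inj; exact: elem_add.
- rewrite weval_comm !weval_gen /=.
  apply: (canLR (mulgK _)); apply: (canLR (mulgK _)); rewrite -mulgA.
  by apply/val_inj/val_inj; exact: elem_comm.
- rewrite weval_comm !weval_gen /=.
  apply: (canLR (mulgK _)); apply: (canLR (mulgK _)); rewrite mul1g.
  by apply/val_inj/val_inj; exact: elem_comm1.
Qed.

(* The canonical surjection St(A) -> E(A), x_ij(a) |-> e_ij(a).               *)
Definition phi : {multiplicative St A -> E A} := pres_lift elem_rel.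

Lemma phiE p a : phi (st_gen p a) = elem p a.
Proof. exact: pres_liftE. Qed.

Definition K2_sub : groupClosed (St A) := hom_ker phi.
Definition K2 : groupType := subgrp K2_sub.

End Phi.

Section EntrywiseAction.
Variables (Gam : groupType) (A : nzRingType) (r : raction Gam A).
Local Open Scope ring_scope.

Fact map_stable (f : {rmorphism A -> A}) n (M : nat -> nat -> A) :
  stable_from n M -> stable_from n (fun i j => f (M i j)).
Proof. by move=> Mn i j nij; rewrite Mn // rmorph_nat. Qed.

Fact smx_act_subproof g (M : smx A) :
  `[< exists n, stable_from n (fun i j => r g (val M i j)) >].
Proof.
by apply/asboolP; have [n Mn] := smxP M; exists n; exact: map_stable.
Qed.
Definition smx_act g (M : smx A) : smx A :=
  exist _ (fun i j => r g (val M i j)) (smx_act_subproof g M).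

Fact smx_actM g : {morph smx_act g : M N / (M * N)%g}.
Proof.
move=> M N; apply: smx_eqP => i j /=; have [m Mm] := smxP M.
have Mn := stable_fromW (leq_maxl m i.+1) Mm.
have lin : (i < maxn m i.+1)%N by rewrite leq_max leqnn orbT.
rewrite [LHS](congr1 (r g) (smx_mul_funE _ _ Mn lin)) rmorph_sum /=.
rewrite [RHS](smx_mul_funE _ _ (map_stable (r g) Mn) lin).
by apply: eq_bigr => k _; rewrite rmorphM.
Qed.

Fact smx_act1 g : smx_act g 1%g = 1%g.
Proof. by apply: smx_eqP => i j /=; rewrite rmorph_nat. Qed.

Fact GL_act_subproof g (x : GL A) :
  minv_of (smx_act g (val x)) (smx_act g (sval (munitsP x))).
Proof.
by case: (munitsP x) => y [xy yx]; split; rewrite -smx_actM ?xy ?yx smx_act1.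
Qed.
Definition GL_fun g (x : GL A) : GL A := MUnit (GL_act_subproof g x).

Fact GL_funM g : {morph GL_fun g : x y / (x * y)%g}.
Proof. by move=> x y; apply: val_inj; exact: smx_actM. Qed.
Fact GL_fun1 x : GL_fun 1%g x = x.
Proof. by apply/val_inj/smx_eqP => i j /=; rewrite ract1. Qed.
Fact GL_funA g h x : GL_fun (g * h)%g x = GL_fun g (GL_fun h x).
Proof. by apply/val_inj/smx_eqP => i j /=; rewrite ractA. Qed.
Definition GL_act : gaction Gam (GL A) := GAction GL_funM GL_fun1 GL_funA.

Lemma GL_act_elem g p a : GL_act g (elem_GL p a) = elem_GL p (r g a).
Proof.
apply/val_inj/smx_eqP => i j /=; rewrite /elem_fun.
by case: eqP => // _; rewrite rmorph_nat.
Qed.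

Fact E_stable g x : x \in E_sub A -> GL_act g x \in E_sub A.
Proof.
rewrite -(hom_preimE (act_hom GL_act g)) => xE.
rewrite genE in xE; move/asboolP: xE.
elim=> {x} [_ [p [a ->]]||x y _ hx _ hy|x _ hx].
- by rewrite hom_preimE [act_hom _ _ _]GL_act_elem; exact: elem_GL_in.
- exact: gpred1.
- exact: gpredM hx hy.
- exact: gpredVr hx.
Qed.
Definition E_act : gaction Gam (E A) := restr_act E_stable.

Definition st_letter_act g (x : offdiag * A) : offdiag * A := (x.1, r g x.2).
Fact st_letter_act1 x : st_letter_act 1%g x = x.
Proof. by case: x => p a; rewrite /st_letter_act /= ract1. Qed.
Fact st_letter_actA g h x :
  st_letter_act (g * h)%g x = st_letter_act g (st_letter_act h x).
Proof. by rewrite /st_letter_act /= ractA. Qed.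
Fact st_letter_act_rel g (u v : word (offdiag * A)%type) : st_rel u v ->
  st_rel (wmap (st_letter_act g) u) (wmap (st_letter_act g) v).
Proof.
case=> {u v} [i j h x y|i j k hij hjk hik x y|i j k l hij hkl x y jk il].
- by rewrite /= /st_letter_act /= rmorphD; exact: st_rel_add.
- by rewrite /= /st_letter_act /= rmorphM; exact: st_rel_comm.
- exact: (@st_rel_comm1 _ _ _ _ _ hij hkl (r g x) (r g y) jk il).
Qed.
Definition St_act : gaction Gam (St A) :=
  pres_act st_letter_act1 st_letter_actA st_letter_act_rel.

Lemma St_actE g p a : St_act g (st_gen p a) = st_gen p (r g a).
Proof. exact: pres_actE. Qed.

Fact phi_equiv g x : phi A (St_act g x) = E_act g (phi A x).
Proof.
elim/pres_ind: x => [|[p a]|u v hu hv|u hu].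
- by rewrite gact_one !hom1 gact_one.
- rewrite [St_act _ _]St_actE !phiE.
  by apply: val_inj; rewrite [RHS]GL_act_elem.
- by rewrite gactM !gmulfM hu hv gactM.
- by rewrite gactV !homV hu gactV.
Qed.

Fact K2_stable g x : x \in K2_sub A -> St_act g x \in K2_sub A.
Proof.
by rewrite !hom_kerE phi_equiv => /eqP ->; rewrite gact_one.
Qed.
Definition K2_act : gaction Gam (K2 A) := restr_act K2_stable.

Definition phi_Gam : {multiplicative coinv St_act -> coinv E_act} :=
  coinv_map phi_equiv.
Definition K2_Gam : groupType := subgrp (hom_ker phi_Gam).

(* The subgroup of K_2(A) of elements lying in \Gamma St(A), and its quotient *)
(* by \Gamma K_2(A).                                                          *)
Definition K2_cap : groupType :=
  subgrp (hom_preim (@incl _ (K2_sub A)) (Gamma_sub St_act)).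
Definition Gamma_K2_in_cap : normalSubgroup K2_cap :=
  preim_normal (@incl _ _ : {multiplicative K2_cap -> K2 A}) (Gamma_sub K2_act).

Lemma Gamma_K2_sub (x : K2 A) :
  x \in Gamma_sub K2_act -> incl x \in Gamma_sub St_act.
Proof.
rewrite -hom_preimE.
apply: (ncl_min (N := preim_normal (@incl _ (K2_sub A)) _)).
move=> _ [g [y ->]]; rewrite hom_preimE gmulfM homV.
by apply: mem_ncl; exists g, (incl y).
Qed.

End EntrywiseAction.

Section TensorPower.
Variables (G : groupType) (n : nat).

(* The n-fold tensor power over Z of the abelianization of G, presented by    *)
(* the generators g_1 (x) ... (x) g_n.                                        *)
Inductive tens_rel : word {ffun 'I_n -> G} -> word {ffun 'I_n -> G} -> Prop :=
| tens_rel_mul (i : 'I_n) (f g h : {ffun 'I_n -> G}) :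
    h i = f i * g i -> (forall j, j != i -> f j = h j /\ g j = h j) ->
    tens_rel (wgen f ++ wgen g) (wgen h)
| tens_rel_comm f g : tens_rel (wgen f ++ wgen g) (wgen g ++ wgen f).

Definition tpow : groupType := pres tens_rel.
Definition tens (f : {ffun 'I_n -> G}) : tpow := pgen tens_rel f.

Lemma tens_comm f g : tens f * tens g = tens g * tens f.
Proof.
by rewrite /tens /pgen -!ppiM; apply/ppiP/presP_rel; exact: tens_rel_comm.
Qed.

Fact tpow_abelian (x y : tpow) : x * y = y * x.
Proof.
have commV (u v : tpow) : u * v = v * u -> u * v^-1 = v^-1 * u.
  by move=> uv; apply: (@mulgI _ v); rewrite mulgA -uv mulgK mulVKg.
elim/pres_ind: y => [|g|u v hu hv|u hu]; last exact: commV.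
- by rewrite mulg1 mul1g.
- elim/pres_ind: x => [|f|u v hu hv|u hu].
  + by rewrite mulg1 mul1g.
  + exact: tens_comm.
  + by rewrite -mulgA hv mulgA hu mulgA.
  + by rewrite [RHS]commV.
- by rewrite mulgA hu -mulgA hv mulgA.
Qed.

End TensorPower.

Section UnitGroup.
Variable A : unitRingType.
Local Open Scope ring_scope.

Definition ustar : Type := {x : A | x \is a GRing.unit}.
HB.instance Definition _ := SubChoice.on ustar.

Definition u_one : ustar := exist _ 1 (unitr1 A).
Fact u_mul_subproof (x y : ustar) : val x * val y \is a GRing.unit.
Proof. by rewrite unitrMl ?(valP x) ?(valP y). Qed.
Definition u_mul (x y : ustar) : ustar :=
  exist _ (val x * val y) (u_mul_subproof x y).
Fact u_inv_subproof (x : ustar) : (val x)^-1 \is a GRing.unit.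
Proof. by rewrite unitrV (valP x). Qed.
Definition u_inv (x : ustar) : ustar := exist _ (val x)^-1 (u_inv_subproof x).

Fact u_mulA : associative u_mul.
Proof. by move=> x y z; apply: val_inj; exact: mulrA. Qed.
Fact u_mul1 : left_id u_one u_mul.
Proof. by move=> x; apply: val_inj; exact: mul1r. Qed.
Fact u_mulr1 : right_id u_one u_mul.
Proof. by move=> x; apply: val_inj; exact: mulr1. Qed.
Fact u_mulV : left_inverse u_one u_inv u_mul.
Proof. by move=> x; apply: val_inj; exact: (mulVr (valP x)). Qed.
Fact u_mulrV : right_inverse u_one u_inv u_mul.
Proof. by move=> x; apply: val_inj; exact: (mulrV (valP x)). Qed.
HB.instance Definition _ :=
  isGroup.Build ustar u_mulA u_mul1 u_mulr1 u_mulV u_mulrV.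

End UnitGroup.

Section MilnorK.
Variables (n : nat) (A : unitRingType).
Local Open Scope ring_scope.

(* Meaningful for n >= 2.                                                     *)
Definition steinberg_set : set (tpow (ustar A) n) :=
  [set t | exists (f : {ffun 'I_n -> ustar A}) (i j : 'I_n),
     [/\ j = i.+1 :> nat, val (f i) + val (f j) = 1 & t = tens f]]%classic.

Definition steinberg_sub : normalSubgroup (tpow (ustar A) n) :=
  abelian_gen (@tpow_abelian _ _) steinberg_set.

Definition KM : groupType := quo steinberg_sub.

Variables (Gam : groupType) (r : raction Gam A).

Definition ustar_act g (x : ustar A) : ustar A :=
  exist _ (r g (val x)) (rmorph_unit (r g) (valP x)).
Definition ffun_act g (f : {ffun 'I_n -> ustar A}) : {ffun 'I_n -> ustar A} :=
  [ffun i => ustar_act g (f i)].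

Fact ffun_act1 f : ffun_act 1%g f = f.
Proof. by apply/ffunP => i; rewrite ffunE; apply: val_inj; exact: ract1. Qed.
Fact ffun_actA g h f : ffun_act (g * h)%g f = ffun_act g (ffun_act h f).
Proof. by apply/ffunP => i; rewrite !ffunE; apply: val_inj; exact: ractA. Qed.
Fact ffun_act_rel g u v : tens_rel u v ->
  tens_rel (wmap (ffun_act g) u) (wmap (ffun_act g) v).
Proof.
case=> {u v} [i f f' h hi hj|f f']; last exact: tens_rel_comm.
apply: (@tens_rel_mul _ _ i); rewrite ?ffunE.
  by rewrite hi; apply: val_inj; exact: rmorphM.
by move=> j /hj [fj fj']; rewrite !ffunE fj fj'.
Qed.
Definition tpow_act : gaction Gam (tpow (ustar A) n) :=
  pres_act ffun_act1 ffun_actA ffun_act_rel.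

Lemma tpow_actE g f : tpow_act g (tens f) = tens (ffun_act g f).
Proof. exact: pres_actE. Qed.

Fact steinberg_stable g x :
  x \in steinberg_sub -> tpow_act g x \in steinberg_sub.
Proof.
rewrite -(hom_preimE (act_hom tpow_act g)) => xS.
rewrite [_ \in _]genE in xS; move/asboolP: xS.
elim=> {x} [_ [f [i [j [ij fij ->]]]]||x y _ hx _ hy|x _ hx].
- rewrite hom_preimE [act_hom _ _ _]tpow_actE.
  apply: mem_gen; exists (ffun_act g f), i, j.
  by split=> //; rewrite !ffunE /= -rmorphD fij rmorph1.
- exact: gpred1.
- exact: gpredM hx hy.
- exact: gpredVr hx.
Qed.
Definition KM_act : gaction Gam KM := quo_act steinberg_stable.

Definition KM_Gam : groupType := coinv KM_act.

End MilnorK.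

(* Exactness of 1 -> G -> H -> K -> 1.                                        *)
Definition short_exact (G H K : groupType) (i : {multiplicative G -> H})
    (p : {multiplicative H -> K}) : Prop :=
  [/\ injective i, forall x, p x = 1 <-> exists y, i y = x &
      forall z, exists x, p x = z].

(* Main.v *)
(** Matsumoto's theorem. The commutators of the lifts of the diagonal matrices
  diag(a, a^-1, 1) and diag(b, 1, b^-1) are central in St(F); they are
  bimultiplicative and satisfy the Steinberg relation, hence define a
  Gamma-equivariant map from K^M_2(F) to K_2(F). It is surjective because, in
  the quotient of St(F) by these symbols, the torus elements multiply as in
  E(F), so that the Bruhat decomposition of the last column peels off one index
  at a time from an element of the kernel of the map to E(F).

  For injectivity, let c be the universal symbol. Finite sequences of columns in
  general position are given leading minors lam_m in F, and moving from one
  sequence to another, by swapping two neighbours or changing the last column,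
  costs a value of c in these minors. The lifts of matrices of SL_n(F) to
  functions compatible with this cost form a central extension, into which the
  Steinberg relations lift. Existence of the lift of an elementary matrix is the
  Steinberg relation for the three terms of the Desnanot-Jacobi identity. The
  symbol of a and b acts there as the constant -c(a, b). General position is
  obtained over infinite and finite F alike by taking columns with polynomial
  entries and leading coefficients of minors.

  Passing to coinvariants, the isomorphism and the exact sequence follow, since
  Gamma St(F) maps onto Gamma E(F). *)
Require Import Defs.
From HB Require Import structures.
From mathcomp Require Import all_boot all_order all_algebra.
From mathcomp Require Import boolp classical_sets.
From mathcomp Require Import perm fraction.
From mathcomp Require Import zify ring.

Set Implicit Arguments.
Unset Strict Implicit.
Unset Printing Implicit Defensive.

Import GRing.Theory.
Local Open Scope group_scope.

(** The difficulty is injectivity: a central extension must be built in which symbols survive,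
    without normal forms of words and without a cocycle identity. No consistency of the costs around
    closed paths has to be proved: an element of the extension is a matrix together with a function
    on states whose variation along each edge is the prescribed change of cost, so the group laws
    are formal and only existence over generators needs work. Connectedness makes the functions over
    the identity matrix constant, hence central. Lower elementary matrices preserve all leading
    minors, so the work concerns [e_(i,i+1)], under which only the minor of size [i+1] moves.

    Keeping every leading minor nonzero avoids case distinctions. To connect two states one needs an
    unlimited supply of columns in general position, which [F^n] lacks when [F] is finite; hence the
    polynomial entries.

    Minors force a finite size [n] although St(F) is stable. A derivation uses finitely many
    indices, so a large [n] is enough. The bound 5 provides an index different from any four given
    ones. The sign in [-c(a, b)] does no harm to injectivity. *)

Lemma homJ (G H : groupType) (f : {multiplicative G -> H}) x y :
  f (x ^ y) = f x ^ f y.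
Proof. by rewrite /conjg !gmulfM homV. Qed.

Lemma homR (G H : groupType) (f : {multiplicative G -> H}) x y :
  f [~ x, y] = [~ f x, f y].
Proof. by rewrite /commg gmulfM homV homJ. Qed.

(** * Central extensions *)

Section CentralKernel.
Variables (L G : groupType) (p : {multiplicative L -> G}).
Hypothesis p_central : forall z x, p z = 1 -> commute z x.

(** Central factors drop out of commutators, so a commutator may be evaluated on whichever lifts
    have an explicit description. *)
Lemma comm_lift x x' y y' : p x = p x' -> p y = p y' -> [~ x, y] = [~ x', y'].
Proof.
move=> px py; have key (g h z : L) : p g = p h -> [~ g, z] = [~ h, z].
  move=> gh; have cg : p (g * h^-1) = 1 by rewrite gmulfM homV gh mulgV.
  rewrite -[g in LHS](mulgVK h) [in LHS]/commg conjMg invgM.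
  have -> : (g * h^-1) ^ z = g * h^-1 by rewrite /conjg (p_central z cg) mulKg.
  by rewrite mulgA mulgVK.
rewrite (key x x' y px) -(invgR y) -(invgR y').
by congr (_^-1); exact: key.
Qed.

(** The hypothesis makes [[~ x, z]] central, so the conjugation by [y] in the general expansion
    disappears. *)
Lemma commMl x y z : p [~ x, z] = 1 -> [~ x * y, z] = [~ x, z] * [~ y, z].
Proof.
move=> pxz; rewrite [LHS]commgEl conjMg invgM -mulgA [x^-1 * _]mulgA.
by rewrite -commgEl mulgA -(p_central _ pxz) -mulgA.
Qed.

End CentralKernel.

(* The commutator convention of the Steinberg relations, unlike [commg].      *)
Definition comm (G : groupType) (x y : G) := x * y * x^-1 * y^-1.

Section SteinbergLift.
Variables (F : nzRingType) (L G : groupType) (p : {multiplicative L -> G}).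
Variables (n : nat) (e : nat -> nat -> F -> G).
Hypothesis p_central : forall z x, p z = 1 -> commute z x.
Hypothesis n5 : (5 <= n)%N.
Hypothesis eD : forall i j a b, i != j -> e i j a * e i j b = e i j (a + b)%R.
Hypothesis eR : forall i j k a b, i != j -> j != k -> i != k ->
  comm (e i j a) (e j k b) = e i k (a * b)%R.
Hypothesis eI : forall i j k l a b, i != j -> k != l -> j != k -> i != l ->
  commute (e i j a) (e k l b).
Variable s : nat -> nat -> F -> L.
Hypothesis sE : forall i j a, (i < n)%N -> (j < n)%N -> i != j ->
  p (s i j a) = e i j a.
Implicit Types (i j k l h : nat) (a b c : F) (x y z : L).

Lemma comm_commg x y : comm x y = [~ x^-1, y^-1].
Proof. by rewrite /comm /commg /conjg !invgK !mulgA. Qed.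

Lemma comm_img x x' y y' : p x = p x' -> p y = p y' -> comm x y = comm x' y'.
Proof.
move=> px py; rewrite !comm_commg.
by apply: (comm_lift p_central); rewrite !homV ?px ?py.
Qed.

Lemma hom_comm x y : p (comm x y) = comm (p x) (p y).
Proof. by rewrite /comm !gmulfM !homV. Qed.

Lemma commJ x y z : z * comm x y * z^-1 = comm (z * x * z^-1) (z * y * z^-1).
Proof. by rewrite /comm !invgM !invgK !mulgA !mulgVK. Qed.

Lemma comm_mull x y z : comm (x * y) z = x * comm y z * x^-1 * comm x z.
Proof. by rewrite /comm !invgM !mulgA !mulgVK. Qed.

Lemma comm_mulr x y z : comm x (y * z) = comm x y * (y * comm x z * y^-1).
Proof. by rewrite /comm !invgM !mulgA !mulgVK. Qed.

Lemma comm1P x y : commute x y -> comm x y = 1.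
Proof. by rewrite /comm => ->; rewrite mulgK mulgV. Qed.

(** Having four indices to avoid is the origin of the bound [5 <= n]. *)
Lemma fresh_index i j k l : exists h, [/\ (h < n)%N, h != i, h != j, h != k & h != l].
Proof.
have /hasP [h] : has (fun h => h \notin [:: i; j; k; l]) (iota 0 5).
  apply/negPn/negP => /hasPn H.
  have /(uniq_leq_size (iota_uniq 0 5)) // : {subset iota 0 5 <= [:: i; j; k; l]}.
  by move=> h /H /negPn.
rewrite mem_iota !inE !negb_or => /andP [_ h5] /and4P [hi hj hk hl].
by exists h; split=> //; apply: leq_trans n5.
Qed.

(** Modulo the kernel [x] is a commutator through a fresh index [h], and [y] commutes in [G] with
    the images of both entries. As a commutator depends only on images, conjugation by [y] fixes
    it. *)
Lemma lift_commute i j k l a b x y : (i < n)%N -> (j < n)%N -> i != j -> k != l ->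
  j != k -> i != l -> p x = e i j a -> p y = e k l b -> commute x y.
Proof.
move=> ni nj ij kl jk il px py.
have [h [nh hi hj hk hl]] := fresh_index i j k l.
have ih : i != h by rewrite eq_sym.
pose q := comm (s i h 1%R) (s h j a).
have pq : p q = p x by rewrite hom_comm !sE // eR // mul1r px.
have qy : y * q * y^-1 = q.
  rewrite commJ; apply: comm_img; rewrite !gmulfM homV py sE //.
    by rewrite -eI ?mulgK // eq_sym.
  by rewrite -eI ?mulgK //; rewrite eq_sym.
have xq : p (x * q^-1) = 1 by rewrite gmulfM homV pq mulgV.
rewrite -[x](mulgVK q); apply: commute_sym; apply: commuteM.
  exact/commute_sym/p_central.
by rewrite /commute -{2}qy mulgVK.
Qed.

Let f i j h a b := comm (s i h a) (s h j b).

Let pf i j h a b : (i < n)%N -> (j < n)%N -> (h < n)%N -> i != j -> i != h ->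
  h != j -> p (f i j h a b) = e i j (a * b)%R.
Proof. by move=> *; rewrite hom_comm !sE // eR. Qed.

(** For lifts [u], [v], [w] along the chain [i, h, h', j] the two sides are [comm u (comm v w)] and
    [comm (comm u v) w]. They agree because [u] commutes with [w], and [comm v w] with [comm u v]
    and with the right-hand side. *)
Let f_shift i j h h' a b c : (i < n)%N -> (j < n)%N -> (h < n)%N -> (h' < n)%N ->
  i != j -> i != h -> h != j -> i != h' -> h' != j -> h != h' ->
  f i j h a (b * c)%R = f i j h' (a * b)%R c.
Proof.
move=> ni nj nh nh' ij ih hj ih' h'j hh'.
have [hi h'i h'h] : [/\ h != i, h' != i & h' != h] by split; rewrite eq_sym.
set u := s i h a; set v := s h h' b; set w := s h' j c.
have puv : p (comm u v) = e i h' (a * b)%R by rewrite hom_comm !sE // eR.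
have pvw : p (comm v w) = e h j (b * c)%R by rewrite hom_comm !sE // eR.
have -> : f i j h a (b * c)%R = comm u (comm v w).
  by apply: comm_img => //; rewrite sE // pvw.
have -> : f i j h' (a * b)%R c = comm (comm u v) w.
  by apply: comm_img => //; rewrite sE // puv.
have uw : u * w * u^-1 = w.
  rewrite (_ : u * w = w * u) ?mulgK //.
  by apply: (@lift_commute i h h' j a c); rewrite ?sE.
have C1 : comm u v * comm v w = comm v w * comm u v.
  by apply: (@lift_commute i h' h j (a * b)%R (b * c)%R).
have C2 : comm v w * comm (comm u v) w = comm (comm u v) w * comm v w.
  apply: (@lift_commute h j i j (b * c)%R (a * b * c)%R) => //.
    by rewrite eq_sym.
  by rewrite hom_comm puv sE // eR.
rewrite {1}/comm -[u * _]/(u * comm v w) commJ uw.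
have -> : u * v * u^-1 = comm u v * v by rewrite /comm mulgVK.
by rewrite comm_mull C1 mulgK C2 mulgK.
Qed.

Let f_indep i j h h' a b : (i < n)%N -> (j < n)%N -> (h < n)%N -> (h' < n)%N ->
  i != j -> i != h -> h != j -> i != h' -> h' != j ->
  f i j h a b = f i j h' 1%R (a * b)%R.
Proof.
move=> ni nj nh nh' ij ih hj ih' h'j.
have one k k' : (k < n)%N -> (k' < n)%N -> i != k -> k != j -> i != k' ->
    k' != j -> k != k' -> f i j k a b = f i j k' 1%R (a * b)%R /\
    f i j k a b = f i j k 1%R (a * b)%R.
  move=> nk nk' ik kj ik' k'j kk'.
  have k'k : k' != k by rewrite eq_sym.
  (* The shift with last scalar 1 collects both scalars in the first slot; with middle scalar 1 it
     changes only the index. *)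
  have fa c d : f i j k c d = f i j k' (c * d)%R 1%R.
    by rewrite -(@f_shift i j k k' c d 1%R) // mulr1.
  have fb c d : f i j k c d = f i j k' c d.
    have := @f_shift i j k k' c 1%R d ni nj nk nk' ij ik kj ik' k'j kk'.
    by rewrite mul1r mulr1.
  by rewrite -!fb !fa mul1r.
have [<-|hh'] := eqVneq h h'; last by have [] := one h h' nh nh' ih hj ih' h'j hh'.
have [k [nk ki kj kh _]] := fresh_index i j h h.
have [ik hk] : i != k /\ h != k by rewrite ![_ == k]eq_sym.
by have [] := one h k nh nk ih hj ik kj hk.
Qed.

(* As the kernel is central, [comm x y] depends only on the images of [x] and *)
(* [y]; as [n >= 5], that of lifts of [e i h 1] and [e h j a] does not depend *)
(* on [h] either.                                                             *)
Lemma steinberg_lift : exists X : nat -> nat -> F -> L,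
  [/\ forall i j a, (i < n)%N -> (j < n)%N -> i != j -> p (X i j a) = e i j a,
      forall i j a b, (i < n)%N -> (j < n)%N -> i != j ->
        X i j a * X i j b = X i j (a + b)%R,
      forall i j k a b, (i < n)%N -> (j < n)%N -> (k < n)%N ->
        i != j -> j != k -> i != k -> comm (X i j a) (X j k b) = X i k (a * b)%R &
      forall i j k l a b, (i < n)%N -> (j < n)%N -> (k < n)%N -> (l < n)%N ->
        i != j -> k != l -> j != k -> i != l -> commute (X i j a) (X k l b)].
Proof.
have [m mP] := choice (fun q : nat * nat => fresh_index q.1 q.2 q.1 q.2).
have mE i j : [/\ (m (i, j) < n)%N, i != m (i, j) & m (i, j) != j].
  by have [? ? ? _ _] := mP (i, j); split=> //; rewrite eq_sym.
pose X i j a := f i j (m (i, j)) 1%R a; exists X.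
have pX i j a : (i < n)%N -> (j < n)%N -> i != j -> p (X i j a) = e i j a.
  by move=> ni nj ij; have [? ? ?] := mE i j; rewrite pf // mul1r.
split=> // [i j a b ni nj ij|i j k a b ni nj nk ij jk ik|i j k l a b ni nj nk nl ij kl jk il].
- have [nh ih hj] := mE i j; rewrite /X; set h := m (i, j) in nh ih hj *.
  have -> : f i j h 1%R (a + b)%R = comm (s i h 1%R) (s h j a * s h j b).
    by apply: comm_img => //; rewrite gmulfM !sE // eD.
  rewrite comm_mulr; congr (_ * _); rewrite -[LHS]/(comm _ _).
  rewrite (_ : s h j a * _ = f i j h 1%R b * s h j a) ?mulgK //.
  apply: (@lift_commute h j i j a b); rewrite ?sE ?pf ?mul1r // eq_sym //.
- have [nh ih hk] := mE i k; rewrite /X -(@f_indep i k j) //.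
  by apply: comm_img; rewrite sE // pX.
- by apply: (@lift_commute i j k l a b); rewrite ?pX.
Qed.

End SteinbergLift.

(** * Weyl and torus elements *)

Section SteinbergFamily.
Variables (F : fieldType) (S : groupType) (X : nat -> nat -> F -> S).
Implicit Types (i j k l : nat) (a b c u v : F).

Record steinberg_family : Prop := SteinbergFamily {
  steinberg_add : forall i j a b, i != j -> X i j a * X i j b = X i j (a + b)%R;
  steinberg_comm : forall i j k a b, i != j -> j != k -> i != k ->
    X i j a * X j k b = X i k (a * b)%R * X j k b * X i j a;
  steinberg_disj : forall i j k l a b, i != j -> k != l -> j != k -> i != l ->
    X i j a * X k l b = X k l b * X i j a }.

Hypothesis XP : steinberg_family.

Let stD := steinberg_add XP.
Let stR := steinberg_comm XP.
Let stI := steinberg_disj XP.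

Lemma st0 i j : i != j -> X i j 0%R = 1.
Proof.
by move=> ij; apply: (@mulgI _ (X i j 0%R)); rewrite stD // addr0 mulg1.
Qed.

Lemma stN i j a : i != j -> X i j (- a)%R = (X i j a)^-1.
Proof.
move=> ij; apply: (@mulgI _ (X i j a)).
by rewrite stD // subrr st0 // mulgV.
Qed.

Lemma stJ_id i j k l a b : i != j -> k != l -> j != k -> i != l ->
  X i j a ^ X k l b = X i j a.
Proof. by move=> ij kl jk il; rewrite /conjg stI // mulKg. Qed.

Lemma stJl i j k a b : i != j -> j != k -> i != k ->
  X i j a ^ X j k b = X i k (a * b)%R * X i j a.
Proof.
move=> ij jk ik; rewrite /conjg stR // [X i k _ * _]stI //; try lia.
by rewrite -mulgA mulKg.
Qed.

Lemma stJr i j k a b : i != j -> j != k -> i != k ->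
  X j k b ^ X i j a = X i k (- (a * b))%R * X j k b.
Proof.
move=> ij jk ik; apply: (@mulgI _ (X i j a)).
rewrite /conjg mulVKg mulgA [X i j a * X i k _]stI; try lia.
by rewrite -mulgA stR // !mulgA stD // addNr st0 // mul1g.
Qed.

(** Lifts the matrix with rows [(0, u)] and [(-u^-1, 0)] in the indices [i], [j]. *)
Definition weyl i j u := X i j u * X j i (- u^-1)%R * X i j u.

Lemma weylV i j u : i != j -> (weyl i j u)^-1 = weyl i j (- u)%R.
Proof.
move=> ij; have ji : j != i by rewrite eq_sym.
by rewrite /weyl !invgM -!stN // invrN !opprK mulgA.
Qed.

Lemma weylJ_src i j k u a : u != 0%R -> i != j -> i != k -> j != k ->
  X i k a ^ weyl i j u = X j k (u^-1 * a)%R.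
Proof.
move=> u0 ij ik jk; rewrite /weyl !conjgM stJ_id //; try lia.
rewrite stJr; try lia.
rewrite conjMg stJr // [X i k a ^ _]stJ_id //; try lia.
rewrite mulNr opprK mulrA mulfV // mul1r -mulgA [X j k _ * _]stI; try lia.
by rewrite mulgA stD // addNr st0 // mul1g.
Qed.

Lemma weylJ_tgt i j k u a : u != 0%R -> i != j -> i != k -> j != k ->
  X k j a ^ weyl i j u = X k i (- (u^-1 * a))%R.
Proof.
move=> u0 ij ik jk; rewrite /weyl !conjgM stJ_id //; try lia.
rewrite stJl; try lia.
rewrite conjMg stJl //; try lia.
rewrite [X k j a ^ _]stJ_id //; try lia.
rewrite mulrN mulNr -mulrA mulVf // mulr1 -mulgA.
rewrite [X k i _ * _]stI; try lia.
by rewrite mulgA stD // ?addNr ?st0 ?mul1g 1?mulrC //; lia.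
Qed.

(* The swapped forms follow from [w_ij(u)^-1 = w_ij(-u)].                     *)
Lemma weylJ_src' i j k u a : u != 0%R -> i != j -> i != k -> j != k ->
  X j k a ^ weyl i j u = X i k (- (u * a))%R.
Proof.
move=> u0 ij ik jk; have u0' : (- u)%R != 0%R by rewrite oppr_eq0.
have := weylJ_src (- (u * a))%R u0' ij ik jk.
rewrite invrN mulrN mulNr opprK mulrA mulVf // mul1r => <-.
by rewrite -weylV // conjgKV.
Qed.

Lemma weylJ_tgt' i j k u a : u != 0%R -> i != j -> i != k -> j != k ->
  X k i a ^ weyl i j u = X k j (u * a)%R.
Proof.
move=> u0 ij ik jk; have u0' : (- u)%R != 0%R by rewrite oppr_eq0.
have := weylJ_tgt (u * a)%R u0' ij ik jk.
rewrite invrN mulNr opprK mulrA mulVf // mul1r => <-.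
by rewrite -weylV // conjgKV.
Qed.

Lemma stRE i j k a : i != j -> j != k -> i != k ->
  X i k a = [~ (X i j 1%R)^-1, (X j k a)^-1].
Proof.
move=> ij jk ik; rewrite /commg /conjg !invgK mulgA stR // mul1r.
by rewrite -!mulgA mulVKg mulgV mulg1.
Qed.

(** No relation links [X i j] to [X j i], so [X i j a] is first written as a commutator through a
    third index [k], both factors of which have known conjugates. *)
Lemma weylJ_same i j u a : u != 0%R -> i != j ->
  X i j a ^ weyl i j u = X j i (- (u^-1 * u^-1 * a))%R.
Proof.
move=> u0 ij; set k := (maxn i j).+1.
rewrite (@stRE i k j) /k; try lia; rewrite -/k conjRg !conjVg.
rewrite weylJ_src // /k; try lia; rewrite -/k weylJ_tgt // /k; try lia.
rewrite -/k /commg /conjg !invgK mulgA stR /k; try lia.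
rewrite -/k -!mulgA mulVKg mulgV mulg1; congr (X _ _ _); ring.
Qed.

Lemma weylJ_opp i j u a : u != 0%R -> i != j ->
  X j i a ^ weyl i j u = X i j (- (u * u * a))%R.
Proof.
move=> u0 ij; have u0' : (- u)%R != 0%R by rewrite oppr_eq0.
have := weylJ_same (- (u * u * a))%R u0' ij.
have -> : (- ((- u)^-1 * (- u)^-1 * - (u * u * a)) = a)%R by field.
by move=> <-; rewrite -weylV // conjgKV.
Qed.

(* [w_ij(u)^-1 e_k = wcoef i j u k * e_(transp i j k)].                       *)
Definition transp i j k := if k == i then j else if k == j then i else k.
Definition wcoef i j u k : F :=
  (if k == i then u^-1 else if k == j then - u else 1)%R.

Lemma weylJ i j u k l a : u != 0%R -> i != j -> k != l ->
  X k l a ^ weyl i j u =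
    X (transp i j k) (transp i j l) (wcoef i j u k * a / wcoef i j u l)%R.
Proof.
move=> u0 ij kl; rewrite /transp /wcoef.
case: (eqVneq k i) => [ki|ki]; case: (eqVneq l i) => [li|li].
- by rewrite ki li eqxx in kl.
- subst k; case: (eqVneq l j) => [->|lj].
    by rewrite weylJ_same //; congr (X _ _ _); field; rewrite ?oppr_eq0 ?oner_eq0 ?u0.
  by rewrite weylJ_src ?divr1 //; lia.
- subst l; case: (eqVneq k j) => [->|kj].
    by rewrite weylJ_opp //; congr (X _ _ _); field; rewrite ?oppr_eq0 ?oner_eq0 ?u0.
  by rewrite weylJ_tgt' //; try lia; congr (X _ _ _); field; rewrite ?oppr_eq0 ?oner_eq0 ?u0.
- case: (eqVneq k j) => [kj|kj]; case: (eqVneq l j) => [lj|lj].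
  + lia.
  + by subst k; rewrite weylJ_src' //; try lia; congr (X _ _ _); field; rewrite ?oppr_eq0 ?oner_eq0 ?u0.
  + by subst l; rewrite weylJ_tgt //; try lia; congr (X _ _ _); field; rewrite ?oppr_eq0 ?oner_eq0 ?u0.
  + rewrite /weyl !conjgM !stJ_id ?divr1 ?mul1r //; lia.
Qed.

Lemma wcoef_neq0 i j u k : u != 0%R -> wcoef i j u k != 0%R.
Proof.
by move=> u0; rewrite /wcoef; do 2?case: ifP => _; rewrite ?invr_eq0 ?oppr_eq0 ?oner_eq0.
Qed.

Lemma transpK i j : involutive (transp i j).
Proof.
move=> k; rewrite /transp.
case: (eqVneq k i) => [->|ki]; first by rewrite eqxx; case: eqP.
by case: (eqVneq k j) => [->|kj]; rewrite ?eqxx ?(negbTE ki) ?(negbTE kj).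
Qed.

Lemma transpL i j : transp i j i = j.
Proof. by rewrite /transp eqxx. Qed.

Lemma transpR i j : transp i j j = i.
Proof. by rewrite /transp eqxx; case: eqP. Qed.

Lemma transp_id i j k : k != i -> k != j -> transp i j k = k.
Proof. by rewrite /transp => /negbTE -> /negbTE ->. Qed.

Lemma transp_neq i j k l : k != l -> transp i j k != transp i j l.
Proof. by apply: contraNneq => /(can_inj (transpK i j)) ->. Qed.

Lemma weylJ_weyl i j u k l a : u != 0%R -> a != 0%R -> i != j -> k != l ->
  weyl k l a ^ weyl i j u =
    weyl (transp i j k) (transp i j l) (wcoef i j u k * a / wcoef i j u l)%R.
Proof.
move=> u0 a0 ij kl; have lk : l != k by rewrite eq_sym.
rewrite {1}/weyl !conjMg !weylJ // /weyl.
have ck := wcoef_neq0 i j k u0; have cl := wcoef_neq0 i j l u0.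
by do ![congr (_ * _)]; congr (X _ _ _); field; rewrite ck cl a0.
Qed.

Lemma weyl_sym i j u : u != 0%R -> i != j -> weyl i j u = weyl j i (- u^-1)%R.
Proof.
move=> u0 ij; have := weylJ_weyl u0 u0 ij ij.
rewrite /conjg mulKg /transp /wcoef !eqxx [j == i]eq_sym (negbTE ij) => ->.
by congr weyl; field; rewrite ?oppr_eq0 ?oner_eq0 u0.
Qed.

(** The Bruhat factorisation of a lower unipotent of SL_2; it serves where a simple reflection keeps
    a column in its cell. *)
Lemma weyl_split i j u : u != 0%R -> i != j ->
  X j i u = X i j (u^-1)%R * weyl i j (- u^-1)%R * X i j (u^-1)%R.
Proof.
move=> u0 ij; rewrite /weyl invrN invrK opprK !mulgA stD // addrN st0 //.
by rewrite mul1g -mulgA stD // addNr st0 // mulg1.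
Qed.

(* Write w_ij(-1) = x_ji(1) x_ij(-1) x_ji(1) and move the outer factors       *)
(* through w_ij(u) and w_ij(v): they become x_ij(-u^2) and x_ij(-v^2), and     *)
(* u + v = 1 makes the inner ones cancel.                                     *)
Lemma weyl_steinberg i j u v : i != j -> u != 0%R -> v != 0%R -> (u + v = 1)%R ->
  weyl i j u * weyl i j (- 1)%R * weyl i j v = weyl i j (u * v)%R.
Proof.
move=> ij u0 v0 uv; have ji : j != i by rewrite eq_sym.
have m1 : (- 1 : F)%R != 0%R by rewrite oppr_eq0 oner_eq0.
rewrite [weyl i j (- 1)]weyl_sym // invrN invr1 opprK {2}/weyl invr1.
have -> : weyl i j u * (X j i 1%R * X i j (- 1)%R * X j i 1%R) * weyl i j v =
  (weyl i j u * X j i 1%R) * X i j (- 1)%R * (X j i 1%R * weyl i j v).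
  by rewrite !mulgA.
rewrite [weyl i j u * X j i _]conjgCV weylV // weylJ_opp ?oppr_eq0 //.
rewrite [X j i 1%R * _]conjgC weylJ_opp // !mulr1 mulrNN.
rewrite /weyl -!mulgA stD // [X i j u * (X i j (- 1)%R * _)]mulgA stD //.
rewrite [X i j _ * (X i j v * _)]mulgA stD // [X i j _ * (X i j u * _)]mulgA stD //.
have -> : (u - 1 + v = 0)%R by rewrite addrAC uv subrr.
rewrite st0 // mul1g [X j i _ * (X j i _ * _)]mulgA stD //.
have vE : v = (1 - u)%R by rewrite -uv addrC addKr.
rewrite vE in v0 *; congr (X _ _ _ * (X _ _ _ * X _ _ _)).
- by ring.
- by field; rewrite u0 v0.
- by ring.
Qed.

Definition torus i j u := weyl i j u * weyl i j (- 1)%R.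

(** The diagonal of the inverse of the torus matrix, because [x ^ y] is [y^-1 * x * y]. *)
Definition tcoef i j u k : F :=
  (if k == i then u^-1 else if k == j then u else 1)%R.

Lemma tcoef_neq0 i j u k : u != 0%R -> tcoef i j u k != 0%R.
Proof.
by move=> u0; rewrite /tcoef; do 2?case: ifP => _; rewrite ?invr_eq0 ?oner_eq0.
Qed.

Lemma torusJ i j u k l a : u != 0%R -> i != j -> k != l ->
  X k l a ^ torus i j u = X k l (tcoef i j u k * a / tcoef i j u l)%R.
Proof.
move=> u0 ij kl; have m1 : (- 1 : F)%R != 0%R by rewrite oppr_eq0 oner_eq0.
rewrite conjgM !weylJ ?transp_neq // !transpK.
have wt x : (wcoef i j (- 1) (transp i j x) * wcoef i j u x = tcoef i j u x)%R.
  rewrite /wcoef /tcoef /transp; case: (eqVneq x i) => [_|xi].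
    by rewrite [j == i]eq_sym (negbTE ij) eqxx opprK mul1r.
  case: (eqVneq x j) => [_|xj].
    by rewrite eqxx invrN invr1 mulrNN mul1r.
  by rewrite (negbTE xi) (negbTE xj) mulr1.
have c1 x := @wcoef_neq0 i j u x u0; have c2 x := @wcoef_neq0 i j _ x m1.
by rewrite -!wt; congr (X _ _ _); field; rewrite !c1 !c2.
Qed.

Lemma torusJ_weyl i j u k l a : u != 0%R -> a != 0%R -> i != j -> k != l ->
  weyl k l a ^ torus i j u = weyl k l (tcoef i j u k * a / tcoef i j u l)%R.
Proof.
move=> u0 a0 ij kl; have lk : l != k by rewrite eq_sym.
rewrite {1}/weyl !conjMg !torusJ // /weyl.
have ck := tcoef_neq0 i j k u0; have cl := tcoef_neq0 i j l u0.
by do ![congr (_ * _)]; congr (X _ _ _); field; rewrite ck cl a0.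
Qed.

Lemma torusE i j u : i != j -> weyl i j u = torus i j u * weyl i j 1%R.
Proof. by move=> ij; rewrite /torus -[in RHS](invgK (weyl i j 1%R)) weylV // mulgK. Qed.

Lemma weyl_weyl i j u v : i != j ->
  weyl i j u * weyl i j v = torus i j u * (torus i j (- v)%R)^-1.
Proof.
by move=> ij; rewrite /torus invgM [RHS]mulgA mulgK weylV // opprK.
Qed.

(** Commutators of torus elements thus measure how far [torus k l] is from being multiplicative. One
    reading gives the Steinberg relation for symbols, the other the multiplicativity of the torus
    once symbols are killed. *)
Lemma torus_torusJ i j u k l v : u != 0%R -> v != 0%R -> i != j -> k != l ->
  let t := (tcoef i j u k / tcoef i j u l)%R in
  torus k l v ^ torus i j u = torus k l (t * v)%R * (torus k l t)^-1.
Proof.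
move=> u0 v0 ij kl t; have m1 : (- 1 : F)%R != 0%R by rewrite oppr_eq0 oner_eq0.
rewrite {1}/torus conjMg !torusJ_weyl // weyl_weyl //.
by congr (torus _ _ _ * (torus _ _ _)^-1); rewrite /t; field; apply: tcoef_neq0.
Qed.

Lemma torus1 i j : i != j -> torus i j 1%R = 1.
Proof. by move=> ij; rewrite /torus -weylV // mulgV. Qed.

Lemma torus_steinberg i j u v : i != j -> u != 0%R -> v != 0%R ->
  (u + v = 1)%R -> torus i j u * torus i j v = torus i j (u * v)%R.
Proof. by move=> *; rewrite /torus mulgA weyl_steinberg. Qed.

End SteinbergFamily.

Section Entries.
Variables (F : fieldType) (S : groupType) (X : nat -> nat -> F -> S).
Variable ent : S -> nat -> nat -> F.
Hypothesis entX : forall i j a s r c, i != j -> (ent (X i j a * s)%g r c =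
  ent s r c + (if r == i then a * ent s j c else 0))%R.
Implicit Types (i j r c : nat) (u : F) (s : S).

(** Any function [ent] obeying the row operations is allowed, since both the matrices of [p s] and
    those of [GL F] are meant. *)
Lemma ent_weyl i j u s r c : i != j -> u != 0%R ->
  (ent (weyl X i j u * s)%g r c =
   if r == i then u * ent s j c
   else if r == j then - (u^-1 * ent s i c) else ent s r c)%R.
Proof.
move=> ij u0; rewrite /weyl -!mulgA !entX //; try lia.
rewrite !eqxx ![j == i]eq_sym !(negbTE ij) !addr0.
case: (eqVneq r i) => [->|ri]; first by rewrite (negbTE ij); field.
by case: (eqVneq r j) => [->|rj]; rewrite ?addr0 //; field.
Qed.

Definition torus_val i j u r : F := (if r == i then u else if r == j then u^-1 else 1)%R.

Lemma ent_torus i j u s r c : i != j -> u != 0%R ->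
  (ent (torus X i j u * s)%g r c = torus_val i j u r * ent s r c)%R.
Proof.
move=> ij u0; rewrite /torus -mulgA !ent_weyl ?oppr_eq0 ?oner_eq0 //.
rewrite !eqxx ![j == i]eq_sym !(negbTE ij) /torus_val invrN invr1 !mulN1r opprK.
case: (eqVneq r i) => [->//|ri].
by case: (eqVneq r j) => [->|rj]; rewrite ?mulrN ?opprK ?mul1r.
Qed.

End Entries.

(** * Symbols in central extensions of E(F) *)

Lemma gen_left_ind (G : groupType) (A : set G) (P : G -> Prop) :
  (forall g, A g -> A g^-1) -> P 1 -> (forall g s, A g -> P s -> P (g * s)) ->
  forall x, x \in gen A -> P x.
Proof.
move=> AV P1 PA x; rewrite genE => /asboolP gx.
(* Multiplication by [x] and by [x^-1] are handled together, for arbitrary [s], so that the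
   induction survives products and inverses. *)
suff [] : (forall s, P s -> P (x * s)) /\ (forall s, P s -> P (x^-1 * s)).
  by move=> /(_ 1 P1); rewrite mulg1.
elim: gx => {x} [x Ax||x y _ [x1 x2] _ [y1 y2]|x _ [x1 x2]].
- by split=> s; apply: PA => //; exact: AV.
- by split=> s Ps; rewrite ?invg1 mul1g.
- by split=> s Ps; rewrite ?invgM -mulgA; [apply/x1/y1 | apply/y2/x2].
- by rewrite invgK.
Qed.

Section ElementaryEntries.
Variable F : fieldType.
Implicit Types (i j r c : nat) (a : F) (x y : E F).

Definition entry x r c : F := val (val (incl x)) r c.

Lemma entry_inj x y : (forall r c, entry x r c = entry y r c) -> x = y.
Proof. by move=> xy; apply/val_inj/val_inj/smx_eqP. Qed.

Lemma entry1 r c : entry 1 r c = (r == c)%:R%R.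
Proof. by []. Qed.

Lemma entry_elem p a y r c : (entry (elem p a * y)%g r c =
  entry y r c + (if r == (val p).1 then a * entry y (val p).2 c else 0))%R.
Proof.
rewrite /entry gmulfM.
have -> : val (incl (elem p a) * incl y) = (elem_smx p a * val (incl y))%g by [].
by rewrite elem_mulE.
Qed.

End ElementaryEntries.

Section OverE.
Variables (F : fieldType) (S : groupType) (X : nat -> nat -> F -> S).
Hypothesis XP : steinberg_family X.
Variable p : {multiplicative S -> E F}.
Hypothesis pX : forall i j (h : i != j) a, p (X i j a) = elem (exist _ (i, j) h) a.
Implicit Types (i j k l m n r c : nat) (a b u v : F) (d : nat -> F) (s : S).

Let stD := steinberg_add XP.
Let stI := steinberg_disj XP.
Let st0 := @st0 _ _ _ XP.
Let stN := @stN _ _ _ XP.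
Let stJ_id := @stJ_id _ _ _ XP.
Let stJl := @stJl _ _ _ XP.
Let stJr := @stJr _ _ _ XP.

Lemma entryX i j a s r c : i != j -> (entry (p (X i j a * s)%g) r c =
  entry (p s) r c + (if r == i then a * entry (p s) j c else 0))%R.
Proof. by move=> ij; rewrite gmulfM (pX ij) entry_elem. Qed.

Definition colv n m d : S := \prod_(0 <= k < m) X k n (d k).
Definition rowv n m d : S := \prod_(0 <= k < m) X n k (d k).

Lemma entry_colv n m d s r c : m <= n -> (entry (p (colv n m d * s)%g) r c =
  entry (p s) r c + (if (r < m)%N then d r * entry (p s) n c else 0))%R.
Proof.
elim: m s => [|m IH] s mn; first by rewrite /colv big_nil mul1g addr0.
rewrite /colv big_nat_recr //= -mulgA IH; last exact: ltnW.
have mn' : m != n by lia.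
rewrite !entryX // [n == m]eq_sym (negbTE mn') addr0 -addrA.
congr (_ + _)%R; rewrite [(r < m.+1)%N]ltnS [(r <= m)%N]leq_eqVlt.
by case: (eqVneq r m) => [->|_] /=; rewrite ?ltnn ?addr0 ?add0r.
Qed.

Lemma entry_rowv n m d s r c : m <= n -> (entry (p (rowv n m d * s)%g) r c =
  entry (p s) r c +
  (if r == n then \sum_(0 <= k < m) d k * entry (p s) k c else 0))%R.
Proof.
elim: m s => [|m IH] s mn.
  by rewrite /rowv !big_nil mul1g if_same addr0.
rewrite /rowv big_nat_recr //= -mulgA IH; last exact: ltnW.
have mn' : n != m by lia.
rewrite entryX // -addrA; congr (_ + _)%R; case: (eqVneq r n) => _; last by rewrite addr0.
rewrite big_nat_recr //= addrC; congr (_ + _)%R.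
rewrite big_seq_cond [RHS]big_seq_cond; apply: eq_bigr => k.
rewrite mem_index_iota andbT => /andP [_ km]; rewrite entryX //.
by case: eqVneq => [kn|]; rewrite ?addr0 //; lia.
Qed.

Lemma colv_recr n m d : colv n m.+1 d = colv n m d * X m n (d m).
Proof. by rewrite /colv big_nat_recr. Qed.

Lemma rowv_recr n m d : rowv n m.+1 d = rowv n m d * X n m (d m).
Proof. by rewrite /rowv big_nat_recr. Qed.

Lemma eq_colv n m d d' : (forall k, (k < m)%N -> d k = d' k) ->
  colv n m d = colv n m d'.
Proof.
move=> dd; rewrite /colv big_seq_cond [RHS]big_seq_cond; apply: eq_bigr => k.
by rewrite mem_index_iota andbT => /andP [_ /dd ->].
Qed.

Lemma eq_rowv n m d d' : (forall k, (k < m)%N -> d k = d' k) ->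
  rowv n m d = rowv n m d'.
Proof.
move=> dd; rewrite /rowv big_seq_cond [RHS]big_seq_cond; apply: eq_bigr => k.
by rewrite mem_index_iota andbT => /andP [_ /dd ->].
Qed.

Lemma colv_commute n m d s :
  (forall k, (k < m)%N -> commute s (X k n (d k))) -> commute s (colv n m d).
Proof.
elim: m => [|m IH] h; first by rewrite /colv big_nil; exact: commute1.
rewrite colv_recr; apply: commuteM; last exact: h.
by apply: IH => k km; apply/h/ltnW.
Qed.

Lemma rowv_commute n m d s :
  (forall k, (k < m)%N -> commute s (X n k (d k))) -> commute s (rowv n m d).
Proof.
elim: m => [|m IH] h; first by rewrite /rowv big_nil; exact: commute1.
rewrite rowv_recr; apply: commuteM; last exact: h.
by apply: IH => k km; apply/h/ltnW.
Qed.

Definition addat i b d k := (if k == i then b + d k else d k)%R.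

Lemma addat_id i b d k : k != i -> addat i b d k = d k.
Proof. by rewrite /addat => /negbTE ->. Qed.

Lemma colv_absorb n m d i b : (m <= n)%N -> (i < m)%N ->
  X i n b * colv n m d = colv n m (addat i b d).
Proof.
elim: m => [//|m IH] mn; rewrite ltnS leq_eqVlt !colv_recr mulgA.
case: eqVneq => [->|im] /= h.
  have -> : colv n m (addat m b d) = colv n m d.
    by apply: eq_colv => k km; rewrite addat_id //; lia.
  rewrite /addat eqxx -stD ?mulgA; last lia.
  by rewrite [X m n b * _]colv_commute // => k km; apply: stI; lia.
by rewrite IH ?(ltnW mn) // [addat i b d m]addat_id // eq_sym.
Qed.

Lemma rowv_absorb n m d i b : (m <= n)%N -> (i < m)%N ->
  X n i b * rowv n m d = rowv n m (addat i b d).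
Proof.
elim: m => [//|m IH] mn; rewrite ltnS leq_eqVlt !rowv_recr mulgA.
case: eqVneq => [->|im] /= h.
  have -> : rowv n m (addat m b d) = rowv n m d.
    by apply: eq_rowv => k km; rewrite addat_id //; lia.
  rewrite /addat eqxx -stD ?mulgA; last lia.
  by rewrite [X n m b * _]rowv_commute // => k km; apply: stI; lia.
by rewrite IH ?(ltnW mn) // [addat i b d m]addat_id // eq_sym.
Qed.

(** Only the factor at [X j n] fails to commute with [X i j b], so a single coordinate changes. The
    induction runs over prefixes and keeps the correction in front. *)
Lemma colvJ n m d i j b : (m <= n)%N -> (i < m)%N -> (j < m)%N -> i != j ->
  colv n m d ^ X i j b = colv n m (addat i (- (b * d j)) d)%R.
Proof.
move=> mn im jm ij; rewrite -colv_absorb //.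
have : forall m', (m' <= n)%N -> colv n m' d ^ X i j b =
    X i n (if (j < m')%N then - (b * d j) else 0)%R * colv n m' d.
  elim=> [|m' IH] m'n; first by rewrite /colv big_nil conj1g st0 ?mul1g //; lia.
  rewrite !colv_recr conjMg IH; last exact: ltnW.
  have [jm'|jm'] := eqVneq j m'.
    rewrite -jm' ltnn ltnSn st0 ?mul1g //; last lia.
    rewrite stJr; try lia.
    rewrite !mulgA; congr (_ * _); apply/esym/colv_commute => k km.
    by apply: stI; lia.
  rewrite [X m' n _ ^ _]stJ_id ?mulgA; try lia.
  by rewrite [(j < m'.+1)%N]ltnS [(j <= m')%N]leq_eqVlt (negbTE jm').
by move=> ->; rewrite // jm.
Qed.

Lemma rowvJ n m d i j b : (m <= n)%N -> (i < m)%N -> (j < m)%N -> i != j ->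
  rowv n m d ^ X i j b = rowv n m (addat j (d i * b) d)%R.
Proof.
move=> mn im jm ij; rewrite -rowv_absorb //.
have : forall m', (m' <= n)%N -> rowv n m' d ^ X i j b =
    X n j (if (i < m')%N then d i * b else 0)%R * rowv n m' d.
  elim=> [|m' IH] m'n; first by rewrite /rowv big_nil conj1g st0 ?mul1g //; lia.
  rewrite !rowv_recr conjMg IH; last exact: ltnW.
  have [im'|im'] := eqVneq i m'.
    rewrite -im' ltnn ltnSn st0 ?mul1g //; last lia.
    rewrite stJl; try lia.
    rewrite !mulgA; congr (_ * _); apply/esym/rowv_commute => k km.
    by apply: stI; lia.
  rewrite [X n m' _ ^ _]stJ_id ?mulgA; try lia.
  by rewrite [(i < m'.+1)%N]ltnS [(i <= m')%N]leq_eqVlt (negbTE im').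
by move=> ->; rewrite // im.
Qed.

Definition bounded n : groupClosed S :=
  gen [set s | exists i j a, [/\ (i < n)%N, (j < n)%N, i != j & s = X i j a]]%classic.

Lemma mem_bounded n i j a : (i < n)%N -> (j < n)%N -> i != j ->
  X i j a \in bounded n.
Proof. by move=> ni nj ij; apply: mem_gen; exists i, j, a. Qed.

Lemma bounded_ind n (P : S -> Prop) : P 1 ->
  (forall i j a s, (i < n)%N -> (j < n)%N -> i != j -> P s -> P (X i j a * s)) ->
  forall s, s \in bounded n -> P s.
Proof.
move=> P1 PX; apply: gen_left_ind => // [_ [i [j [a [ni nj ij ->]]]]|].
  by exists i, j, (- a)%R; rewrite stN.
by move=> _ s [i [j [a [ni nj ij ->]]]]; apply: PX.
Qed.

Lemma bounded_colvJ n s d : s \in bounded n ->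
  exists d', colv n n d ^ s = colv n n d'.
Proof.
move=> sn; elim/(@bounded_ind n): s / sn d => [|i j a s ni nj ij IH] d.
  by exists d; rewrite conjg1.
by rewrite conjgM colvJ.
Qed.

Lemma bounded_rowvJ n s d : s \in bounded n ->
  exists d', rowv n n d ^ s = rowv n n d'.
Proof.
move=> sn; elim/(@bounded_ind n): s / sn d => [|i j a s ni nj ij IH] d.
  by exists d; rewrite conjg1.
by rewrite conjgM rowvJ.
Qed.

Lemma colv_inj n d d' : p (colv n n d) = p (colv n n d') ->
  colv n n d = colv n n d'.
Proof.
move=> e; apply: eq_colv => k kn; have := congr1 (fun x => entry x k n) e.
rewrite -[colv n n d]mulg1 -[colv n n d']mulg1 !entry_colv // kn hom1 !entry1.
by rewrite eqxx !mulr1 => /addrI.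
Qed.

Lemma rowv_inj n d d' : p (rowv n n d) = p (rowv n n d') ->
  rowv n n d = rowv n n d'.
Proof.
move=> e; apply: eq_rowv => k kn; have := congr1 (fun x => entry x n k) e.
rewrite -[rowv n n d]mulg1 -[rowv n n d']mulg1 !entry_rowv // eqxx hom1.
move=> /addrI.
have sumE (f : nat -> F) :
    (\sum_(0 <= l < n) f l * entry (1 : E F)%g l k = f k)%R.
  rewrite (bigD1_seq k) ?iota_uniq ?mem_index_iota //= entry1 eqxx mulr1.
  by rewrite big1 ?addr0 // => l /negbTE lk; rewrite entry1 lk mulr0.
by rewrite !sumE.
Qed.

Hypothesis X_gen : forall s, exists n, s \in bounded n.

Lemma boundedW m n s : (m <= n)%N -> s \in bounded m -> s \in bounded n.
Proof.
move=> mn; elim/bounded_ind => [|i j a {}s mi mj ij IH]; first exact: gpred1.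
by rewrite gpredM ?mem_bounded //; lia.
Qed.

(* The centre contains the kernel: for [n] large [s] normalises the row and    *)
(* column groups of index [n], on which [p] is injective.                     *)
Lemma ker_central s t : p s = 1 -> commute s t.
Proof.
move=> ps; have [n0 sn0] := X_gen s; have [m tm] := X_gen t.
elim/bounded_ind: t / tm => [|i j a t mi mj ij IH]; first exact: commute1.
apply: commuteM => {t IH} //.
have [n [sn mn]] : exists n, s \in bounded n /\ (m <= n)%N.
  by exists (maxn n0 m); rewrite (boundedW _ sn0) ?leq_maxl ?leq_maxr.
have cJ d : colv n n d ^ s = colv n n d.
  have [d' dE] := bounded_colvJ d sn; rewrite dE; apply/esym/colv_inj.
  by rewrite -dE homJ ps conjg1.
have rJ d : rowv n n d ^ s = rowv n n d.
  have [d' dE] := bounded_rowvJ d sn; rewrite dE; apply/esym/rowv_inj.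
  by rewrite -dE homJ ps conjg1.
have [ni nj] : (i < n)%N /\ (j < n)%N by lia.
have one k b : (fun l => addat k b (fun=> 0%R) l) = fun l => (if l == k then b else 0)%R.
  by apply/funext => l; rewrite /addat addr0.
have col0 : colv n n (fun=> 0%R) = 1.
  rewrite /colv big_seq_cond big1 // => k; rewrite mem_index_iota andbT => kn.
  by rewrite st0 //; lia.
have row0 : rowv n n (fun=> 0%R) = 1.
  rewrite /rowv big_seq_cond big1 // => k; rewrite mem_index_iota andbT => kn.
  by rewrite st0 //; lia.
have Xi : X i n 1%R ^ s = X i n 1%R.
  by have := cJ (addat i 1%R (fun=> 0%R)); rewrite -colv_absorb // col0 mulg1.
have Xj : X n j a ^ s = X n j a.
  by have := rJ (addat j a (fun=> 0%R)); rewrite -rowv_absorb // row0 mulg1.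
have : X i j a ^ s = X i j a.
  by rewrite (@stRE _ _ _ XP i n j) ?conjRg ?conjVg ?Xi ?Xj //; lia.
by move=> XJ; rewrite /commute [RHS]conjgC XJ.
Qed.

Lemma entry_torus i j u s r c : i != j -> u != 0%R ->
  (entry (p (torus X i j u * s)%g) r c = torus_val i j u r * entry (p s) r c)%R.
Proof.
by move=> ij u0; apply: (ent_torus (ent := fun s => entry (p s))) => // *; exact: entryX.
Qed.

Lemma entry_weyl i j u s r c : i != j -> u != 0%R ->
  (entry (p (weyl X i j u * s)%g) r c =
   if r == i then u * entry (p s) j c
   else if r == j then - (u^-1 * entry (p s) i c) else entry (p s) r c)%R.
Proof.
by move=> ij u0; apply: (ent_weyl (ent := fun s => entry (p s))) => // *; exact: entryX.
Qed.

Lemma p_torusM i j u v : i != j -> u != 0%R -> v != 0%R ->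
  p (torus X i j (u * v)%R) = p (torus X i j u * torus X i j v).
Proof.
move=> ij u0 v0; rewrite -[torus X i j (u * v)]mulg1 -[torus X i j v]mulg1.
apply: entry_inj => r c; rewrite !entry_torus ?mulf_neq0 // mulrA.
congr (_ * _)%R; rewrite /torus_val; case: eqP => _ //; case: eqP => _.
  by rewrite invfM.
by rewrite mulr1.
Qed.

Lemma p_torusC i j k l u v : i != j -> k != l -> u != 0%R -> v != 0%R ->
  p (torus X i j u * torus X k l v) = p (torus X k l v * torus X i j u).
Proof.
move=> ij kl u0 v0; rewrite -[torus X i j u * _]mulg1 -[torus X k l v * _]mulg1.
rewrite -(mulgA (torus X i j u)) -(mulgA (torus X k l v)).
by apply: entry_inj => r c; rewrite !entry_torus // mulrCA.
Qed.

Lemma p_torus_weylJ i j k l u v : i != j -> k != l -> u != 0%R -> v != 0%R ->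
  p (torus X k l v ^ weyl X i j u) = p (torus X (transp i j k) (transp i j l) v).
Proof.
move=> ij kl u0 v0; have m1 : (- 1 : F)%R != 0%R by rewrite oppr_eq0 oner_eq0.
rewrite {1}/torus conjMg !weylJ_weyl // (weyl_weyl XP) ?transp_neq //.
rewrite mulrN1 mulNr opprK [LHS]gmulfM.
set t := (wcoef i j u k / wcoef i j u l)%R; have t0 : t != 0%R by rewrite mulf_neq0 ?invr_eq0 ?wcoef_neq0.
have -> : (wcoef i j u k * v / wcoef i j u l = v * t)%R by rewrite mulrAC mulrC.
by rewrite p_torusM ?transp_neq // gmulfM homV mulgK.
Qed.

Definition symb i j k u v := [~ torus X i j u, torus X i k v].

Lemma p_comm_torus i j k l u v : i != j -> k != l -> u != 0%R -> v != 0%R ->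
  p [~ torus X i j u, torus X k l v] = 1.
Proof.
move=> ij kl u0 v0; rewrite homR; apply/eqP/commgP.
by rewrite /commute -!gmulfM p_torusC.
Qed.

Lemma p_symb i j k u v : i != j -> i != k -> u != 0%R -> v != 0%R ->
  p (symb i j k u v) = 1.
Proof. exact: p_comm_torus. Qed.

Lemma symbMl i j k u u' v : i != j -> i != k ->
  u != 0%R -> u' != 0%R -> v != 0%R ->
  symb i j k (u * u')%R v = symb i j k u v * symb i j k u' v.
Proof.
move=> ij ik u0 u0' v0.
rewrite -(commMl ker_central) ?p_symb //; apply: (comm_lift ker_central) => //; exact: p_torusM.
Qed.

Lemma symb_inv i j k u v : symb i j k u v = (symb i k j v u)^-1.
Proof. by rewrite /symb invgR. Qed.

Lemma symb_comm i j k u v s : i != j -> i != k -> u != 0%R -> v != 0%R ->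
  commute (symb i j k u v) s.
Proof. by move=> *; apply: ker_central; rewrite p_symb. Qed.

Lemma symbMr i j k u v v' : i != j -> i != k ->
  u != 0%R -> v != 0%R -> v' != 0%R ->
  symb i j k u (v * v')%R = symb i j k u v * symb i j k u v'.
Proof.
move=> ij ik u0 v0 v0'; rewrite symb_inv symbMl // invgM -!symb_inv.
by rewrite symb_comm.
Qed.

(** Conjugation by [torus i k v^-1] rescales the argument of [torus i j] by [v], so the symbol at
    [(u, v^-1)] measures the defect of [torus i j u * torus i j v = torus i j (u * v)], which
    vanishes if [u + v = 1]. Bimultiplicativity then removes the inverse. *)
Lemma symb_steinberg i j k u v : i != j -> i != k -> j != k ->
  u != 0%R -> v != 0%R -> (u + v = 1)%R -> symb i j k u v = 1.
Proof.
move=> ij ik jk u0 v0 uv; have v0' : (v^-1)%R != 0%R by rewrite invr_eq0.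
have s1 : symb i j k u (v^-1)%R = 1.
  rewrite /symb commgEl (torus_torusJ XP) // /tcoef eqxx [j == i]eq_sym (negbTE ij) (negbTE jk).
  by rewrite invrK divr1 mulrC -(torus_steinberg XP) // -mulgA mulgV mulg1 mulVg.
have s0 : symb i j k u 1%R = 1 by rewrite /symb (torus1 XP) // commg1.
by have := symbMr ij ik u0 v0 v0'; rewrite divff // s0 s1 mulg1.
Qed.

(** A central symbol equals its Weyl conjugate, and the conjugated torus elements agree modulo the
    kernel with those at the transposed indices. *)
Lemma symb_transp x y i j k u v : x != y -> i != j -> i != k ->
  u != 0%R -> v != 0%R ->
  symb i j k u v = symb (transp x y i) (transp x y j) (transp x y k) u v.
Proof.
move=> xy ij ik u0 v0; have o0 : (1 : F)%R != 0%R by rewrite oner_eq0.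
have c := symb_comm (weyl X x y 1%R) ij ik u0 v0.
have -> : symb i j k u v = symb i j k u v ^ weyl X x y 1%R.
  by rewrite /conjg c mulKg.
by rewrite conjRg; apply: (comm_lift ker_central); rewrite p_torus_weylJ.
Qed.

Lemma symb_indep i j k u v : i != j -> i != k -> j != k ->
  u != 0%R -> v != 0%R -> symb i j k u v = symb 0 1 2 u v.
Proof.
move=> ij ik jk u0 v0.
(* Going to indices above all those present keeps each transposition away from the other two
   indices. *)
have up i' j' k' m : i' != j' -> i' != k' -> j' != k' -> (i' < m)%N ->
    (j' < m)%N -> (k' < m)%N -> symb i' j' k' u v = symb m m.+1 m.+2 u v.
  move=> ij' ik' jk' im jm km.
  have -> : symb i' j' k' u v = symb m j' k' u v.
    by rewrite (@symb_transp i' m) ?transpL ?transp_id //; lia.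
  have -> : symb m j' k' u v = symb m m.+1 k' u v.
    by rewrite (@symb_transp j' m.+1) ?transpL ?transp_id //; lia.
  by rewrite (@symb_transp k' m.+2) ?transpL ?transp_id //; lia.
have [m [im jm km m2]] : exists m, [/\ i < m, j < m, k < m & 2 < m]%N.
  by exists (i + j + k + 3)%N; split; lia.
rewrite (up i j k m) // (up 0 1 2 m)%N //; lia.
Qed.

End OverE.

(** * Bruhat cells of a column *)

Section TrivialSymbols.
Variables (F : fieldType) (S : groupType) (X : nat -> nat -> F -> S).
Hypothesis XP : steinberg_family X.
Variable p : {multiplicative S -> E F}.
Hypothesis pX : forall i j (h : i != j) a, p (X i j a) = elem (exist _ (i, j) h) a.
Hypothesis X_gen : forall s, exists n, s \in bounded X n.
Hypothesis torusM : forall i j u v, i != j -> u != 0%R -> v != 0%R ->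
  torus X i j (u * v)%R = torus X i j u * torus X i j v.
Implicit Types (i j k l m n r c : nat) (a b u v : F) (d : nat -> F) (s y q t : S).

Let stI := steinberg_disj XP.
Let st0 := @st0 _ _ _ XP.
Let stN := @stN _ _ _ XP.
Let stJl := @stJl _ _ _ XP.

(* The stabiliser of the [m]-th basis vector among matrices of size [m.+1].   *)
Definition parab m : groupClosed S :=
  gen [set s | exists i j a, [/\ (i <= m)%N, (j < m)%N, i != j & s = X i j a]]%classic.

Lemma mem_parab m i j a : (i <= m)%N -> (j < m)%N -> i != j ->
  X i j a \in parab m.
Proof. by move=> mi mj ij; apply: mem_gen; exists i, j, a. Qed.

Lemma weyl_parab m i j u : (i < m)%N -> (j < m)%N -> i != j ->
  weyl X i j u \in parab m.
Proof. by move=> im jm ij; do 2?[apply: gpredM]; apply: mem_parab; lia. Qed.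

Lemma torus_parab m i j u : (i < m)%N -> (j < m)%N -> i != j ->
  torus X i j u \in parab m.
Proof. by move=> im jm ij; apply: gpredM; apply: weyl_parab. Qed.

Lemma weyl_bounded m i j u : (i < m)%N -> (j < m)%N -> i != j ->
  weyl X i j u \in bounded X m.
Proof. by move=> im jm ij; do 2?[apply: gpredM]; apply: mem_bounded; lia. Qed.

Lemma parab_ind m (P : S -> Prop) : P 1 ->
  (forall i j a s, (i <= m)%N -> (j < m)%N -> i != j -> P s -> P (X i j a * s)) ->
  forall s, s \in parab m -> P s.
Proof.
move=> P1 PX; apply: gen_left_ind => // [_ [i [j [a [mi mj ij ->]]]]|].
  by exists i, j, (- a)%R; rewrite stN.
by move=> _ s [i [j [a [mi mj ij ->]]]]; apply: PX.
Qed.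

Lemma colv0 m n : (m <= n)%N -> colv X n m (fun=> 0%R) = 1.
Proof.
move=> mn; rewrite /colv big_seq_cond big1 // => k.
by rewrite mem_index_iota andbT => km; rewrite st0 //; lia.
Qed.

Lemma rowv0 m n : (m <= n)%N -> rowv X n m (fun=> 0%R) = 1.
Proof.
move=> mn; rewrite /rowv big_seq_cond big1 // => k.
by rewrite mem_index_iota andbT => km; rewrite st0 //; lia.
Qed.

(** A Levi decomposition: [bounded X m] normalises the row group of index [m]. *)
Lemma parab_dec m q : q \in parab m ->
  exists d s, s \in bounded X m /\ q = rowv X m m d * s.
Proof.
elim/parab_ind => [|i j a {}q mi mj ij [d [s [sm ->]]]].
  by exists (fun=> 0%R), 1; rewrite rowv0 // mulg1 gpred1.
rewrite mulgA; have [im|im] := eqVneq i m.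
  by subst i; exists (addat j a d), s; rewrite (rowv_absorb XP).
have im' : (i < m)%N by lia.
exists (addat j (d i * - a) d)%R, (X i j a * s).
rewrite gpredM ?mem_bounded // -(rowvJ XP _ _ _ im') // stN // /conjg invgK.
by rewrite -[in RHS](mulgA (X i j a)) -(mulgA _ _ (X i j a * s)) !mulgA mulgVK.
Qed.

(** Such a [y] sends the [m]-th basis vector to a nonzero multiple of the [k]-th. For [k = m] it is
    a torus element with [m.-1] as its other index, whence the recurring [0 < m]. *)
Definition cell_rep m k y := exists2 u, u != 0%R &
  y = if (k < m)%N then weyl X k m u else torus X m.-1 m u.

(* The matrices of size [m.+1] sorted by the position [k] of the last nonzero *)
(* entry of their [m]-th column.                                              *)
Definition cell m k s := exists d y q,
  [/\ cell_rep m k y, q \in parab m & s = colv X k k d * y * q].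

Lemma cell_intro m k d t y q : cell_rep m k y -> q \in parab m ->
  t ^ y \in parab m -> cell m k (colv X k k d * t * y * q).
Proof.
move=> yk qm tym; exists d, y, (t ^ y * q); rewrite gpredM //; split=> //.
by rewrite -[_ * t * y]mulgA [t * y]conjgC !mulgA.
Qed.

Lemma cell1 m k y q : cell_rep m k y -> q \in parab m -> cell m k (y * q).
Proof.
by move=> ym qm; exists (fun=> 0%R), y, q; rewrite colv0 // mul1g.
Qed.

Lemma repJ m k y i j a : (0 < m)%N -> (k <= m)%N -> cell_rep m k y -> i != j ->
  (i <= m)%N -> (j <= m)%N -> j != k -> X i j a ^ y \in parab m.
Proof.
move=> m0 km [u u0 ->] ij im jm jk; case: ltnP => mk.
  rewrite weylJ //; try lia.
  apply: mem_parab; last exact: transp_neq.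
    by rewrite /transp; do 2?case: eqP => _.
  rewrite /transp (negbTE jk); case: eqP => ?; lia.
rewrite torusJ //; try lia.
by apply: mem_parab => //; lia.
Qed.

Lemma rep_weylJ m k y i j a : (0 < m)%N -> (k <= m)%N -> cell_rep m k y ->
  a != 0%R -> i != j -> (i <= m)%N -> (j <= m)%N -> i != k -> j != k ->
  weyl X i j a ^ y \in parab m.
Proof.
move=> m0 km [u u0 ->] a0 ij im jm ik jk; case: ltnP => mk.
  rewrite weylJ_weyl //; try lia.
  apply: weyl_parab; last exact: transp_neq.
    by rewrite /transp (negbTE ik); case: eqP => ?; lia.
  by rewrite /transp (negbTE jk); case: eqP => ?; lia.
rewrite torusJ_weyl //; try lia.
by apply: weyl_parab => //; lia.
Qed.

Lemma rep_colvJ m k y j n d : (0 < m)%N -> (k <= m)%N -> cell_rep m k y ->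
  (n <= j)%N -> (j <= m)%N -> j != k -> colv X j n d ^ y \in parab m.
Proof.
move=> m0 km yk; elim: n => [|n IH] nj jm jk.
  by rewrite /colv big_nil conj1g gpred1.
rewrite colv_recr conjMg; apply: gpredM; first by apply: IH => //; lia.
by apply: (repJ _ m0 km yk) => //; lia.
Qed.

Lemma colvJ_out k j n d b : (n <= k)%N -> (k < j)%N ->
  colv X k n d ^ X k j b = colv X k n d * colv X j n (fun l => d l * b)%R.
Proof.
move=> nk kj; elim: n nk => [|n IH] nk.
  by rewrite /colv !big_nil conj1g mulg1.
rewrite !colv_recr conjMg IH; last exact: ltnW.
rewrite stJl; try lia.
rewrite -!mulgA; congr (_ * _).
rewrite [X n j _ * _]stI; try lia.
rewrite !mulgA; congr (_ * _); apply/esym/colv_commute => l ln.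
by apply: stI; lia.
Qed.

(** The column absorbs [X i j a] if [j = k]. Otherwise the factor passes to its right, changing
    coordinates or leaving a correction in column [j > k], and what arrives at [y] is conjugated by
    it into [parab m]. *)
Lemma upper_cell m k i j a s : (0 < m)%N -> (k <= m)%N -> (i < j)%N ->
  (j <= m)%N -> cell m k s -> cell m k (X i j a * s).
Proof.
move=> m0 km ij jm [d [y [q [yk qm ->]]]]; rewrite !mulgA.
have [jk|jk|jk] := ltngtP j k.
- have -> : X i j a * colv X k k d =
      colv X k k (addat i (- (- a * d j)) d)%R * X i j a.
    rewrite -(colvJ XP) //; try lia.
    by rewrite stN ?/conjg ?invgK ?mulgA ?mulgVK //; lia.
  by apply: cell_intro => //; apply: (repJ _ m0 km yk); lia.
- have [ik|ik] := eqVneq i k; last first.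
    have -> : X i j a * colv X k k d = colv X k k d * X i j a.
      by apply: colv_commute => l lk; apply: stI; lia.
    by apply: cell_intro => //; apply: (repJ _ m0 km yk); lia.
  subst i; have -> : X k j a * colv X k k d = colv X k k d *
      (colv X j k (fun l => d l * - a)%R * X k j a).
    rewrite mulgA -colvJ_out // stN ?/conjg ?invgK ?mulgA ?mulgVK //; lia.
  apply: cell_intro => //; rewrite conjMg; apply: gpredM.
    by apply: (rep_colvJ _ m0 km yk); lia.
  by apply: (repJ _ m0 km yk); lia.
- by subst j; rewrite (colv_absorb XP) //; exists (addat i a d), y, q.
Qed.

Lemma upper_colv_cell m k j n d s : (0 < m)%N -> (k <= m)%N -> (n <= j)%N ->
  (j <= m)%N -> cell m k s -> cell m k (colv X j n d * s).
Proof.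
move=> m0 km; elim: n s => [|n IH] s nj jm sk.
  by rewrite /colv big_nil mul1g.
rewrite colv_recr -mulgA; apply: (IH) => //; first exact: ltnW.
by apply: upper_cell.
Qed.

Lemma torus_div i j u v : i != j -> u != 0%R -> v != 0%R ->
  torus X i j u * (torus X i j v)^-1 = torus X i j (u / v)%R.
Proof.
move=> ij u0 v0; rewrite -[u in LHS](mulfVK v0) [in LHS]torusM // ?mulgK //.
by rewrite mulf_neq0 ?invr_eq0.
Qed.

Lemma torus_weyl i j u v : i != j -> u != 0%R -> v != 0%R ->
  torus X i j u * weyl X i j v = weyl X i j (u * v)%R.
Proof.
move=> ij u0 v0; rewrite (torusE XP v ij) (torusE XP (u * v)%R ij).
by rewrite mulgA torusM.
Qed.

Lemma weyl_torus i j u v : i != j -> u != 0%R -> v != 0%R ->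
  weyl X i j u * torus X i j v = weyl X i j (u / v)%R.
Proof.
move=> ij u0 v0; rewrite conjgC (torusJ_weyl XP) // torus_weyl //; last first.
  by rewrite !mulf_neq0 ?invr_eq0 ?tcoef_neq0.
congr weyl; rewrite /tcoef eqxx [j == i]eq_sym (negbTE ij) eqxx.
by field.
Qed.

Lemma torusV i j u : i != j -> u != 0%R ->
  (torus X i j u)^-1 = torus X i j (u^-1)%R.
Proof.
move=> ij u0; have o0 : (1 : F)%R != 0%R by rewrite oner_eq0.
by rewrite -[LHS]mul1g -(torus1 XP ij) torus_div // mul1r.
Qed.

Lemma colvJ_weyl i j n d u : (n <= i)%N -> (n <= j)%N -> i != j -> u != 0%R ->
  exists d', colv X i n d ^ weyl X i j u = colv X j n d'.
Proof.
move=> ni nj ij u0; exists (fun l => 1 * d l / wcoef i j u i)%R.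
elim: n ni nj => [|n IH] ni nj; first by rewrite /colv !big_nil conj1g.
rewrite !colv_recr conjMg IH; try lia.
rewrite weylJ //; last lia.
have -> : wcoef i j u n = 1%R by rewrite /wcoef !ifN //; lia.
by rewrite transpL transp_id //; lia.
Qed.

Lemma weyl_rep_up m i u y q : (i < m)%N -> u != 0%R -> cell_rep m i y ->
  q \in parab m -> cell m i.+1 (weyl X i i.+1 u * y * q).
Proof.
move=> im u0 [v v0 ->] qm; rewrite im; have ii : i != i.+1 by lia.
have [i1m|i1m] := eqVneq i.+1 m.
  subst m; rewrite (weyl_weyl XP) // torus_div ?oppr_eq0 //.
  apply: cell1 => //; exists (u / - v)%R; last by rewrite ltnn.
  by rewrite mulf_neq0 ?invr_eq0 ?oppr_eq0.
rewrite [weyl X i i.+1 u * _]conjgCV (weylV XP) // weylJ_weyl ?oppr_eq0 //; try lia.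
rewrite -mulgA transpL (@transp_id i i.+1 m); try lia.
apply: cell1; last by rewrite gpredM ?weyl_parab //; lia.
eexists; last by rewrite ifT //; lia.
by rewrite !mulf_neq0 ?invr_eq0 ?wcoef_neq0 ?oppr_eq0.
Qed.

Lemma weyl_rep_down m i u y q : (i < m)%N -> u != 0%R -> cell_rep m i.+1 y ->
  q \in parab m -> cell m i (weyl X i i.+1 u * y * q).
Proof.
move=> im u0 [v v0 ->] qm; have ii : i != i.+1 by lia.
case: ltnP => [i1m|mi1].
  rewrite [weyl X i i.+1 u * _]conjgCV (weylV XP) // weylJ_weyl ?oppr_eq0 //; try lia.
  rewrite -mulgA transpR (@transp_id i i.+1 m); try lia.
  apply: cell1; last by rewrite gpredM ?weyl_parab //; lia.
  eexists; last by rewrite ifT //; lia.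
  by rewrite !mulf_neq0 ?invr_eq0 ?wcoef_neq0 ?oppr_eq0.
have mE : m = i.+1 by lia.
subst m; rewrite weyl_torus //; apply: cell1 => //; exists (u / v)%R.
  by rewrite mulf_neq0 ?invr_eq0.
by rewrite ltnSn.
Qed.

Lemma torus_rep m i u y q : (i < m)%N -> u != 0%R -> cell_rep m i.+1 y ->
  q \in parab m -> cell m i.+1 (torus X i i.+1 u * y * q).
Proof.
move=> im u0 [v v0 ->] qm; have ii : i != i.+1 by lia.
case: ltnP => [i1m|mi1].
  rewrite [torus X i i.+1 u * _]conjgCV torusV // (torusJ_weyl XP) ?invr_eq0 //; try lia.
  rewrite -mulgA; apply: cell1; last by rewrite gpredM ?torus_parab //; lia.
  eexists; last by rewrite ifT //; lia.
  by rewrite !mulf_neq0 ?invr_eq0 ?tcoef_neq0 ?invr_eq0.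
have mE : m = i.+1 by lia.
subst m; rewrite -torusM //; apply: cell1 => //; exists (u * v)%R.
  by rewrite mulf_neq0.
by rewrite ltnn.
Qed.

(** Cell [i] goes to [i.+1], and cells other than these two are preserved. From [i.+1] the outcome
    depends on the coordinate [d i]: the cell drops to [i] if it vanishes and stays otherwise, by
    [weyl_split]. *)
Lemma weyl_cell m k i u s : (0 < m)%N -> (k <= m)%N -> (i < m)%N -> u != 0%R ->
  cell m k s -> exists2 k', (k' <= m)%N & cell m k' (weyl X i i.+1 u * s).
Proof.
move=> m0 km im u0 [d [y [q [yk qm ->]]]]; rewrite !mulgA.
have ii : i != i.+1 by lia.
have [ik1|ik1|ik1] := ltngtP i.+1 k.
- have wk : (weyl X i i.+1 u)^-1 \in bounded X k.
    by rewrite gpredV; apply: weyl_bounded; lia.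
  have [d' dE] := bounded_colvJ XP d wk; exists k => //.
  have -> : weyl X i i.+1 u * colv X k k d = colv X k k d' * weyl X i i.+1 u.
    by rewrite conjgCV dE.
  by apply: cell_intro => //; apply: (rep_weylJ m0 km yk) => //; lia.
- have [ik|ik] := eqVneq i k; last first.
    exists k => //.
    have -> : weyl X i i.+1 u * colv X k k d = colv X k k d * weyl X i i.+1 u.
      apply: colv_commute => l lk; rewrite /commute [RHS]conjgC weylJ //; try lia.
      by rewrite !transp_id /wcoef ?ifN ?mul1r ?divr1 //; lia.
    by apply: cell_intro => //; apply: (rep_weylJ m0 km yk) => //; lia.
  subst k; exists i.+1 => //.
  rewrite [weyl X i i.+1 u * _]conjgCV (weylV XP) //.
  have [d' ->] : exists d', colv X i i d ^ weyl X i i.+1 (- u)%R = colv X i.+1 i d'.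
    by apply: colvJ_weyl; rewrite ?oppr_eq0 //; lia.
  rewrite -!(mulgA (colv X _ _ _)); apply: upper_colv_cell => //.
  exact: weyl_rep_up.
- subst k; have ui : (- u)%R != 0%R by rewrite oppr_eq0.
  rewrite colv_recr mulgA [weyl X i i.+1 u * _]conjgCV (weylV XP) //.
  have [d' ->] : exists d', colv X i.+1 i d ^ weyl X i i.+1 (- u)%R = colv X i i d'.
    by rewrite weyl_sym // ; apply: colvJ_weyl; rewrite ?oppr_eq0 ?invr_eq0 //; lia.
  have main : exists2 k', (k' <= m)%N &
      cell m k' (weyl X i i.+1 u * X i i.+1 (d i) * y * q).
    have [->|b0] := eqVneq (d i) 0%R.
      by exists i; [lia | rewrite st0 // mulg1; exact: weyl_rep_down].
    exists i.+1 => //; rewrite [weyl X i i.+1 u * _]conjgCV (weylV XP) // weylJ_same //.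
    set b := (- _)%R; have b1 : b != 0%R.
      by rewrite oppr_eq0 !mulf_neq0 ?invr_eq0.
    rewrite (weyl_split XP b1) // -!(mulgA (X i i.+1 _)).
    apply: upper_cell => //.
    rewrite -(mulgA (weyl _ _ _ _)) [X i i.+1 _ * _]conjgC weylJ_same //.
    rewrite mulgA (weyl_weyl XP) // torus_div ?oppr_eq0 ?invr_eq0 //.
    set b' := (- _)%R.
    rewrite -(mulgA (torus X _ _ _)) [X i.+1 i _ * _]conjgC mulgA -mulgA.
    apply: torus_rep => //; first by rewrite !mulf_neq0 ?invr_eq0 ?oppr_eq0 ?invr_eq0.
    by rewrite gpredM //; apply: (repJ _ m0 im yk); lia.
  case: main => k' k'm ck'; exists k' => //.
  rewrite -!(mulgA (colv X _ _ _)); by apply: upper_colv_cell => //; lia.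
Qed.

Definition in_cell m s := exists2 k, (k <= m)%N & cell m k s.

Lemma in_cell_weyl m i u s : (0 < m)%N -> (i < m)%N -> u != 0%R ->
  in_cell m s -> in_cell m (weyl X i i.+1 u * s).
Proof.
move=> m0 im u0 [k km ks]; have [k' k'm k's] := weyl_cell m0 km im u0 ks.
by exists k'.
Qed.

(** Upper factors keep the cell, [X i.+1 i] is a Weyl conjugate of an upper factor, and the other
    lower ones are commutators built from these. *)
Lemma in_cellX m i j a s : (0 < m)%N -> (i <= m)%N -> (j <= m)%N -> i != j ->
  in_cell m s -> in_cell m (X i j a * s).
Proof.
move=> m0 im jm ij.
have up i' j' b t : (i' < j')%N -> (j' <= m)%N -> in_cell m t ->
    in_cell m (X i' j' b * t).
  by move=> ij' jm' [k km kt]; exists k => //; apply: upper_cell.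
case: (ltnP i j) => [lij|ji]; first exact: up.
have lji : (j < i)%N by lia.
have simple i' b t : (i' < m)%N -> in_cell m t -> in_cell m (X i'.+1 i' b * t).
  move=> im' tm; have ii : i' != i'.+1 by lia.
  have o0 : (1 : F)%R != 0%R by rewrite oner_eq0.
  have := weylJ_same XP (- b)%R o0 ii.
  rewrite invr1 !mul1r opprK => <-.
  rewrite /conjg (weylV XP) // -(mulgA (weyl X _ _ _)) -(mulgA (X _ _ _)).
  apply: in_cell_weyl => //.
    by rewrite oppr_eq0.
  by apply: up => //; apply: in_cell_weyl.
elim: i {ij ji} lji im a s => [//|i IH]; rewrite ltnS => ji im a s sm.
have [->|nji] := eqVneq j i; first exact: simple.
have lji : (j < i)%N by lia.
rewrite (@stRE _ _ _ XP i.+1 i j); try lia.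
rewrite /commg /conjg !invgK -!stN; try lia.
rewrite -!mulgA; apply: (simple) => //; apply: (IH) => //; first exact: ltnW.
by apply: (simple) => //; apply: IH => //; exact: ltnW.
Qed.

Lemma bounded_in_cell m s : (0 < m)%N -> s \in bounded X m.+1 -> in_cell m s.
Proof.
move=> m0; elim/(bounded_ind XP) => // [|i j a {}s im jm ij sm]; last exact: in_cellX.
exists m => //; rewrite -[1]mulg1; apply: cell1; last exact: gpred1.
by exists 1%R; rewrite ?oner_eq0 // ltnn torus1 //; lia.
Qed.

Lemma parab_col m q : q \in parab m -> forall r, (entry (p q) r m = (r == m)%:R)%R.
Proof.
elim/parab_ind => [r|i j a {}q im jm ij IH r]; first by rewrite hom1.
by rewrite (entryX pX) // !IH [j == m]ltn_eqF // mulr0 if_same addr0.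
Qed.

Lemma bounded_row m s c : s \in bounded X m -> (entry (p s) m c = (m == c)%:R)%R.
Proof.
elim/(bounded_ind XP) => [|i j a {}s im jm ij IH]; first by rewrite hom1.
by rewrite (entryX pX) // IH [m == i]gtn_eqF // addr0.
Qed.

Lemma ker_bounded_step m s : (0 < m)%N -> p s = 1 -> s \in bounded X m.+1 ->
  s \in bounded X m.
Proof.
move=> m0 ps /(bounded_in_cell m0) [k km [d [y [q [[u u0 yE] qm sE]]]]].
have m1m : m.-1 != m by lia.
have es r c : (entry (p s) r c = (r == c)%:R)%R by rewrite ps.
have qcol := parab_col qm.
move: yE; case: ltnP => [ltkm yE|mk yE].
  (* A cell with [k < m] would put the nonzero [u] at the off-diagonal entry [(k, m)]. *)
  have := es k m; rewrite sE yE -mulgA (entry_colv pX) // ltnn addr0.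
  rewrite (entry_weyl pX) ?eqxx ?qcol ?eqxx ?mulr1 ?ltn_eqF //.
  by move/eqP; rewrite (negbTE u0).
have {mk km} kE : k = m by lia.
subst k; have ey c r : (entry (p (y * q)%g) r c = torus_val m.-1 m u r * entry (p q) r c)%R.
  by rewrite yE (entry_torus pX).
have u1 : u = 1%R.
  have := es m m; rewrite sE -mulgA (entry_colv pX) // ltnn addr0 ey qcol eqxx.
  by rewrite mulr1 /torus_val eqxx [m == _]gtn_eqF ?ltn_predL // => /(canRL invrK); rewrite invr1.
have y1 : y = 1 by rewrite yE u1 torus1.
have d0 r : (r < m)%N -> d r = 0%R.
  move=> rm; have := es r m; rewrite sE y1 mulg1 (entry_colv pX) // rm !qcol.
  by rewrite eqxx mulr1 [r == m]ltn_eqF // add0r.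
have {y1 d0} sq : s = q.
  by rewrite sE y1 mulg1 (@eq_colv _ _ _ _ _ _ (fun=> 0%R)) // colv0 // mul1g.
(* The column part is gone. Rows of index below [m] show that [t] is the identity there, and then
   row [m] reads off the coordinates [a]. *)
have [a [t [tm qE]]] := parab_dec qm.
have et r c : (r < m)%N -> (entry (p t) r c = (r == c)%:R)%R.
  by move=> rm; rewrite -es sq qE (entry_rowv pX) // [r == m]ltn_eqF // addr0.
have a0 c : (c < m)%N -> a c = 0%R.
  move=> cm; have := es m c; rewrite sq qE (entry_rowv pX) // eqxx.
  rewrite bounded_row // [m == c]gtn_eqF // add0r.
  rewrite (bigD1_seq c) ?iota_uniq ?mem_index_iota //= et // eqxx mulr1.
  rewrite big_seq_cond big1 ?addr0 // => l /andP []; rewrite mem_index_iota.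
  by move=> /andP [_ lm] /negbTE lc; rewrite et // lc mulr0.
by rewrite sq qE (@eq_rowv _ _ _ _ _ _ (fun=> 0%R)) // rowv0 // mul1g.
Qed.

Lemma ker_trivial s : p s = 1 -> s = 1.
Proof.
move=> ps; have [n] := X_gen s; case: n => [|n].
  by elim/(bounded_ind XP).
(* The descent needs [0 < m] and so ends at size 1, where no pair of distinct indices exists. *)
elim: n => [|n IH] sn; last by apply: IH; apply: ker_bounded_step.
by elim/(bounded_ind XP): s / sn {ps} => // i j a s; rewrite !ltnS !leqn0 => /eqP -> /eqP ->.
Qed.

End TrivialSymbols.

(** * The map from Milnor K-theory to K_2 *)

Lemma hom_weyl (F F' : fieldType) (S S' : groupType) (X : nat -> nat -> F -> S)
    (X' : nat -> nat -> F' -> S') (f : {multiplicative S -> S'})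
    (h : {rmorphism F -> F'}) :
  (forall i j a, i != j -> f (X i j a) = X' i j (h a)) ->
  forall i j u, i != j -> f (weyl X i j u) = weyl X' i j (h u).
Proof.
move=> fX i j u ij; have ji : j != i by rewrite eq_sym.
by rewrite /weyl !gmulfM !fX // rmorphN fmorphV.
Qed.

Lemma hom_torus (F F' : fieldType) (S S' : groupType) (X : nat -> nat -> F -> S)
    (X' : nat -> nat -> F' -> S') (f : {multiplicative S -> S'})
    (h : {rmorphism F -> F'}) :
  (forall i j a, i != j -> f (X i j a) = X' i j (h a)) ->
  forall i j u, i != j -> f (torus X i j u) = torus X' i j (h u).
Proof.
by move=> fX i j u ij; rewrite /torus gmulfM !(hom_weyl fX) // rmorphN rmorph1.
Qed.

Section StX.
Variable F : fieldType.
Implicit Types (i j k l : nat) (a b u v : F).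

(** Total in the indices, with value 1 on the diagonal, so that computations carry no proofs of
    [i != j]. *)
Definition st_X i j a : St F :=
  if insub (i, j) is Some q then st_gen q a else 1.

Lemma st_XE i j (h : i != j) a : st_X i j a = st_gen (exist _ (i, j) h) a.
Proof. by rewrite /st_X insubT. Qed.

Lemma st_genE (q : offdiag) a : st_gen q a = st_X (val q).1 (val q).2 a.
Proof. by case: q => -[i j] h; rewrite st_XE. Qed.

Lemma commE (G : groupType) (x y z : G) :
  x * y * x^-1 * y^-1 = z -> x * y = z * y * x.
Proof. by move=> <-; rewrite !mulgVK. Qed.

Lemma st_X_family : steinberg_family st_X.
Proof.
have rel (x y : word (offdiag * F)%type) : st_rel x y ->
    weval (pgen (@st_rel F)) x = weval (pgen (@st_rel F)) y.
  by move=> uv; rewrite !weval_pgen; apply/ppiP/presP_rel.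
split=> [i j a b ij|i j k a b ij jk ik|i j k l a b ij kl jk il].
- rewrite !st_XE; have := rel _ _ (st_rel_add ij a b).
  by rewrite weval_cat !weval_gen.
- rewrite !st_XE; have := rel _ _ (st_rel_comm ij jk ik a b).
  by rewrite weval_comm !weval_gen => /commE.
- rewrite !st_XE; have := rel _ _ (st_rel_comm1 ij kl a b jk il).
  by rewrite weval_comm !weval_gen => /commE ->; rewrite mul1g.
Qed.

Lemma phi_st_X i j (h : i != j) a : phi F (st_X i j a) = elem (exist _ (i, j) h) a.
Proof. by rewrite st_XE phiE. Qed.

Lemma st_X_gen (s : St F) : exists n, s \in bounded st_X n.
Proof.
elim/pres_ind: s => [|[q a]|s t [m sm] [n tn]|s [n sn]].
- by exists 0; exact: gpred1.
- exists (maxn (val q).1 (val q).2).+1; rewrite -[pgen _ _]/(st_gen q a) st_genE.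
  by apply: mem_bounded; rewrite ?ltnS ?leq_maxl ?leq_maxr //; exact: (valP q).
- exists (maxn m n); apply: gpredM.
    by apply: (boundedW st_X_family) sm; rewrite leq_maxl.
  by apply: (boundedW st_X_family) tn; rewrite leq_maxr.
- by exists n; rewrite gpredV.
Qed.

Definition st_symb u v : St F := symb st_X 0 1 2 u v.

Lemma phi_symb u v : u != 0%R -> v != 0%R -> phi F (st_symb u v) = 1.
Proof. by move=> u0 v0; apply: (p_symb phi_st_X). Qed.

Lemma st_symb_central u v (s : St F) : u != 0%R -> v != 0%R ->
  commute (st_symb u v) s.
Proof.
by move=> u0 v0; apply: (symb_comm st_X_family phi_st_X st_X_gen).
Qed.

Lemma st_symbMl u u' v : u != 0%R -> u' != 0%R -> v != 0%R ->
  st_symb (u * u')%R v = st_symb u v * st_symb u' v.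
Proof. by move=> *; apply: (symbMl st_X_family phi_st_X st_X_gen). Qed.

Lemma st_symbMr u v v' : u != 0%R -> v != 0%R -> v' != 0%R ->
  st_symb u (v * v')%R = st_symb u v * st_symb u v'.
Proof. by move=> *; apply: (symbMr st_X_family phi_st_X st_X_gen). Qed.

Lemma st_symb_steinberg u v : u != 0%R -> v != 0%R -> (u + v = 1)%R ->
  st_symb u v = 1.
Proof. by move=> *; apply: (symb_steinberg st_X_family phi_st_X st_X_gen). Qed.

Definition symb_sub : normalSubgroup (St F) :=
  ncl [set s | exists u v, [/\ u != 0%R, v != 0%R & s = st_symb u v]]%classic.

Lemma symb_sub_ker s : s \in symb_sub -> phi F s = 1.
Proof.
pose N := @NormalSubgroup _ (hom_ker (phi F)).
have Nn x y : x \in hom_ker (phi F) -> x ^ y \in hom_ker (phi F).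
  by rewrite !hom_kerE homJ => /eqP ->; rewrite conj1g.
move=> sC; apply/eqP; rewrite -hom_kerE.
apply: (ncl_min (N := NormalSubgroup Nn)) sC => _ [u [v [u0 v0 ->]]].
by rewrite hom_kerE phi_symb.
Qed.

Let Q := quo symb_sub.
Let q_X i j a : Q := qpi symb_sub (st_X i j a).

Let q_X_family : steinberg_family q_X.
Proof.
have [D R I] := st_X_family; split=> [i j a b ij|i j k a b ij jk ik|i j k l a b ij kl jk il].
- by have := congr1 (qpi symb_sub) (D i j a b ij); rewrite qpiM.
- by have := congr1 (qpi symb_sub) (R i j k a b ij jk ik); rewrite !qpiM.
- by have := congr1 (qpi symb_sub) (I i j k l a b ij kl jk il); rewrite !qpiM.
Qed.

Let q_phi := quo_lift symb_sub_ker.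

Let q_phi_X i j (h : i != j) a : q_phi (q_X i j a) = elem (exist _ (i, j) h) a.
Proof. by rewrite -(phi_st_X h); exact: (qliftE symb_sub_ker). Qed.

Let q_X_gen s : exists n, s \in bounded q_X n.
Proof.
have [n] := st_X_gen (qrepr s); rewrite -{2}(qreprK s).
elim/(bounded_ind st_X_family) => [|i j a t ni nj ij [m tm]].
  by exists 0; exact: gpred1.
exists (maxn n m); rewrite qpiM gpredM //; last first.
  by apply: (boundedW q_X_family) tm; rewrite leq_maxr.
by apply: mem_bounded => //; rewrite leq_max ?ni ?nj.
Qed.

Let q_torusE i j u : i != j -> torus q_X i j u = qpi symb_sub (torus st_X i j u).
Proof.
move=> ij; symmetry.
exact: (hom_torus (X := st_X) (X' := q_X) (f := qpi symb_sub) (h := idfun)).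
Qed.

(** The argument for [symb_steinberg] read backwards: triviality of the symbol at [(u, v^-1)] is
    multiplicativity at [u], [v]. *)
Let q_torusM i j u v : i != j -> u != 0%R -> v != 0%R ->
  torus q_X i j (u * v)%R = torus q_X i j u * torus q_X i j v.
Proof.
move=> ij u0 v0; have v0' : (v^-1)%R != 0%R by rewrite invr_eq0.
have [k [ik jk]] : exists k, i != k /\ j != k by exists (maxn i j).+1; lia.
have ki : k != i by rewrite eq_sym.
have : qpi symb_sub (symb st_X i j k u (v^-1)%R) = 1.
  apply/qpi_eq1; rewrite (symb_indep st_X_family phi_st_X st_X_gen) //.
  by apply: mem_ncl; exists u, (v^-1)%R.
rewrite /symb homR /= -!q_torusE // commgEl (torus_torusJ q_X_family) //.
rewrite /tcoef eqxx (negbTE jk) [j == i]eq_sym (negbTE ij) divr1 invrK.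
move/(congr1 (fun x => torus q_X i j u * x * torus q_X i j v)).
by rewrite mulg1 mulVKg mulgVK [(v * u)%R]mulrC.
Qed.

Lemma K2_symb_gen s : phi F s = 1 -> s \in symb_sub.
Proof.
move=> ps; apply/qpi_eq1.
apply: (ker_trivial q_X_family q_phi_X q_X_gen q_torusM).
by rewrite -ps; exact: (qliftE symb_sub_ker).
Qed.

End StX.

Section Matsumoto.
Variable F : fieldType.
Implicit Types (u v : ustar F) (s : St F).

Lemma ustar_neq0 u : val u != 0%R.
Proof. by rewrite -unitfE; exact: valP. Qed.

Fact K2symb_subproof u v : st_symb (val u) (val v) \in K2_sub F.
Proof. by rewrite hom_kerE phi_symb // ustar_neq0. Qed.

Definition K2symb (f : {ffun 'I_2 -> ustar F}) : K2 F :=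
  Sub (st_symb (val (f ord0)) (val (f ord_max))) (K2symb_subproof _ _).

Lemma incl_K2symb f : incl (K2symb f) = st_symb (val (f ord0)) (val (f ord_max)).
Proof. by []. Qed.

Lemma ord2P (i : 'I_2) : i = ord0 \/ i = ord_max.
Proof. by case: i => -[|[|//]] ?; [left|right]; apply: val_inj. Qed.

Fact K2symb_rel x y : tens_rel x y -> weval K2symb x = weval K2symb y.
Proof.
case=> {x y} [i f g h hi hj|f g]; rewrite !weval_cat !weval_gen;
  apply: incl_inj; rewrite !gmulfM /= !incl_K2symb.
- have n0 := ustar_neq0; case: (ord2P i) => ii; subst i.
    by have [-> ->] := hj ord_max isT; rewrite hi -st_symbMl.
  by have [-> ->] := hj ord0 isT; rewrite hi -st_symbMr.
- by apply: st_symb_central; exact: ustar_neq0.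
Qed.

Definition tpow_K2 : {multiplicative tpow (ustar F) 2 -> K2 F} :=
  pres_lift K2symb_rel.

Fact tpow_K2_ker x : x \in steinberg_sub 2 F -> tpow_K2 x = 1.
Proof.
rewrite genE => /asboolP.
elim=> {x} [_ [f [i [j [ij fij ->]]]]||x y _ hx _ hy|x _ hx].
- rewrite [LHS]pres_liftE; apply: incl_inj; rewrite incl_K2symb hom1.
  have [i0 j1] : i = ord0 /\ j = ord_max.
    case: (ord2P i) (ord2P j) ij => -> [->|->] //= ij.
  by subst i j; apply: st_symb_steinberg; rewrite ?ustar_neq0.
- exact: hom1.
- by rewrite gmulfM hx hy mulg1.
- by rewrite homV hx invg1.
Qed.

Definition matsumoto : {multiplicative KM 2 F -> K2 F} := quo_lift tpow_K2_ker.

Definition milnor f : KM 2 F := qpi (steinberg_sub 2 F) (tens f).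

Lemma matsumotoE f : matsumoto (milnor f) = K2symb f.
Proof. by rewrite [LHS](qliftE tpow_K2_ker) [LHS]pres_liftE. Qed.

Lemma matsumoto_surj k : exists x, matsumoto x = k.
Proof.
suff h s : s \in symb_sub F -> exists x, incl (matsumoto x) = s.
  have [|x xk] := h (incl k); last by exists x; apply: incl_inj.
  by apply: K2_symb_gen; apply/eqP; rewrite -hom_kerE; exact: (valP k).
rewrite genE => /asboolP.
elim=> {s} [_ [s [t [[u [v [u0 v0 ->]]] ->]]]||s t _ [x <-] _ [y <-]|s _ [x <-]].
- have uu : u \is a GRing.unit by rewrite unitfE.
  have vu : v \is a GRing.unit by rewrite unitfE.
  exists (milnor [ffun i => if i == ord0 then exist _ u uu else exist _ v vu]).
  by rewrite matsumotoE incl_K2symb !ffunE /= /conjg st_symb_central // mulKg.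
- by exists 1; rewrite !hom1.
- by exists (x * y); rewrite !gmulfM.
- by exists x^-1; rewrite !homV.
Qed.

Variables (Gam : groupType) (r : raction Gam F).

Lemma St_act_symb g (u v : F) : St_act r g (st_symb u v) = st_symb (r g u) (r g v).
Proof.
have h i j a : i != j -> act_hom (St_act r) g (st_X i j a) = st_X i j (r g a).
  by move=> ij; rewrite !st_XE; exact: St_actE.
by rewrite -[LHS]/(act_hom (St_act r) g _) homR !(hom_torus h).
Qed.

Lemma KM_act_milnor g f : KM_act 2 r g (milnor f) = milnor (ffun_act r g f).
Proof.
rewrite [LHS](quo_funE (@steinberg_stable 2 F Gam r)); congr qpi.
exact: tpow_actE.
Qed.

Lemma KM_ind (P : KM 2 F -> Prop) : P 1 -> (forall f, P (milnor f)) ->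
  (forall x y, P x -> P y -> P (x * y)) -> (forall x, P x -> P x^-1) ->
  forall x, P x.
Proof.
move=> P1 Pf PM PV x; rewrite -(qreprK x).
elim/pres_ind: (qrepr x) => [|f|u v hu hv|u hu]; first by rewrite hom1.
- exact: Pf.
- by rewrite qpiM; apply: PM.
- by rewrite homV; apply: PV.
Qed.

Lemma matsumoto_equiv g x : matsumoto (KM_act 2 r g x) = K2_act r g (matsumoto x).
Proof.
elim/KM_ind: x => [|f|x y hx hy|x hx].
- by rewrite !(hom1, gact_one).
- have e k : incl (K2_act r g k) = St_act r g (incl k) by [].
  rewrite KM_act_milnor !matsumotoE; apply: incl_inj.
  by rewrite e !incl_K2symb St_act_symb !ffunE.
- by rewrite !(gactM, gmulfM) hx hy.
- by rewrite gactV !homV hx gactV.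
Qed.

End Matsumoto.

(** * Extensions defined by potentials *)

Section AdditiveNormalForm.
Variable A : zmodType.
Local Open Scope ring_scope.

Inductive zexpr := ZVar of nat | ZZero | ZAdd of zexpr & zexpr | ZOpp of zexpr.

Fixpoint zeval (env : seq A) e : A :=
  match e with
  | ZVar i => nth 0 env i
  | ZZero => 0
  | ZAdd e1 e2 => zeval env e1 + zeval env e2
  | ZOpp e1 => - zeval env e1
  end.

Fixpoint zcoef e (i : nat) : int :=
  match e with
  | ZVar j => (i == j)%:R
  | ZZero => 0
  | ZAdd e1 e2 => zcoef e1 i + zcoef e2 i
  | ZOpp e1 => - zcoef e1 i
  end.

Lemma zevalE env e :
  zeval env e = \sum_(i < size env) nth 0 env i *~ zcoef e i.
Proof.
elim: e => [j||e1 IH1 e2 IH2|e1 IH] /=.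
- have [jn|nj] := ltnP j (size env).
    rewrite (bigD1 (Ordinal jn)) //= eqxx mulr1z big1 ?addr0 // => i ij.
    by rewrite (_ : (i == j :> nat) = false) ?mulr0z //; apply/negbTE.
  rewrite nth_default // big1 // => i _.
  by rewrite (_ : (i == j :> nat) = false) ?mulr0z // ltn_eqF // (leq_trans _ nj).
- by rewrite big1 // => i _; rewrite mulr0z.
- by rewrite IH1 IH2 -big_split; apply: eq_bigr => i _; rewrite mulrzDr.
- by rewrite IH -sumrN; apply: eq_bigr => i _; rewrite mulrNz.
Qed.

Lemma zmod_eq env e1 e2 :
  all (fun i => zcoef e1 i == zcoef e2 i) (iota 0 (size env)) ->
  zeval env e1 = zeval env e2.
Proof.
move=> /allP h; rewrite !zevalE; apply: eq_bigr => i _.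
by rewrite (eqP (h i _)) // mem_iota ltn_ord.
Qed.

End AdditiveNormalForm.

Ltac zmod_mem x env :=
  lazymatch env with
  | nil => constr:(false)
  | x :: _ => constr:(true)
  | _ :: ?env' => zmod_mem x env'
  end.
Ltac zmod_idx x env :=
  lazymatch env with
  | x :: _ => constr:(0%N)
  | _ :: ?env' => let i := zmod_idx x env' in constr:(S i)
  end.
Ltac zmod_atoms e env :=
  lazymatch e with
  | (?a + ?b)%R => let env' := zmod_atoms a env in zmod_atoms b env'
  | (- ?a)%R => zmod_atoms a env
  | 0%R => env
  | _ => lazymatch zmod_mem e env with true => env | false => constr:(e :: env) end
  end.
Ltac zmod_reify e env :=
  lazymatch e with
  | (?a + ?b)%R => let a' := zmod_reify a env in let b' := zmod_reify b env in
      constr:(ZAdd a' b')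
  | (- ?a)%R => let a' := zmod_reify a env in constr:(ZOpp a')
  | 0%R => constr:(ZZero)
  | _ => let i := zmod_idx e env in constr:(ZVar i)
  end.
(* Proves equalities that hold in every abelian group.                        *)
Ltac zmod :=
  lazymatch goal with
  | |- @eq ?T ?a ?b =>
    let env := zmod_atoms a (@nil T) in
    let env := zmod_atoms b env in
    let a' := zmod_reify a env in
    let b' := zmod_reify b env in
    exact: (@zmod_eq _ env a' b' isT)
  end.

(** Connectedness is encoded by its effect on [A]-valued functions, the form in which it makes the
    kernel central. *)
Record potential (A : zmodType) (G : groupType) := Potential {
  pt_state : Type;
  pt_kind : Type;
  pt_act : G -> pt_state -> pt_state;
  pt_act1 : forall y, pt_act 1 y = y;
  pt_actM : forall g h y, pt_act (g * h) y = pt_act g (pt_act h y);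
  pt_edge : pt_kind -> pt_state -> pt_state -> Prop;
  pt_edgeP : forall g k y y', pt_edge k y y' -> pt_edge k (pt_act g y) (pt_act g y');
  pt_val : pt_kind -> pt_state -> pt_state -> A;
  pt_base : pt_state;
  pt_connected : forall f : pt_state -> A,
    (forall k y y', pt_edge k y y' -> f y = f y') -> forall y, f y = f pt_base }.

Section PotentialGroup.
Variables (A : zmodType) (G : groupType) (t : potential A G).
Local Open Scope ring_scope.

(* Lifts of the translations by G to automorphisms of the A-torsor over the   *)
(* states that is trivialised up to [pt_val] along the edges.                  *)
Definition compat (g : G) (f : pt_state t -> A) := forall k y y', pt_edge k y y' ->
  f y' - f y = pt_val k (pt_act g y) (pt_act g y') - pt_val k y y'.

Record ext := Ext { ext_g : G; ext_f : pt_state t -> A; ext_compat : compat ext_g ext_f }.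

Lemma ext_eq x y : ext_g x = ext_g y -> ext_f x =1 ext_f y -> x = y.
Proof.
case: x y => [g f c] [g' f' c'] /= gg /funext ff; subst g' f'.
by congr Ext; exact: Prop_irrelevance.
Qed.

HB.instance Definition _ := gen_eqMixin ext.
HB.instance Definition _ := gen_choiceMixin ext.

Fact ext_one_compat : compat 1%g (fun=> 0).
Proof. by move=> k y y' _; rewrite !pt_act1 !subrr. Qed.
Definition ext_one := Ext ext_one_compat.

Fact ext_mul_compat x y :
  compat (ext_g x * ext_g y)%g (fun z => ext_f x (pt_act (ext_g y) z) + ext_f y z).
Proof.
move=> k z z' zz; rewrite !pt_actM.
have := ext_compat x (pt_edgeP (ext_g y) zz); have := ext_compat y zz.
by rewrite opprD addrACA => -> ->; zmod.
Qed.
Definition ext_mul x y := Ext (ext_mul_compat x y).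

Fact ext_inv_compat x :
  compat (ext_g x)^-1%g (fun z => - ext_f x (pt_act (ext_g x)^-1%g z)).
Proof.
move=> k z z' zz; have := ext_compat x (pt_edgeP (ext_g x)^-1%g zz).
rewrite -!pt_actM !mulgV !pt_act1 => h.
by rewrite -opprD h; zmod.
Qed.
Definition ext_inv x := Ext (ext_inv_compat x).

Fact ext_mulA : associative ext_mul.
Proof.
move=> x y z; apply: ext_eq => [|w] /=; first by rewrite mulgA.
by rewrite pt_actM addrA.
Qed.
Fact ext_mul1 : left_id ext_one ext_mul.
Proof. by move=> x; apply: ext_eq => [|w] /=; rewrite ?mul1g ?add0r. Qed.
Fact ext_mulr1 : right_id ext_one ext_mul.
Proof. by move=> x; apply: ext_eq => [|w] /=; rewrite ?mulg1 ?addr0 ?pt_act1. Qed.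
Fact ext_mulV : left_inverse ext_one ext_inv ext_mul.
Proof.
move=> x; apply: ext_eq => [|w] /=; first by rewrite mulVg.
by rewrite -pt_actM mulVg pt_act1 addNr.
Qed.
Fact ext_mulrV : right_inverse ext_one ext_inv ext_mul.
Proof.
move=> x; apply: ext_eq => [|w] /=; first by rewrite mulgV.
by rewrite subrr.
Qed.
HB.instance Definition _ :=
  isGroup.Build ext ext_mulA ext_mul1 ext_mulr1 ext_mulV ext_mulrV.

Fact ext_gM : {morph ext_g : x y / (x * y)%g}. Proof. by []. Qed.
HB.instance Definition _ := isMultiplicative.Build ext G ext_g ext_gM.

Lemma ext_fM x y z : ext_f (x * y)%g z = ext_f x (pt_act (ext_g y) z) + ext_f y z.
Proof. by []. Qed.

(** Over the identity the prescribed variation is zero along every edge. *)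
Lemma ext_ker_const x y : ext_g x = 1%g -> ext_f x y = ext_f x (pt_base t).
Proof.
move=> x1; apply: pt_connected => k z z' zz.
have := ext_compat x zz; rewrite x1 !pt_act1 subrr => /eqP.
by rewrite subr_eq0 => /eqP.
Qed.

Lemma ext_central x y : ext_g x = 1%g -> commute x y.
Proof.
move=> x1; apply: ext_eq => [|z]; first by rewrite !ext_gM x1 mulg1 mul1g.
by rewrite !ext_fM x1 pt_act1 (ext_ker_const _ x1) (ext_ker_const z x1) addrC.
Qed.

End PotentialGroup.

(** * Minors of generic columns *)

Section LeadingMinors.
Variable R : comNzRingType.
Local Open Scope ring_scope.
Implicit Types (f g : nat -> nat -> R) (m i j a b : nat) (c : R).

(** The leading minors of one infinite array, so that sizes and shifted indices vary without
    casts. *)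
Definition minor m f : R := \det (\matrix_(a < m, b < m) f a b).

Lemma eq_minor m f g : (forall a b, (a < m)%N -> (b < m)%N -> f a b = g a b) ->
  minor m f = minor m g.
Proof.
by move=> fg; congr (\det _); apply/matrixP => a b; rewrite !mxE fg.
Qed.

Lemma minor0 f : minor 0 f = 1.
Proof. exact: det_mx00. Qed.

Lemma minor_rowop m f i j c : (i < m)%N -> (j < m)%N -> i != j ->
  minor m (fun a b => f a b + (if a == i then c * f j b else 0)) = minor m f.
Proof.
move=> im jm ij; pose i' := Ordinal im; pose j' := Ordinal jm.
pose B : 'M[R]_m := \matrix_(a, b) (if a == i' then f j b else f a b).
rewrite /minor (@determinant_multilinear _ _ _ (\matrix_(a, b) f a b) B i' 1 c).
- rewrite mul1r [X in _ + _ * X](@determinant_alternate _ _ _ i' j') ?mulr0 ?addr0 //.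
  by move=> b; rewrite !mxE eqxx; case: eqP.
- by apply/rowP => b; rewrite !mxE !eqxx mul1r.
- apply/matrixP => a b; rewrite !mxE -[(lift i' a : nat) == i]/(lift i' a == i').
  by rewrite eq_sym (negbTE (neq_lift _ _)) addr0.
- apply/matrixP => a b; rewrite !mxE -[(lift i' a : nat) == i]/(lift i' a == i').
  by rewrite eq_sym (negbTE (neq_lift _ _)) addr0.
Qed.

Lemma minor_lastrow m f g h c : (forall a b, (a < m)%N -> f a b = g a b) ->
  (forall a b, (a < m)%N -> f a b = h a b) ->
  (forall b, f m b = g m b + c * h m b) ->
  minor m.+1 f = minor m.+1 g + c * minor m.+1 h.
Proof.
move=> fg fh fm; rewrite /minor (@determinant_multilinear _ _ _
  (\matrix_(a, b) g a b) (\matrix_(a, b) h a b) ord_max 1 c) ?mul1r //.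
- by apply/rowP => b; rewrite !mxE mul1r fm.
- by apply/matrixP => a b; rewrite !mxE fg // lift_max.
- by apply/matrixP => a b; rewrite !mxE fh // lift_max.
Qed.

Lemma minor_scale m f (t : nat -> R) :
  minor m (fun a b => t a * f a b) = (\prod_(0 <= a < m) t a) * minor m f.
Proof.
rewrite /minor; have -> : \matrix_(a < m, b < m) (t a * f a b) =
    diag_mx (\row_a t a) *m \matrix_(a, b) f a b.
  by apply/matrixP => a b; rewrite mul_diag_mx !mxE.
rewrite det_mulmx det_diag big_mkord; congr (_ * _).
by apply: eq_bigr => a _; rewrite mxE.
Qed.

Definition swap_idx i k := if k == i then i.+1 else if k == i.+1 then i else k.

Lemma minor_colswap m f i : (i.+1 < m)%N ->
  minor m (fun a b => f a (swap_idx i b)) = - minor m f.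
Proof.
move=> im; have im' : (i < m)%N by apply: ltnW.
pose i1 := Ordinal im'; pose i2 := Ordinal im.
have -> : minor m (fun a b => f a (swap_idx i b)) =
    \det (xcol i1 i2 (\matrix_(a < m, b < m) f a b)).
  congr (\det _); apply/matrixP => a b; rewrite !mxE; congr (f a _).
  rewrite permE /= /swap_idx -!(inj_eq val_inj) /=.
  by do 2?case: ifP.
rewrite xcolE det_mulmx det_perm odd_tperm.
rewrite -(inj_eq val_inj) /= (_ : i != i.+1) //; last by lia.
by rewrite expr1 mulrN1.
Qed.

End LeadingMinors.

(** * The Desnanot-Jacobi identity *)

Section DesnanotJacobi.
Local Open Scope ring_scope.

Lemma minor_map (R S : comNzRingType) (h : {rmorphism R -> S}) m f :
  minor m (fun a b => h (f a b)) = h (minor m f).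
Proof.
by rewrite /minor -det_map_mx; congr (\det _); apply/matrixP => a b; rewrite !mxE.
Qed.

Lemma det_schur (K : fieldType) m n (A : 'M[K]_m) (B : 'M_(m, n)) C (D : 'M_n) :
  A \in unitmx -> \det (block_mx A B C D) = \det A * \det (D - C *m invmx A *m B).
Proof.
move=> uA; have -> : block_mx A B C D =
    block_mx 1%:M 0 (C *m invmx A) 1%:M *m block_mx A B 0 (D - C *m invmx A *m B).
  rewrite mulmx_block !mul1mx !mul0mx !addr0 mulmxKV //.
  by rewrite addrCA subrr addr0.
by rewrite det_mulmx det_lblock det_ublock !det1 !mul1r.
Qed.

Lemma det_mx22 (R : comNzRingType) (M : 'M[R]_2) :
  \det M = M 0 0 * M 1 1 - M 0 1 * M 1 0.
Proof.
rewrite (expand_det_row _ 0) !big_ord_recl big_ord0 addr0 /cofactor !det_mx11 !mxE.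
have -> : lift 0 0 = 1 :> 'I_2 by apply: val_inj.
have -> : lift 1 0 = 0 :> 'I_2 by apply: val_inj.
by rewrite expr0 mul1r expr1 mulN1r mulrN.
Qed.

Lemma minor_bordered (K : fieldType) i (f : nat -> nat -> K) :
  let A := \matrix_(a < i, b < i) f a b in A \in unitmx ->
  minor i.+1 f = \det A * (f i i - \sum_(k < i) (\sum_(l < i) f i l * invmx A l k) * f k i).
Proof.
move=> A uA; have -> : minor i.+1 f = minor (i + 1) f by rewrite addn1.
rewrite /minor; have -> : \matrix_(a < i + 1, b < i + 1) f a b =
    block_mx A (\col_a f a i) (\row_b f i b) (f i i)%:M.
  apply/matrixP => a b; rewrite mxE.
  case: (split_ordP a) => a' ->; case: (split_ordP b) => b' ->;
    rewrite ?(block_mxEul, block_mxEur, block_mxEdl, block_mxEdr) !mxE //=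
      ?[a']ord1 ?[b']ord1 /= ?addn0 ?mulr1n //.
rewrite det_schur // [in X in _ * X]det_mx11 !mxE eqxx mulr1n; congr (_ * (_ - _)).
apply: eq_bigr => k _; rewrite !mxE; congr (_ * _).
by apply: eq_bigr => l _; rewrite !mxE.
Qed.

Definition skip_idx i k := if k == i then i.+1 else k.

(** Schur complements of the leading block of size [i] turn the minors of size [i+1] into its
    determinant times the entries of a 2 by 2 matrix, and the minor of size [i+2] into its
    determinant times that of this matrix. *)
Lemma desnanot_jacobi_field (K : fieldType) i (f : nat -> nat -> K) :
  minor i f != 0 ->
  minor i.+1 f * minor i.+1 (fun a b => f (skip_idx i a) (skip_idx i b)) -
  minor i.+1 (fun a b => f a (skip_idx i b)) *
    minor i.+1 (fun a b => f (skip_idx i a) b) = minor i f * minor i.+2 f.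
Proof.
move=> nz; pose A := \matrix_(a < i, b < i) f a b.
have uA : A \in unitmx by rewrite unitmxE unitfE.
pose S x y := f x y - \sum_(k < i) (\sum_(l < i) f x l * invmx A l k) * f k y.
have sk (k : 'I_i) : skip_idx i k = k by rewrite /skip_idx ltn_eqF.
have bord (r c : nat -> nat) : (forall k : 'I_i, r k = k) ->
    (forall k : 'I_i, c k = k) ->
    minor i.+1 (fun a b => f (r a) (c b)) = \det A * S (r i) (c i).
  move=> rk ck; have AE : \matrix_(a < i, b < i) f (r a) (c b) = A.
    by apply/matrixP => a b; rewrite !mxE rk ck.
  have := @minor_bordered K i (fun a b => f (r a) (c b)); rewrite /= AE.
  move=> -> //; congr (_ * (_ - _)); apply: eq_bigr => k _; rewrite rk.
  by congr (_ * _); apply: eq_bigr => l _; rewrite ck.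
have si : skip_idx i i = i.+1 by rewrite /skip_idx eqxx.
rewrite (bord id id) // (bord (skip_idx i) (skip_idx i)) //.
rewrite (bord id (skip_idx i)) // (bord (skip_idx i) id) // !si.
have -> : minor i.+2 f = \det A * (S i i * S i.+1 i.+1 - S i i.+1 * S i.+1 i).
  have -> : minor i.+2 f = minor (i + 2) f by rewrite addn2.
  rewrite /minor; have -> : \matrix_(a < i + 2, b < i + 2) f a b =
      block_mx A (\matrix_(a, b) f a (i + b)%N) (\matrix_(a, b) f (i + a)%N b)
        (\matrix_(a, b) f (i + a)%N (i + b)%N).
    apply/matrixP => a b; rewrite mxE.
    by case: (split_ordP a) => a' ->; case: (split_ordP b) => b' ->;
      rewrite ?(block_mxEul, block_mxEur, block_mxEdl, block_mxEdr) !mxE.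
  rewrite det_schur //; congr (_ * _).
  set M := (_ - _); have ME x y : M x y = S (i + x)%N (i + y)%N.
    rewrite !mxE; congr (_ - _); apply: eq_bigr => k _; rewrite !mxE.
    by congr (_ * _); apply: eq_bigr => l _; rewrite !mxE.
  by rewrite det_mx22 !ME /= !addn0 !addn1; ring.
by rewrite -[minor i f]/(\det A); ring.
Qed.

Lemma desnanot_jacobi (R : idomainType) i (f : nat -> nat -> R) :
  minor i f != 0 ->
  minor i.+1 f * minor i.+1 (fun a b => f (skip_idx i a) (skip_idx i b)) -
  minor i.+1 (fun a b => f a (skip_idx i b)) *
    minor i.+1 (fun a b => f (skip_idx i a) b) = minor i f * minor i.+2 f.
Proof.
move=> nz; apply/eqP; rewrite -tofrac_eq; apply/eqP.
have := @desnanot_jacobi_field {fraction R} i (fun a b => tofrac (f a b)).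
rewrite !(minor_map (@tofrac R)) tofrac_eq0 => /(_ nz).
by rewrite -!rmorphM -rmorphB.
Qed.

End DesnanotJacobi.

Section ElementaryGL.
Variable F : fieldType.
Implicit Types (i j k l r c : nat) (a b : F) (g : GL F).

Definition gl_X i j a : GL F :=
  if insub (i, j) is Some q then elem_GL q a else 1.

Lemma gl_XE i j (h : i != j) a : gl_X i j a = elem_GL (exist _ (i, j) h) a.
Proof. by rewrite /gl_X insubT. Qed.

Lemma gl_XD i j a b : i != j -> gl_X i j a * gl_X i j b = gl_X i j (a + b)%R.
Proof. by move=> ij; rewrite !gl_XE; apply: val_inj; exact: elem_add. Qed.

Lemma gl_XR i j k a b : i != j -> j != k -> i != k ->
  comm (gl_X i j a) (gl_X j k b) = gl_X i k (a * b)%R.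
Proof.
move=> ij jk ik; rewrite !gl_XE /comm.
apply: (canLR (mulgK _)); apply: (canLR (mulgK _)); rewrite -mulgA.
by apply: val_inj; exact: elem_comm.
Qed.

Lemma gl_XI i j k l a b : i != j -> k != l -> j != k -> i != l ->
  commute (gl_X i j a) (gl_X k l b).
Proof.
by move=> ij kl jk il; rewrite !gl_XE; apply: val_inj; exact: elem_comm1.
Qed.

Definition gl_entry g r c : F := val (val g) r c.

Lemma gl_entry1 r c : gl_entry 1 r c = ((r == c)%:R)%R.
Proof. by []. Qed.

Lemma gl_entryX i j a g r c : i != j -> gl_entry (gl_X i j a * g) r c =
  (gl_entry g r c + (if r == i then a * gl_entry g j c else 0))%R.
Proof. by move=> ij; rewrite gl_XE; exact: elem_mulE. Qed.

Definition gl_sub n : groupClosed (GL F) :=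
  gen [set g | exists i j a, [/\ (i < n)%N, (j < n)%N, i != j & g = gl_X i j a]]%classic.

Lemma gl_XV i j a : i != j -> (gl_X i j a)^-1 = gl_X i j (- a)%R.
Proof.
move=> ij; have x0 : gl_X i j 0%R = 1.
  by rewrite gl_XE; apply: val_inj; exact: elem_0.
by apply: (@mulgI _ (gl_X i j a)); rewrite mulgV gl_XD // subrr x0.
Qed.

Lemma mem_gl_sub n i j a : (i < n)%N -> (j < n)%N -> i != j -> gl_X i j a \in gl_sub n.
Proof. by move=> ni nj ij; apply: mem_gen; exists i, j, a. Qed.

Lemma gl_sub_ind n (P : GL F -> Prop) : P 1 ->
  (forall i j a s, (i < n)%N -> (j < n)%N -> i != j -> P s -> P (gl_X i j a * s)) ->
  forall s, s \in gl_sub n -> P s.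
Proof.
move=> P1 PX; apply: gen_left_ind => // [_ [i [j [a [ni nj ij ->]]]]|].
  by exists i, j, (- a)%R; rewrite gl_XV.
by move=> _ s [i [j [a [ni nj ij ->]]]]; apply: PX.
Qed.

Local Open Scope ring_scope.

(** Each generator is moved from [g] onto the row vector [q] as an invertible operation, which
    avoids cutting an inverse block out of a stable matrix. *)
Lemma gl_sub_inj n g (q : nat -> {poly F}) : g \in gl_sub n ->
  (forall l, (l < n)%N -> \sum_(i < n) q i * (gl_entry g i l)%:P = 0) ->
  forall i, (i < n)%N -> q i = 0.
Proof.
move=> gn; elim/gl_sub_ind: g / gn q => [|p r a g pn rn pr IH] q q0 i ni.
  have := q0 i ni; rewrite (bigD1 (Ordinal ni)) //= gl_entry1 eqxx mulr1.
  by rewrite big1 ?addr0 // => j /negbTE ji; rewrite gl_entry1 (ji : (j == i :> nat) = false) mulr0.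
pose q' k := q k + (if k == r then q p * a%:P else 0).
have q'0 : forall k, (k < n)%N -> q' k = 0.
  apply: IH => l ln; rewrite -[RHS](q0 l ln).
  under eq_bigr => k _ do rewrite mulrDl.
  under [RHS]eq_bigr => k _ do rewrite gl_entryX // polyCD mulrDr.
  rewrite !big_split /=; congr (_ + _).
  rewrite (bigD1 (Ordinal rn)) //= eqxx [X in _ + X]big1 ?addr0; last first.
    by move=> k /negbTE kr; rewrite (kr : (k == r :> nat) = false) mul0r.
  rewrite [RHS](bigD1 (Ordinal pn)) //= eqxx [X in _ = _ + X]big1 ?addr0.
    by rewrite polyCM mulrA.
  by move=> k /negbTE kr; rewrite (kr : (k == p :> nat) = false) polyC0 mulr0.
have qp : q p = 0 by have := q'0 p pn; rewrite /q' (negbTE pr) addr0.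
by have := q'0 i ni; rewrite /q' qp mul0r if_same addr0.
Qed.

End ElementaryGL.

(** * Columns in general position *)

Section GenericColumns.
Variables (F : fieldType) (n : nat).
Local Open Scope ring_scope.

(* The column [(k, g)] is [g] applied to the vector ['X^(l * n ^ (2 * k))]_l,  *)
(* so that columns of distinct levels [k] are in general position over F.     *)
Definition column : Type := (nat * subgrp (@gl_sub F n))%type.
Implicit Types (t : column) (c : nat -> column).

(** This base leaves room: a minor of size below [n] in columns of level below [k] has degree less
    than [W ^ k], the spacing of the exponents at level [k]. *)
Let W := (n * n)%N.

Definition col_entry t a : {poly F} :=
  \sum_(l < n) (gl_entry (incl t.2) a l)%:P * 'X^(l * W ^ t.1).

Lemma size_col_entry t a : (size (col_entry t a) <= (n.-1 * W ^ t.1).+1)%N.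
Proof.
apply: (leq_trans (size_sum _ _ _)); apply/bigmax_leqP => l _.
rewrite mul_polyC; apply: (leq_trans (size_scale_leq _ _)).
rewrite size_polyXn ltnS leq_mul2r; apply/orP; right.
by have := ltn_ord l; lia.
Qed.

Lemma size_det (R : idomainType) m d (M : 'M[{poly R}]_m) :
  (forall i j, (size (M i j) <= d.+1)%N) -> (size (\det M) <= (m * d).+1)%N.
Proof.
move=> Md; apply: (leq_trans (size_sum _ _ _)); apply/bigmax_leqP => s _.
rewrite -signr_odd mulr_sign.
have h : (size (\prod_i M i (s i))%R <= (m * d).+1)%N.
  apply: (leq_trans (size_prod_leq _ _)).
  rewrite leq_subLR card_ord addnS ltnS.
  apply: (@leq_trans (\sum_(i < m) d.+1)); first by apply: leq_sum.
  by rewrite sum_nat_const card_ord mulnS.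
by case: ifP => _; rewrite ?size_polyN.
Qed.

(** The [q l] are digits in base ['X^w], too short to overlap. *)
Lemma separated_sum w m (q : nat -> {poly F}) :
  (forall l, (l < m)%N -> (size (q l) <= w)%N) ->
  \sum_(l < m) q l * 'X^(l * w) = 0 -> forall l, (l < m)%N -> q l = 0.
Proof.
move=> qw s0 l lm; apply/polyP => r; rewrite coef0.
have [rw|wr] := ltnP r w; last by rewrite nth_default // (leq_trans (qw _ lm)).
have := congr1 (fun s : {poly F} => s`_(l * w + r)) s0; rewrite coef0 coef_sum.
rewrite (bigD1 (Ordinal lm)) //= coefMXn ltnNge leq_addr /= addKn.
rewrite big1 ?addr0 // => k kl; rewrite coefMXn; case: ltnP => // h.
have {}kl : (k : nat) != l by [].
apply: nth_default; apply: (leq_trans (qw _ (ltn_ord k))).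
by case: (ltngtP k l) kl h => // kl _ h; nia.
Qed.

(** Expand along the column of highest level [k]. The cofactors are digits in base ['X^(W ^ k)], so
    if the minor vanished, the row of cofactors would be killed by an element of [gl_sub F n] and
    would be zero, against the induction hypothesis for the last one. *)
Lemma minor_neq0 m c : (m <= n)%N ->
  (forall i j, (i < m)%N -> (j < m)%N -> (c i).1 = (c j).1 -> i = j) ->
  minor m (fun a b => col_entry (c b) a) != 0.
Proof.
elim: m c => [|m IH] c mn cinj; first by rewrite minor0 oner_neq0.
pose M := \matrix_(a < m.+1, b < m.+1) col_entry (c b) a.
have [j0 _ j0max] : {j0 : 'I_m.+1 | true & forall j : 'I_m.+1, ((c j).1 <= (c j0).1)%N}.
  by case: (@arg_maxnP _ ord0 xpredT (fun j : 'I_m.+1 => (c j).1)) => // j0 _ h; exists j0 => // j; apply: h.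
set k := (c j0).1 in j0max.
have lev (j : 'I_m) : ((c (lift j0 j)).1 < k)%N.
  rewrite ltn_neqAle j0max andbT; apply/eqP => e.
  have := cinj _ _ (ltn_ord (lift j0 j)) (ltn_ord j0) e => /val_inj /eqP.
  by rewrite eq_sym (negbTE (neq_lift _ _)).
apply/negP => /eqP; rewrite -[minor _ _]/(\det M) (expand_det_col _ j0) => det0.
pose q i := if insub i is Some i' then cofactor M i' j0 else 0.
have qE (i : 'I_m.+1) : q i = cofactor M i j0 by rewrite /q valK.
have cof0 : q m != 0.
  rewrite -[m]/(val (@ord_max m)) qE /cofactor mulf_neq0 ?signr_eq0 //.
  have -> : row' ord_max (col' j0 M) =
      \matrix_(a < m, b < m) col_entry (c (bump j0 b)) a.
    by apply/matrixP => a b; rewrite !mxE lift_max.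
  apply: (IH (fun b => c (bump j0 b))) => [|i j im jm /cinj h]; first exact: ltnW.
  by apply: (can_inj (bumpK j0)); apply: h; rewrite /bump; case: leqP; lia.
have sq i : (size (q i) <= W ^ k)%N.
  rewrite /q; case: insubP => [i' _ _|_]; last by rewrite size_poly0.
  have Wk : (0 < W ^ k)%N by rewrite expn_gt0 /W muln_gt0; apply/orP; left; lia.
  rewrite /cofactor -signr_odd mulr_sign.
  suff h : (size (\det (row' i' (col' j0 M))) <= W ^ k)%N by case: ifP; rewrite ?size_polyN.
  case: (posnP m) => [m0|m0].
    by move: (row' _ _); rewrite m0 => ?; rewrite det_mx00 size_poly1.
  have k0 : (0 < k)%N by have := lev (Ordinal m0); lia.
  apply: (leq_trans (@size_det _ m (n.-1 * W ^ k.-1) _ _)) => [a b|].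
    rewrite !mxE; apply: (leq_trans (size_col_entry _ _)).
    rewrite ltnS leq_mul2l; apply/orP; right; apply: leq_pexp2l.
      by rewrite muln_gt0; lia.
    by have := lev b; lia.
  rewrite -[in (W ^ k)%N](prednK k0) expnS /W.
  have : (0 < (n * n) ^ k.-1)%N by rewrite expn_gt0 muln_gt0; lia.
  by move: ((n * n) ^ k.-1)%N => z z0; nia.
have [g gn cE] : exists2 g, g \in gl_sub F n & forall i, col_entry (c j0) i =
    \sum_(l < n) (gl_entry g i l)%:P * 'X^(l * W ^ k).
  by exists (incl (c j0).2); first exact: valP.
have sum0 l : (l < n)%N -> \sum_(i < m.+1) q i * (gl_entry g i l)%:P = 0.
  move: l; apply: (@separated_sum (W ^ k) n
      (fun l => \sum_(i < m.+1) q i * (gl_entry g i l)%:P)) => [l _|].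
    apply: (leq_trans (size_sum _ _ _)); apply/bigmax_leqP => i _.
    by rewrite mulrC mul_polyC; apply: (leq_trans (size_scale_leq _ _)).
  rewrite -[RHS]det0; under eq_bigr => l _ do rewrite mulr_suml.
  rewrite exchange_big /=; apply: eq_bigr => i _.
  rewrite !mxE cE mulr_suml; apply: eq_bigr => l _.
  by rewrite -qE; ring.
have qm := @gl_sub_inj F n g (fun i => if (i < m.+1)%N then q i else 0) gn _ m mn.
move: qm; rewrite /= ltnSn => qm; move: cof0; rewrite qm ?eqxx // => l ln.
rewrite -[RHS](sum0 l ln).
rewrite -(big_ord_narrow mn (F := fun i : 'I_n => q i * (gl_entry g i l)%:P)).
rewrite [RHS]big_mkcond; apply: eq_bigr => i _.
by case: ifP; rewrite ?mul0r.
Qed.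

End GenericColumns.

(** * Steinberg symbols and edge costs *)

Record steinberg_symbol (F : fieldType) (A : zmodType) (c : F -> F -> A) : Prop :=
  SteinbergSymbol {
    symMl : forall x y z, x != 0%R -> y != 0%R -> z != 0%R ->
      c (x * y)%R z = (c x z + c y z)%R;
    symMr : forall x y z, x != 0%R -> y != 0%R -> z != 0%R ->
      c x (y * z)%R = (c x y + c x z)%R;
    sym_steinberg : forall x y, x != 0%R -> y != 0%R -> (x + y = 1)%R ->
      c x y = 0%R }.

Section SymbolTheory.
Variables (F : fieldType) (A : zmodType) (c : F -> F -> A).
Hypothesis cP : steinberg_symbol c.
Local Open Scope ring_scope.
Implicit Types (x y z : F).

Let cMl := symMl cP.
Let cMr := symMr cP.

Lemma sym1l x : x != 0 -> c 1 x = 0.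
Proof.
move=> x0; have := cMl (oner_neq0 F) (oner_neq0 F) x0.
by rewrite mulr1 => /(congr1 (fun a => a - c 1 x)); rewrite addrK subrr.
Qed.

Lemma sym1r x : x != 0 -> c x 1 = 0.
Proof.
move=> x0; have := cMr x0 (oner_neq0 F) (oner_neq0 F).
by rewrite mulr1 => /(congr1 (fun a => a - c x 1)); rewrite addrK subrr.
Qed.

Lemma symVl x y : x != 0 -> y != 0 -> c x^-1 y = - c x y.
Proof.
move=> x0 y0; apply: (@addrI _ (c x y)).
by rewrite -cMl ?invr_eq0 // divff // sym1l // subrr.
Qed.

Lemma symVr x y : x != 0 -> y != 0 -> c x y^-1 = - c x y.
Proof.
move=> x0 y0; apply: (@addrI _ (c x y)).
by rewrite -cMr ?invr_eq0 // divff // sym1r // subrr.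
Qed.

Lemma sym_opp x : x != 0 -> c x (- x) = 0.
Proof.
move=> x0; have [->|x1] := eqVneq x 1; first by rewrite sym1l // oppr_eq0 oner_neq0.
have x1' : 1 - x != 0 by rewrite subr_eq0 eq_sym.
have xV1 : 1 - x^-1 != 0 by rewrite subr_eq0 eq_sym invr_eq1.
(* This writes [- x] as a quotient whose terms form Steinberg pairs with [x] and with [x^-1]. *)
have -> : - x = (1 - x) * (1 - x^-1)^-1.
  by field; rewrite x0 subr_eq0 x1.
rewrite cMr ?invr_eq0 // symVr // -[c x (1 - x^-1)]opprK -symVl //.
by rewrite !(sym_steinberg cP) ?invr_eq0 ?addr0 ?oppr0 ?addr0 // addrC subrK.
Qed.

Lemma sym_sq x : x != 0 -> c x x = c (- 1) x.
Proof.
move=> x0; have := sym_opp (x := - x); rewrite oppr_eq0 opprK => /(_ x0).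
have n0 : (- 1 : F) != 0 by rewrite oppr_eq0 oner_neq0.
have : c (- 1) x + c (- 1) x = 0.
  by rewrite -cMl // mulrNN mulr1 sym1l.
rewrite -[in c (- x) x]mulN1r cMl // => e1 e2; apply: (@addrI _ (c (- 1) x)).
by rewrite e1 e2.
Qed.

Lemma sym_anti x y : x != 0 -> y != 0 -> c x y + c y x = 0.
Proof.
move=> x0 y0; have := sym_opp (mulf_neq0 x0 y0).
have [nx ny] : - x != 0 /\ - y != 0 by rewrite !oppr_eq0.
rewrite cMl ?oppr_eq0 ?mulf_neq0 // -[in c x _]mulNr -[in c y _]mulrN !cMr //.
by rewrite !sym_opp // add0r addr0.
Qed.

Lemma sym_N1 x : x != 0 -> c (- 1) x + c (- 1) x = 0.
Proof.
move=> x0; have n0 : (- 1 : F) != 0 by rewrite oppr_eq0 oner_neq0.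
by rewrite -cMl // mulrNN mulr1 sym1l.
Qed.

Lemma sym_steinberg_hom P Q R : P != 0 -> Q != 0 -> R != 0 -> P = Q + R ->
  c Q R - c Q P - c P R + c P P = 0.
Proof.
move=> P0 Q0 R0 PQR; have : c (Q * P^-1) (R * P^-1) = 0.
  apply: (sym_steinberg cP); rewrite ?mulf_neq0 ?invr_eq0 //.
  by rewrite -mulrDl -PQR divff.
rewrite cMl ?cMr ?mulf_neq0 ?invr_eq0 // !symVr ?invr_eq0 // !symVl // => <-.
by zmod.
Qed.

(** If the sizes of [Q] and [R] differ, [P] inherits a leading coefficient. If they agree without
    cancellation, the leading coefficients add up. If the top terms cancel, they are opposite and
    [c x (- x) = 0] applies. *)
Lemma lead_coef_steinberg (P Q R : {poly F}) : P != 0 -> Q != 0 -> R != 0 ->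
  P = Q + R ->
  let l := @lead_coef F in
  c (l Q) (l R) - c (l Q) (l P) - c (l P) (l R) + c (l P) (l P) = 0.
Proof.
move=> P0 Q0 R0 PQR l.
have [lP lQ lR] : [/\ l P != 0, l Q != 0 & l R != 0] by rewrite !lead_coef_eq0.
have [QR|RQ|QR] := ltngtP (size Q) (size R).
- have -> : l P = l R by rewrite PQR addrC /l lead_coefDl.
  by zmod.
- have -> : l P = l Q by rewrite PQR /l lead_coefDl.
  by zmod.
have [sP|sP] := eqVneq (size P) (size Q).
  apply: sym_steinberg_hom => //.
  by rewrite /l !lead_coefE -QR sP PQR coefD.
have ltP : (size P < size Q)%N.
  rewrite ltn_neqAle sP PQR (leq_trans (size_polyD _ _)) //.
  by rewrite -QR maxnn.
have RE : l R = - l Q.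
  apply/eqP; rewrite -addr_eq0 addrC /l !lead_coefE -QR -coefD -PQR.
  by rewrite nth_default // -ltnS prednK // (leq_trans _ ltP).
have n0 : (- 1 : F) != 0 by rewrite oppr_eq0 oner_neq0.
rewrite RE sym_opp // -[- l Q]mulN1r cMr //.
have e1 := sym_anti lP lQ; have e2 := sym_sq lP; have e3 := sym_anti n0 lP.
rewrite [LHS](_ : _ = - (c (l P) (l Q) + c (l Q) (l P))
  - (c (- 1) (l P) + c (l P) (- 1)) + (c (- 1) (l P) + c (- 1) (l P))).
  by rewrite e1 e3 sym_N1 // !oppr0 !addr0.
by rewrite e2; zmod.
Qed.

(* To be used for the swap of the columns [i] and [i.+1], which changes the   *)
(* leading minor of size [i.+1] from [p] to [r] and keeps that of size [i],   *)
(* which is [e].                                                              *)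
Definition swap_pot p r e := c (- 1) (p * r) - c p r + c (p / r) e.

(** Here [p], [r] are the minors of size [i+1] before and after the swap, [l], [m] the same once the
    matrix has acted, [e] and [E] those of sizes [i] and [i+2]; the swap negates [E]. The hypothesis
    is the relation coming from [p * m = r * l + s * e * E]. *)
Lemma swap_pot_steinberg p r l m E e s :
  p != 0 -> r != 0 -> l != 0 -> m != 0 -> E != 0 -> e != 0 -> s != 0 ->
  c (r * l) (s * e * E) - c (r * l) (p * m) - c (p * m) (s * e * E)
    + c (p * m) (p * m) = 0 ->
  c (m / r) (- s * - E / r) - c (l / p) (- s * E / p) =
  swap_pot l m e - swap_pot p r e.
Proof.
move=> p0 r0 l0 m0 E0 e0 s0; rewrite /swap_pot.
have n0 : (- 1 : F) != 0 by rewrite oppr_eq0 oner_neq0.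
have [rV pV mV] : [/\ r^-1 != 0, p^-1 != 0 & m^-1 != 0] by rewrite !invr_eq0.
rewrite mulrNN -[- s]mulN1r.
have [sE sN] : s * E != 0 /\ -1 * s != 0 by rewrite !mulf_neq0.
have [sNE pm se] : [/\ -1 * s * E != 0, p * m != 0 & s * e != 0].
  by rewrite !mulf_neq0.
have [rl seE sEr] : [/\ r * l != 0, s * e * E != 0 & s * E / r != 0].
  by rewrite !mulf_neq0.
have [sEp lm] : -1 * s * E / p != 0 /\ l * m != 0 by rewrite !mulf_neq0.
rewrite !(cMl, cMr) // !(symVl, symVr) // ?(cMl, cMr) // ?(symVl, symVr) //.
have a1 := sym_anti r0 m0; have a2 := sym_anti n0 l0; have a3 := sym_anti n0 p0.
have a4 := sym_anti p0 r0; have a5 := sym_anti p0 m0.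
have q1 := sym_sq r0; have q2 := sym_sq m0; have h := sym_N1 r0.
set St := (X in X = 0 -> _); move=> St0; set T := (X in _ = X).
(* The two sides differ by the listed instances of antisymmetry, of [c x x = c (- 1) x] and of the
   2-torsion of [c (- 1) x]. *)
transitivity (T - St + (c (- 1) r + c (- 1) r) - (c r m + c m r) + (c r r - c (- 1) r)
  - (c (- 1) l + c l (- 1)) + (c (- 1) p + c p (- 1)) - (c p r + c r p)
  + (c p m + c m p) + (c m m - c (- 1) m)); first by rewrite /T /St; zmod.
by rewrite St0 a1 a2 a3 a4 a5 q1 q2 h !subrr !subr0 !addr0.
Qed.

(** The variation of the lift of [e_(i,i+1)] when only the minor of size [i+2] changes, from [p] to
    [r]. The right side is a difference of costs of last-column edges and, by [swap_pot_adj], also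
    of swaps at [i+1]. *)
Lemma sym_ratio q1 q t p r : q1 != 0 -> q != 0 -> t != 0 -> p != 0 -> r != 0 ->
  c (q1 / q) (t * r / q) - c (q1 / q) (t * p / q) = c q1 (r / p) - c q (r / p).
Proof.
move=> q10 q0 t0 p0 r0; have [qV pV] : q^-1 != 0 /\ p^-1 != 0 by rewrite !invr_eq0.
have [tr tp rp qq] : [/\ t * r != 0, t * p != 0, r / p != 0 & q1 / q != 0].
  by rewrite !mulf_neq0.
rewrite !(cMr qq _ qV) // !(cMr qq t0) // !(cMr _ r0 pV) // !cMl // !symVl // !(symVr _ p0) //.
by zmod.
Qed.

Lemma swap_pot_adj p r e e' : p != 0 -> r != 0 -> e != 0 -> e' != 0 ->
  swap_pot p r e - swap_pot p r e' = c e (r / p) - c e' (r / p).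
Proof.
move=> p0 r0 e0 e0'; have [rV pV] : r^-1 != 0 /\ p^-1 != 0 by rewrite !invr_eq0.
have n0 : (- 1 : F) != 0 by rewrite oppr_eq0 oner_neq0.
rewrite /swap_pot !cMl // !cMr // !symVl // !symVr //.
have a1 := sym_anti p0 e0; have a2 := sym_anti r0 e0.
have a3 := sym_anti p0 e0'; have a4 := sym_anti r0 e0'.
set T := (X in _ = X).
transitivity (T + (c p e + c e p) - (c r e + c e r) - (c p e' + c e' p) + (c r e' + c e' r)).
  by rewrite /T; zmod.
by rewrite a1 a2 a3 a4 !subr0 !addr0.
Qed.

Lemma swap_pot_diag p r e d t : p != 0 -> r != 0 -> e != 0 -> d != 0 -> t != 0 ->
  c r t - c p t + c (- 1) (d * t)^-1 =
  swap_pot (d * t * p) (d * t * r) (d * e) - swap_pot p r e.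
Proof.
move=> p0 r0 e0 d0 t0; have n0 : (- 1 : F) != 0 by rewrite oppr_eq0 oner_neq0.
have dt : d * t != 0 by rewrite mulf_neq0.
have [dtp dtr de rV] : [/\ d * t * p != 0, d * t * r != 0, d * e != 0 & r^-1 != 0].
  by rewrite !mulf_neq0 ?invr_eq0.
have rat : d * t * p / (d * t * r) = p / r by field; rewrite r0 d0 t0.
rewrite /swap_pot rat !cMl // !cMr // !symVl // !symVr // !cMr //.
have a1 := sym_anti r0 d0; have a2 := sym_anti r0 t0; have a3 := sym_anti d0 t0.
have q1 := sym_sq d0; have q2 := sym_sq t0.
have h1 := sym_N1 d0; have h2 := sym_N1 t0.
set T := (X in _ = X).
transitivity (T + (c r t + c t r) + (c r d + c d r) + (c d t + c t d)
  + (c d d - c (- 1) d) + (c t t - c (- 1) t) - (c (- 1) d + c (- 1) d)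
  - (c (- 1) t + c (- 1) t)); first by rewrite /T; zmod.
by rewrite a1 a2 a3 q1 q2 h1 h2 !subrr !subr0 !addr0.
Qed.

Lemma sym_div_diag e x x' d t : e != 0 -> x != 0 -> x' != 0 -> d != 0 -> t != 0 ->
  d * t = 1 -> c (d * e) (x' / x) - c e (x' / x) = c x' t - c x t.
Proof.
move=> e0 x0 x0' d0 t0 dt; have xV : x^-1 != 0 by rewrite invr_eq0.
have xx : x' / x != 0 by rewrite mulf_neq0.
have -> : t = d^-1 by apply: (mulfI d0); rewrite dt divff.
rewrite cMl // addrK cMr // !symVr //.
have a1 := sym_anti d0 x0; have a2 := sym_anti d0 x0'.
set T := (X in _ = X).
transitivity (T + (c d x' + c x' d) - (c d x + c x d)); first by rewrite /T; zmod.
by rewrite a1 a2 subr0 addr0.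
Qed.

End SymbolTheory.

(** * The extension attached to a Steinberg symbol *)

Section States.
Variables (F : fieldType) (n : nat).
Local Notation G := (subgrp (@gl_sub F n)).
Implicit Types (g h : G) (i j m : nat) (s : F).

Record state := State {
  col :> nat -> column F n;
  col_inj : forall i j, (i < n)%N -> (j < n)%N -> (col i).1 = (col j).1 -> i = j }.
Implicit Types y : state.

Lemma state_eq y y' : y =1 y' -> y = y'.
Proof.
case: y y' => [f p] [f' p'] /= /funext ff; subst f'.
by congr State; exact: Prop_irrelevance.
Qed.

Fact state_act_inj g y i j : (i < n)%N -> (j < n)%N ->
  ((y i).1, g * (y i).2).1 = ((y j).1, g * (y j).2).1 -> i = j.
Proof. exact: col_inj. Qed.
Definition state_act g y : state := State (@state_act_inj g y).

Fact state_act1 y : state_act 1 y = y.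
Proof. by apply: state_eq => b /=; rewrite mul1g; case: (y b). Qed.
Fact state_actM g h y : state_act (g * h) y = state_act g (state_act h y).
Proof. by apply: state_eq => b /=; rewrite mulgA. Qed.

(** A [None] edge changes column [n.-1] and may change all columns from [n] on, which no minor of
    size at most [n] sees. *)
Definition edge (k : option nat) y y' : Prop :=
  match k with
  | Some i => (i.+1 < n)%N /\ forall b, y' b = y (swap_idx i b)
  | None => forall b, (b < n.-1)%N -> y' b = y b
  end.

Lemma edge_act g k y y' : edge k y y' -> edge k (state_act g y) (state_act g y').
Proof.
case: k => [i [im e]|e] /=; first by split=> // b; rewrite !e.
by move=> b bn; rewrite !e.
Qed.

Fact base_inj i j : (i < n)%N -> (j < n)%N ->
  (i, 1 : G).1 = (j, 1 : G).1 -> i = j.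
Proof. by []. Qed.
Definition base_state : state := State base_inj.

Section Connected.
Variables (B : Type) (f : state -> B).
Hypothesis f_edge : forall k y y', edge k y y' -> f y = f y'.

(** Swaps of neighbours carry the first column to position [n.-1], where a last-column edge replaces
    it. *)
Lemma edge_shift y y' : (forall b, (b < n.-1)%N -> y' b = y b.+1) -> f y = f y'.
Proof.
move=> yy; pose rot j b := if (b < j)%N then b.+1 else if b == j then 0%N else b.
have rot_inj j : (j < n)%N -> forall a b : nat, (a < n)%N -> (b < n)%N ->
    (y (rot j a)).1 = (y (rot j b)).1 -> a = b.
  move=> jn a b an bn /col_inj e; have : rot j a = rot j b.
    by apply: e; rewrite /rot; do 2?case: ifP; lia.
  by rewrite /rot; do 4?case: ifP; lia.
have rotE j (jn : (j < n)%N) : f y = f (State (rot_inj j jn)).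
  elim: j jn => [|j IH] jn.
    congr f; apply: state_eq => b /=; congr (y _).
    by rewrite /rot ltn0; case: eqP.
  rewrite (IH (ltnW jn)); apply: (f_edge (k := Some j)); split=> // b /=.
  congr (y _); rewrite /rot /swap_idx.
  by case: (ltngtP b j) => ?; case: (ltngtP b j.+1) => ?; do 4?case: ifP; lia.
case: (posnP n) => [n0|n0].
  by apply: (f_edge (k := None)) => b bn; exfalso; lia.
have n1 : (n.-1 < n)%N by rewrite ltn_predL.
rewrite (rotE _ n1); apply: (f_edge (k := None)) => b bn /=.
by rewrite /rot bn yy.
Qed.

(* Append the columns of [z] one at a time, dropping the first one each time.  *)
Lemma edge_far y (z : state) : (forall i j, (i < n)%N -> (y i).1 != (z j).1) ->
  (forall i j, (z i).1 = (z j).1 -> i = j) -> f y = f z.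
Proof.
move=> yz zinj; pose w b := if (b < n)%N then y b else z (b - n)%N.
have winj (a b : nat) : (w a).1 = (w b).1 -> a = b.
  rewrite /w; case: ltnP => an; case: ltnP => bn.
  - exact: col_inj.
  - by move=> e; have := yz a (b - n)%N an; rewrite e eqxx.
  - by move=> e; have := yz b (a - n)%N bn; rewrite -e eqxx.
  - by move=> /zinj; lia.
have sinj k i j : (i < n)%N -> (j < n)%N -> (w (i + k)%N).1 = (w (j + k)%N).1 -> i = j.
  by move=> _ _ /winj; lia.
have shift k : f y = f (State (sinj k)).
  elim: k => [|k ->].
    apply: (f_edge (k := None)) => b bn /=; rewrite addn0 /w.
    by rewrite (leq_trans bn) // leq_pred.
  by apply: edge_shift => b bn /=; rewrite addSnnS.
rewrite (shift n); apply: (f_edge (k := None)) => b bn /=.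
by rewrite /w ltnNge leq_addl addnK.
Qed.

Lemma edge_connected y : f y = f base_state.
Proof.
have [L LP] : exists L, (n <= L)%N /\ forall i, (i < n)%N -> ((y i).1 < L)%N.
  exists (maxn (\max_(i < n) (y i).1).+1 n); split=> [|i ni]; first exact: leq_maxr.
  by rewrite leq_max ltnS (leq_bigmax (Ordinal ni)).
have zinj i j : (i < n)%N -> (j < n)%N ->
  ((L + i)%N, 1 : G).1 = ((L + j)%N, 1 : G).1 -> i = j by move=> _ _ /=; lia.
(* The levels of [z] exceed those of both [y] and [base_state], so both can be carried to it. *)
pose z := State zinj.
have zz i j : (z i).1 = (z j).1 -> i = j by move=> /=; lia.
have [nL yL] := LP; rewrite (@edge_far y z) // => [|i j ni].
  by rewrite -(@edge_far base_state z) // => i j ni /=; lia.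
by rewrite neq_ltn (leq_trans (yL i ni)) //= leq_addr.
Qed.

End Connected.

Local Open Scope ring_scope.

Definition state_minor y m := minor m (fun a b => col_entry (y b) a).
Definition lam y m : F := lead_coef (state_minor y m).

Lemma state_minor_neq0 y m : (m <= n)%N -> state_minor y m != 0.
Proof.
move=> mn; apply: minor_neq0 => // i j im jm; apply: col_inj.
  exact: leq_trans im mn.
exact: leq_trans jm mn.
Qed.

Lemma lam_neq0 y m : (m <= n)%N -> lam y m != 0.
Proof. by move=> mn; rewrite lead_coef_eq0 state_minor_neq0. Qed.

Lemma lam_swap y y' i m : (forall b, y' b = y (swap_idx i b)) ->
  lam y' m = if (m <= i)%N then lam y m
             else if (m == i.+1)%N then lam y' m else - lam y m.
Proof.
move=> yy; case: ltnP => mi; last first.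
  congr lead_coef; apply: eq_minor => a b am bm; rewrite yy /swap_idx.
  by rewrite !ifN //; lia.
case: eqP => // mi'; have im : (i.+1 < m)%N by lia.
rewrite -lead_coefN -(minor_colswap _ im); congr lead_coef; by apply: eq_minor => a b am bm; rewrite yy.
Qed.

Lemma lam_last y y' m : (forall b, (b < n.-1)%N -> y' b = y b) -> (m < n)%N ->
  lam y' m = lam y m.
Proof.
move=> yy mn; congr lead_coef; apply: eq_minor => a b am bm.
by rewrite yy //; lia.
Qed.

Lemma col_entry_act g k h r i j a : i != j -> incl g = gl_X i j a ->
  col_entry (k, g * h)%g r =
  col_entry (k, h) r + (if r == i then a%:P * col_entry (k, h) j else 0).
Proof.
move=> ij gE; rewrite /col_entry.
have e l : gl_entry (incl (g * h)%g) r l =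
    gl_entry (incl h) r l + (if r == i then a * gl_entry (incl h) j l else 0).
  by rewrite gmulfM /= gE gl_entryX.
under eq_bigr => l _ do rewrite e polyCD mulrDl.
rewrite big_split /=; congr (_ + _); case: eqP => _.
  by rewrite mulr_sumr; apply: eq_bigr => l _; rewrite polyCM mulrA.
by rewrite big1 // => l _; rewrite mul0r.
Qed.

Lemma state_minor_act g y m i j a : i != j -> incl g = gl_X i j a ->
  (m <= i)%N || (j < m)%N -> state_minor (state_act g y) m = state_minor y m.
Proof.
move=> ij gE; rewrite /state_minor; case: (leqP m i) => /= [mi _|im jm].
  apply: eq_minor => r b rm _ /=; rewrite (col_entry_act _ _ _ ij gE).
  by rewrite ifN ?addr0 -?surjective_pairing // ltn_eqF // (leq_trans rm).
rewrite -[RHS](minor_rowop _ a%:P im jm ij); apply: eq_minor => r b rm bm /=.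
by rewrite (col_entry_act _ _ _ ij gE) -surjective_pairing.
Qed.

Lemma state_minor_simple g y i s : incl g = gl_X i i.+1 s ->
  state_minor (state_act g y) i.+1 = state_minor y i.+1 +
    s%:P * minor i.+1 (fun a b => col_entry (y b) (skip_idx i a)).
Proof.
move=> gE; have ii : i != i.+1 by lia.
apply: minor_lastrow => [a b ai|a b ai|b] /=;
  rewrite (col_entry_act _ _ _ ii gE) -surjective_pairing /skip_idx ?eqxx //.
  by rewrite ltn_eqF // addr0.
by rewrite !ltn_eqF // addr0.
Qed.

(** To the minor of size [i+1] the swap means skipping column [i], and [g] adds [s] times the minor
    that skips row [i]. The four minors so obtained are those of the Desnanot-Jacobi identity. *)
Lemma state_minor_plucker g y y' i s : (i.+1 < n)%N -> incl g = gl_X i i.+1 s ->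
  (forall b, y' b = y (swap_idx i b)) ->
  state_minor y i.+1 * state_minor (state_act g y') i.+1 =
  state_minor y' i.+1 * state_minor (state_act g y) i.+1 +
    s%:P * state_minor y i * state_minor y i.+2.
Proof.
move=> im gE yy; rewrite !(state_minor_simple _ gE).
have sw b : (b < i.+1)%N -> y' b = y (skip_idx i b).
  rewrite yy ltnS /skip_idx /swap_idx => bi; case: eqP => // _.
  by rewrite ifN //; lia.
have -> : state_minor y' i.+1 = minor i.+1 (fun a b => col_entry (y (skip_idx i b)) a).
  by apply: eq_minor => a b am bm; rewrite sw.
have -> : minor i.+1 (fun a b => col_entry (y' b) (skip_idx i a)) =
    minor i.+1 (fun a b => col_entry (y (skip_idx i b)) (skip_idx i a)).
  by apply: eq_minor => a b am bm; rewrite sw.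
have := @desnanot_jacobi {poly F} i (fun a b => col_entry (y b) a).
rewrite -/(state_minor y i) => /(_ (state_minor_neq0 y (ltnW (ltnW im)))).
rewrite -/(state_minor y i.+1) -/(state_minor y i.+2).
set X1 := minor _ _; set X2 := minor _ _; set X3 := minor _ _ => e.
by rewrite -[s%:P * _ * _]mulrA -e; ring.
Qed.

End States.

Section SymbolExtension.
Variables (F : fieldType) (A : zmodType) (c : F -> F -> A) (n : nat).
Hypothesis cP : steinberg_symbol c.
Local Notation G := (subgrp (@gl_sub F n)).
Implicit Types (g h : G) (i j m : nat) (s u v : F) (y : state F n).
Local Open Scope ring_scope.

Definition edge_pot (k : option nat) y y' : A :=
  match k with
  | Some i => swap_pot c (lam y i.+1) (lam y' i.+1) (lam y i)
  | None => c (lam y n.-1) (lam y' n / lam y n)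
  end.

Definition symbol_potential : potential A G :=
  Potential (@state_act1 F n) (@state_actM F n) (@edge_act F n) edge_pot
    (@edge_connected F n A).

Local Notation L := (ext symbol_potential).

Lemma lam_act g y m i j a : i != j -> incl g = gl_X i j a ->
  (m <= i)%N || (j < m)%N -> lam (state_act g y) m = lam y m.
Proof. by move=> ij gE mij; rewrite /lam (state_minor_act _ ij gE). Qed.

(** Adding an earlier row to a later one preserves all leading minors, so the zero function is a
    lift. *)
Lemma lower_compat g i j a : (j < i)%N -> incl g = gl_X i j a ->
  @compat _ _ symbol_potential g (fun=> 0).
Proof.
move=> ji gE k y y' _; have ij : i != j by lia.
have e z m : lam (state_act g z) m = lam z m by apply: (lam_act _ ij gE); lia.
by case: k => [k|] /=; rewrite !e !subrr.
Qed.

Definition simple_lift_f g i s y : A :=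
  c (lam (state_act g y) i.+1 / lam y i.+1) (- s * lam y i.+2 / lam y i.+1).

(** Swaps at [i] use the Plücker relation. Swaps at [i+1], and the last column when [n = i+2], alter
    only the second argument of the lift. Along the other edges nothing changes, signs cancelling in
    the ratios. *)
Lemma simple_compat g i s : (i.+1 < n)%N -> s != 0 -> incl g = gl_X i i.+1 s ->
  @compat _ _ symbol_potential g (simple_lift_f g i s).
Proof.
move=> ni s0 gE k y y'; have ii : i != i.+1 by lia.
have e (z : state F n) m : m != i.+1 -> lam (state_act g z) m = lam z m.
  by move=> mi; apply: (lam_act _ ii gE); lia.
have l0 (z : state F n) m : (m <= n)%N -> lam z m != 0 by exact: lam_neq0.
have n1 : (i.+1 <= n)%N by lia.
have N0 : (- s) != 0 by rewrite oppr_eq0.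
rewrite /simple_lift_f => kyy.
have := edge_act g kyy; case: k kyy => [j [nj yy] [_ gyy]|yy gyy] /=.
  have swlt (z z' : state F n) m : (forall b, z' b = z (swap_idx j b)) ->
      (m <= j)%N -> lam z' m = lam z m by move=> zz mj; rewrite (lam_swap _ zz) mj.
  have swgt (z z' : state F n) m : (forall b, z' b = z (swap_idx j b)) ->
      (j.+1 < m)%N -> lam z' m = - lam z m.
    by move=> zz mj; rewrite (lam_swap _ zz) !ifN //; lia.
  have [ji|ij|ji] := ltngtP j i.
  - rewrite !(e _ j.+1) ?(e _ j) ?subrr; try lia.
    rewrite !(swgt _ _ _ yy) ?(swgt _ _ _ gyy); try lia.
    apply/eqP; rewrite subr_eq0; apply/eqP.
    by congr (c _ _); field; rewrite ?oppr_eq0 ?oner_eq0 l0.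
  - have [jE|ij1] := eqVneq j i.+1.
      subst j; rewrite !(e _ i.+2); try lia.
      rewrite (swlt _ _ _ yy (leqnn _)) (swlt _ _ _ gyy (leqnn _)).
      by rewrite (sym_ratio cP) ?(swap_pot_adj cP) ?l0 //; lia.
    rewrite !(e _ j.+1) ?(e _ j) ?subrr; try lia.
    by rewrite !(swlt _ _ _ yy) ?(swlt _ _ _ gyy) ?subrr //; lia.
  - subst j; rewrite !(e _ i) ?(swgt _ _ i.+2 yy) //; try lia.
    have [n0 n2] : (i <= n)%N /\ (i.+2 <= n)%N by lia.
    apply: (swap_pot_steinberg cP) => //; try exact: l0.
    have m0 (z : state F n) m : (m <= n)%N -> state_minor z m != 0 by exact: state_minor_neq0.
    have := lead_coef_steinberg cP _ _ _ (state_minor_plucker nj gE yy).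
    rewrite !mulf_neq0 ?polyC_eq0 ?m0 // => /(_ isT isT isT) /=.
    by rewrite !lead_coefM lead_coefC.
rewrite (e y' n) ?(e y n); try lia.
have [nE|nE] := eqVneq n i.+2; last first.
  have [nE' n2 n1'] : [/\ n.-1 != i.+1, (i.+2 < n)%N & (i.+1 < n)%N] by split; lia.
  by rewrite (e y n.-1) // (lam_last yy n1') (lam_last yy n2) (lam_last gyy n1') !subrr.
have n1E : n.-1 = i.+1 by rewrite nE.
rewrite n1E -nE (lam_last yy ni) (lam_last gyy ni).
by rewrite (sym_ratio cP) // l0.
Qed.

Fact ext_gl_subproof : {morph (fun x : L => incl (ext_g x)) : x y / (x * y)%g}.
Proof. by move=> x y; rewrite !gmulfM. Qed.
Definition ext_gl : {multiplicative L -> GL F} :=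
  HB.pack_for {multiplicative L -> GL F} (fun x : L => incl (ext_g x))
    (isMultiplicative.Build L (GL F) _ ext_gl_subproof).

Lemma ext_glE (x : L) : ext_gl x = incl (ext_g x). Proof. by []. Qed.

Lemma ext_gl_eq1 (x : L) : ext_gl x = 1%g -> ext_g x = 1%g.
Proof. by rewrite ext_glE => x1; apply: incl_inj; rewrite x1 hom1. Qed.

Lemma ext_gl_central (z x : L) : ext_gl z = 1%g -> commute z x.
Proof. by move=> /ext_gl_eq1; apply: ext_central. Qed.

Lemma gl_lift_simple i (a : F) : (i.+1 < n)%N -> exists x, ext_gl x = gl_X i i.+1 a.
Proof.
move=> ni; have ii : i != i.+1 by lia.
have [->|a0] := eqVneq a 0.
  by exists 1%g; rewrite hom1 gl_XE; apply: val_inj; rewrite [RHS]elem_0.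
pose g : G := Sub (gl_X i i.+1 a) (mem_gl_sub a (ltnW ni) ni ii).
by exists (Ext (@simple_compat g i a ni a0 erefl)).
Qed.

Lemma gl_lift i j (a : F) : (i < n)%N -> (j < n)%N -> i != j ->
  exists x, ext_gl x = gl_X i j a.
Proof.
move=> ni nj ij; have [ji|lij|ji] := ltngtP j i; last by rewrite ji eqxx in ij.
  pose g : G := Sub (gl_X i j a) (mem_gl_sub a ni nj ij).
  by exists (Ext (@lower_compat g i j a ji erefl)).
elim: j {ij} nj lij a => [//|j IH] nj; rewrite ltnS leq_eqVlt => /predU1P [ij|ij] a.
  by subst j; apply: gl_lift_simple.
have [x xE] := IH (ltnW nj) ij 1; have [y yE] := gl_lift_simple a nj.
exists (comm x y); rewrite hom_comm xE yE gl_XR ?mul1r //; lia.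
Qed.

End SymbolExtension.

(** * Lifts of diagonal matrices *)

Section DiagonalLift.
Variables (F : fieldType) (A : zmodType) (c : F -> F -> A) (n : nat).
Hypothesis cP : steinberg_symbol c.
Local Notation G := (subgrp (@gl_sub F n)).
Local Notation L := (ext (symbol_potential c n)).
Implicit Types (h : G) (i j m : nat) (u v : F) (y : state F n).
Local Open Scope ring_scope.

Let cMl := symMl cP.
Let cMr := symMr cP.

Variable diag : nat -> F.
Definition diag_det m := \prod_(0 <= k < m) diag k.
Hypothesis diag_neq0 : forall k, diag k != 0.
Hypothesis n_gt0 : (0 < n)%N.
Hypothesis diag_n : diag_det n = 1.
Variable g : G.
Hypothesis gE : forall h r l, gl_entry (incl (g * h)%g) r l =
  diag r * gl_entry (incl h) r l.

Lemma diag_det_neq0 m : diag_det m != 0.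
Proof. by rewrite /diag_det prodf_seq_neq0; apply/allP => k _; apply/implyP. Qed.

Lemma lam_diag y m : lam (state_act g y) m = diag_det m * lam y m.
Proof.
rewrite /lam /state_minor /diag_det.
rewrite (@eq_minor _ m _ (fun r b => (diag r)%:P * col_entry (y b) r)).
  rewrite minor_scale lead_coefM; congr (_ * _).
  by rewrite -(rmorph_prod (@polyC F)) /= lead_coefC.
move=> r b _ _; rewrite /= /col_entry mulr_sumr; apply: eq_bigr => l _.
by rewrite /= gE polyCM mulrA.
Qed.

Definition diag_lift_f y : A := \sum_(0 <= k < n) c (lam y k.+1) (diag k).

Lemma sym_prod x a b : x != 0 ->
  \sum_(a <= k < b) c x (diag k) = c x (\prod_(a <= k < b) diag k).
Proof.
move=> x0; elim: b => [|b IH]; first by rewrite !big_geq // sym1r.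
have [ab|ba] := leqP a b; last by rewrite !big_geq // sym1r.
rewrite !big_nat_recr //= IH cMr //.
by rewrite prodf_seq_neq0; apply/allP => k _; apply/implyP.
Qed.

(** A swap at [i] negates all minors of size above [i+1], which contributes [c (- 1)] of the product
    of the later diagonal entries. Determinant 1 makes this product the inverse of [diag_det i.+1],
    as [swap_pot_diag] expects. *)
Lemma diag_compat : @compat _ _ (symbol_potential c n) g diag_lift_f.
Proof.
move=> k y y' kyy; have N0 : (- 1 : F) != 0 by rewrite oppr_eq0 oner_neq0.
have l0 (z : state F n) m : (m <= n)%N -> lam z m != 0 by exact: lam_neq0.
rewrite /diag_lift_f -sumrB; case: k kyy => [i [ni yy]|yy] /=.
  have ni' : (i <= n)%N by lia.
  rewrite (big_cat_nat (n := i)) //= big_nat big1 ?add0r => [|k /andP [_ ki]]; last first.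
    by rewrite (lam_swap _ yy) ki subrr.
  rewrite big_ltn; last by lia.
  rewrite !lam_diag.
  have -> : \sum_(i.+1 <= k < n) (c (lam y' k.+1) (diag k) - c (lam y k.+1) (diag k)) =
      c (- 1) (\prod_(i.+1 <= k < n) diag k).
    rewrite -sym_prod // big_nat [RHS]big_nat; apply: eq_bigr => k /andP [ik kn].
    rewrite (lam_swap _ yy) !ifN; try lia.
    by rewrite -[- lam y _]mulN1r cMl ?l0 // addrK.
  have -> : \prod_(i.+1 <= k < n) diag k = (diag_det i.+1)^-1.
    apply: (mulfI (diag_det_neq0 i.+1)); rewrite divff ?diag_det_neq0 //.
    by apply: etrans diag_n; rewrite /diag_det [RHS](big_cat_nat (n := i.+1)) // ltnW.
  have -> : diag_det i.+1 = diag_det i * diag i by rewrite /diag_det big_nat_recr.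
  by apply: (swap_pot_diag cP); rewrite ?l0 ?diag_det_neq0 //; lia.
have dn : diag_det n.-1 * diag n.-1 = 1.
  have : diag_det n.-1.+1 = 1 by rewrite prednK.
  by rewrite /diag_det big_nat_recr.
rewrite !lam_diag diag_n !mul1r (big_cat_nat (n := n.-1)) ?leq_pred //=.
rewrite big_nat big1 ?add0r => [|k /andP [_ kn]]; last first.
  by rewrite (lam_last yy) ?subrr //; lia.
rewrite big_ltn ?ltn_predL // big_geq ?prednK // addr0.
by rewrite (sym_div_diag cP _ _ _ _ _ dn) ?l0 ?diag_det_neq0 ?leq_pred.
Qed.

End DiagonalLift.

Section SymbolCommutator.
Variables (F : fieldType) (A : zmodType) (c : F -> F -> A) (n : nat).
Hypothesis cP : steinberg_symbol c.
Hypothesis n5 : (5 <= n)%N.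
Local Notation G := (subgrp (@gl_sub F n)).
Local Notation L := (ext (symbol_potential c n)).
Local Notation p := (ext_gl c n).
Implicit Types (i j m : nat) (u v : F) (y : state F n).
Local Open Scope ring_scope.

Lemma torus_val_neq0 i j u k : u != 0 -> torus_val i j u k != 0.
Proof.
by move=> u0; rewrite /torus_val; do 2?case: ifP => _; rewrite ?invr_eq0 ?oner_eq0.
Qed.

Lemma torus_val_det i j u : (i < n)%N -> (j < n)%N -> i != j -> u != 0 ->
  diag_det (torus_val i j u) n = 1.
Proof.
move=> ni nj ij u0; rewrite /diag_det big_mkord (bigD1 (Ordinal ni)) //=.
rewrite (bigD1 (Ordinal nj)) /=; last by rewrite eq_sym.
rewrite big1 => [|k /andP [ki kj]]; last by rewrite /torus_val !ifN.
by rewrite mulr1 /torus_val !eqxx [j == i]eq_sym (negbTE ij) divff.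
Qed.

Lemma torus_lift i j u : (i < n)%N -> (j < n)%N -> i != j -> u != 0 ->
  exists x : L, p x = torus (@gl_X F) i j u /\
    forall y, ext_f x y = diag_lift_f c (torus_val i j u) y.
Proof.
move=> ni nj ij u0; have ji : j != i by rewrite eq_sym.
have tG : torus (@gl_X F) i j u \in gl_sub F n.
  by do !apply: gpredM; apply: mem_gl_sub.
pose g : G := Sub (torus (@gl_X F) i j u) tG.
have gE (h : G) r l : gl_entry (incl (g * h)%g) r l =
    torus_val i j u r * gl_entry (incl h) r l.
  by rewrite gmulfM; apply: (ent_torus (@gl_entryX F)).
have n0 : (0 < n)%N by lia.
by exists (Ext (diag_compat cP (fun k => torus_val_neq0 i j k u0) n0
  (torus_val_det ni nj ij u0) gE)).
Qed.

(** A torus matrix scales each leading minor, so bimultiplicativity makes the shift independent of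
    the state. *)
Lemma diag_lift_shift (x : L) (t : nat -> F) i j u z : (i < n)%N -> (j < n)%N ->
  i != j -> u != 0 -> p x = torus (@gl_X F) i j u -> (forall k, t k != 0) ->
  diag_lift_f c t (state_act (ext_g x) z) - diag_lift_f c t z =
  \sum_(0 <= k < n) c (diag_det (torus_val i j u) k.+1) (t k).
Proof.
move=> ni nj ij u0 px t0; rewrite /diag_lift_f -sumrB big_nat [RHS]big_nat.
apply: eq_bigr => k /andP [_ kn].
have gE (h : G) r l : gl_entry (incl (ext_g x * h)%g) r l =
    torus_val i j u r * gl_entry (incl h) r l.
  have -> : incl (ext_g x * h)%g = (p x * incl h)%g by rewrite gmulfM.
  by rewrite px; apply: (ent_torus (@gl_entryX F)).
have d0 := diag_det_neq0 (fun k => torus_val_neq0 i j k u0) k.+1.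
by rewrite (lam_diag gE) (symMl cP) ?lam_neq0 // addrK.
Qed.

(** On the explicit lifts the commutator is a difference of two shifts. The minors [v, v, 1] against
    the entries [u, u^-1, 1] give 0, and [u, 1, 1] against [v, 1, v^-1] give [c u v]. *)
Lemma symb_ext (X : nat -> nat -> F -> L) u v :
  (forall i j a, (i < n)%N -> (j < n)%N -> i != j -> p (X i j a) = gl_X i j a) ->
  u != 0 -> v != 0 ->
  ext_g (symb X 0 1 2 u v) = 1%g /\ forall y, ext_f (symb X 0 1 2 u v) y = - c u v.
Proof.
move=> pX u0 v0; have [N0 [N1 N2]] : (0 < n /\ 1 < n /\ 2 < n)%N by lia.
have [x [px fx]] := @torus_lift 0 1 u N0 N1 isT u0.
have [y [py fy]] := @torus_lift 0 2 v N0 N2 isT v0.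
have pT i j t : (i < n)%N -> (j < n)%N -> i != j ->
    p (torus X i j t) = torus (@gl_X F) i j t.
  by move=> ni nj ij; rewrite /torus /weyl !gmulfM !pX // eq_sym.
have -> : symb X 0 1 2 u v = [~ x, y]%g.
  by apply: (comm_lift (@ext_gl_central _ _ c n)); rewrite pT.
have g1 : ext_g [~ x, y]%g = 1%g.
  apply: (@ext_gl_eq1 _ _ c n); rewrite homR px py; apply/eqP/commgP.
  apply: val_inj; apply: smx_eqP => r l.
  rewrite -[LHS]/(gl_entry (_ * _)%g r l) -[RHS]/(gl_entry (_ * _)%g r l).
  rewrite -[torus _ 0 2 v]mulg1 -[torus _ 0 1 u in RHS]mulg1 -[in RHS]mulgA mul1g.
  by rewrite !(ent_torus (@gl_entryX F)) // mulrCA.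
split=> // z.
have := commgC x y; move: [~ x, y]%g g1 => k k1 /(congr1 (fun w : L => ext_f w z)).
rewrite !ext_fM k1 pt_act1 !fx !fy /= => e.
have {e} -> : ext_f k z = (diag_lift_f c (torus_val 0 1 u) (state_act (ext_g y) z) -
    diag_lift_f c (torus_val 0 1 u) z) -
    (diag_lift_f c (torus_val 0 2 v) (state_act (ext_g x) z) -
     diag_lift_f c (torus_val 0 2 v) z).
  apply: (addrI (diag_lift_f c (torus_val 0 2 v) (state_act (ext_g x) z) +
    diag_lift_f c (torus_val 0 1 u) z)); rewrite -e; zmod.
rewrite (@diag_lift_shift y (torus_val 0 1 u) 0 2 v z N0 N2 isT v0 py); last by move=> l; apply: torus_val_neq0.
rewrite (@diag_lift_shift x (torus_val 0 2 v) 0 1 u z N0 N1 isT u0 px); last by move=> l; apply: torus_val_neq0.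
rewrite !(big_ltn N0) !(big_ltn N1) !(big_ltn N2).
rewrite !big_nat !big1 => [|l /andP [l3 _]|l /andP [l3 _]]; last 2 first.
- rewrite /torus_val !ifN ?(sym1r cP) ?diag_det_neq0 //; try lia.
  by move=> k'; apply: torus_val_neq0.
- rewrite /torus_val !ifN ?(sym1r cP) ?diag_det_neq0 //; try lia.
  by move=> k'; apply: torus_val_neq0.
rewrite /diag_det !big_nat_recr //= !big_geq // /torus_val /= !mul1r !mulr1 ?(divff u0) ?(divff v0).
rewrite !(sym1l cP) ?invr_eq0 ?oner_eq0 // ?(sym1r cP) //.
by rewrite (symVr cP) //; zmod.
Qed.

End SymbolCommutator.

(** * Injectivity *)

Lemma weval_hom (X : choiceType) (G H : groupType) (h : {multiplicative G -> H})
    (f : X -> G) w : h (weval f w) = weval (fun x => h (f x)) w.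
Proof.
elim: w => [|[b x] w IH] /=; first exact: hom1.
by rewrite gmulfM IH; case: b; rewrite ?homV.
Qed.

Lemma eq_weval (X : choiceType) (H : groupType) (f g : X -> H) w : f =1 g ->
  weval f w = weval g w.
Proof. by move=> /funext ->. Qed.

Section AdditiveMilnor.
Variable F : fieldType.

Lemma KM_comm (x y : KM 2 F) : x * y = y * x.
Proof. by rewrite -(qreprK x) -(qreprK y) -!qpiM tpow_abelian. Qed.

(** An additive copy of the group, since potentials take values in a [zmodType]. *)
Definition KM_add : Type := KM 2 F.
HB.instance Definition _ := Choice.on KM_add.
Definition km_add (x y : KM_add) : KM_add := (x : KM 2 F) * (y : KM 2 F).
Definition km_opp (x : KM_add) : KM_add := (x : KM 2 F)^-1.
Definition km_zero : KM_add := (1 : KM 2 F).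
Fact km_addA : associative km_add. Proof. by move=> x y z; exact: mulgA. Qed.
Fact km_addC : commutative km_add. Proof. by move=> x y; exact: KM_comm. Qed.
Fact km_add0 : left_id km_zero km_add. Proof. by move=> x; exact: mul1g. Qed.
Fact km_addN : left_inverse km_zero km_opp km_add.
Proof. by move=> x; exact: mulVg. Qed.
HB.instance Definition _ := GRing.isZmodule.Build KM_add km_addA km_addC km_add0 km_addN.

Definition to_ustar (x : F) : ustar F := insubd (u_one F) x.

Lemma val_to_ustar x : x != 0%R -> val (to_ustar x) = x.
Proof. by move=> x0; rewrite insubdK // unfold_in unitfE. Qed.

Lemma to_ustarK (x : ustar F) : to_ustar (val x) = x.
Proof. exact: valKd. Qed.

Definition pair2 (u v : ustar F) : {ffun 'I_2 -> ustar F} :=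
  [ffun i => if i == ord0 then u else v].

Lemma pair2E (f : {ffun 'I_2 -> ustar F}) : pair2 (f ord0) (f ord_max) = f.
Proof. by apply/ffunP => i; rewrite ffunE; case: (ord2P i) => ->. Qed.

Definition km_symbol (x y : F) : KM_add := milnor (pair2 (to_ustar x) (to_ustar y)).

Lemma milnorM (f g h : {ffun 'I_2 -> ustar F}) i :
  h i = f i * g i -> (forall j, j != i -> f j = h j /\ g j = h j) ->
  milnor h = milnor f * milnor g.
Proof.
move=> hi hj; rewrite /milnor -qpiM; congr qpi.
rewrite /tens /pgen -ppiM; apply/esym/ppiP/presP_rel; exact: tens_rel_mul hi hj.
Qed.

Lemma km_symbolP : steinberg_symbol km_symbol.
Proof.
have uM x y : x != 0%R -> y != 0%R -> to_ustar (x * y)%R = to_ustar x * to_ustar y.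
  move=> x0 y0; apply: val_inj; rewrite val_to_ustar ?mulf_neq0 //.
  by rewrite -[RHS]/((val (to_ustar x) * val (to_ustar y))%R) !val_to_ustar.
split=> [x y z x0 y0 z0|x y z x0 y0 z0|x y x0 y0 xy].
- apply: (@milnorM _ _ _ ord0) => [|j /negbTE j0]; rewrite !ffunE ?eqxx ?uM //.
  by rewrite j0.
- apply: (@milnorM _ _ _ ord_max) => [|j jm]; rewrite !ffunE /= ?uM //.
  by case: (ord2P j) jm => ->.
- apply/qpi_eq1/mem_gen; exists (pair2 (to_ustar x) (to_ustar y)), ord0, ord_max.
  by split=> //; rewrite !ffunE /= !val_to_ustar.
Qed.

Lemma milnor_symbol f : milnor f = km_symbol (val (f ord0)) (val (f ord_max)).
Proof. by rewrite /km_symbol !to_ustarK pair2E. Qed.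

End AdditiveMilnor.

(** * Derivations with bounded indices *)

Section BoundedRelations.
Variable F : fieldType.
Local Notation letter := (offdiag * F)%type.

Definition wbound M (w : word letter) : bool :=
  all (fun l => ((val l.2.1).1 < M)%N && ((val l.2.1).2 < M)%N) w.

Lemma wboundW M N w : (M <= N)%N -> wbound M w -> wbound N w.
Proof.
move=> MN /allP h; apply/allP => l /h /andP [l1 l2].
by rewrite !(leq_trans _ MN).
Qed.

Lemma wbound_ex w : exists N, wbound N w.
Proof.
elim: w => [|l w [N Nw]]; first by exists 0.
exists (maxn N (maxn (val l.2.1).1 (val l.2.1).2).+1); rewrite /= -/(wbound _ w).
by rewrite (wboundW (leq_maxl _ _) Nw) andbT; lia.
Qed.

Definition st_rel_upto M (u v : word letter) : Prop :=
  [/\ st_rel u v, wbound M u & wbound M v].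

(* A derivation involves only finitely many indices.                          *)
Lemma presP_bounded (u v : word letter) : presP (@st_rel F) u v -> exists N,
  forall M, (N <= M)%N -> forall (H : groupType) (f : letter -> H),
  (forall a b, st_rel_upto M a b -> weval f a = weval f b) -> weval f u = weval f v.
Proof.
elim=> {u v} [w|u v _ [N h]|u v w _ [N h] _ [N' h']|u u' v v' _ [N h] _ [N' h']
  |[b x]|u v uv].
- by exists 0.
- by exists N => M NM H f fr; rewrite (h M).
- exists (maxn N N') => M NM H f fr.
  by rewrite (h M) ?(h' M) // (leq_trans _ NM) ?leq_maxl ?leq_maxr.
- exists (maxn N N') => M NM H f fr; rewrite !weval_cat.
  by rewrite (h M) ?(h' M) // (leq_trans _ NM) ?leq_maxl ?leq_maxr.
- by exists 0 => M _ H f _; case: b; rewrite /= mulg1 ?mulVg ?mulgV.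
- have [N uN] := wbound_ex u; have [N' vN'] := wbound_ex v.
  exists (maxn N N') => M NM H f; apply; split=> //.
    by apply: wboundW uN; rewrite (leq_trans _ NM) ?leq_maxl.
  by apply: wboundW vN'; rewrite (leq_trans _ NM) ?leq_maxr.
Qed.

End BoundedRelations.

Section Injectivity.
Variable F : fieldType.
Local Notation letter := (offdiag * F)%type.

(** A common source for St(F) and for the extension of size [n], where the Steinberg relations are
    lifted only for indices below [n], so that St(F) itself cannot be mapped to it directly. *)
Definition St5 : groupType := pres (@st_rel_upto F 5).
Definition X5 i j (a : F) : St5 :=
  if insub (i, j) is Some q then pgen _ (q, a) else 1.

Definition letter_map (H : groupType) (X : nat -> nat -> F -> H) (l : letter) : H :=
  X (val l.1).1 (val l.1).2 l.2.

Section St5Lift.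
Variables (H : groupType) (X : nat -> nat -> F -> H).
Hypothesis XR : forall a b, st_rel_upto 5 a b ->
  weval (letter_map X) a = weval (letter_map X) b.

Definition St5_lift : {multiplicative St5 -> H} := pres_lift XR.

Lemma St5_liftX i j a : i != j -> St5_lift (X5 i j a) = X i j a.
Proof. by move=> ij; rewrite /X5 insubT [LHS]pres_liftE. Qed.

Lemma St5_lift_symb u v :
  St5_lift (symb X5 0 1 2 u v) = symb X 0 1 2 u v.
Proof.
have h i j a : i != j -> St5_lift (X5 i j a) = X i j (idfun a) by exact: St5_liftX.
by rewrite homR !(hom_torus h).
Qed.

Lemma St5_liftE x : St5_lift x = weval (letter_map X) (prepr x).
Proof. by []. Qed.

End St5Lift.

Lemma bounded_rel (H : groupType) (X : nat -> nat -> F -> H) M :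
  (forall i j a b, (i < M)%N -> (j < M)%N -> i != j ->
     X i j a * X i j b = X i j (a + b)%R) ->
  (forall i j k a b, (i < M)%N -> (j < M)%N -> (k < M)%N ->
     i != j -> j != k -> i != k -> comm (X i j a) (X j k b) = X i k (a * b)%R) ->
  (forall i j k l a b, (i < M)%N -> (j < M)%N -> (k < M)%N -> (l < M)%N ->
     i != j -> k != l -> j != k -> i != l -> commute (X i j a) (X k l b)) ->
  forall a b, st_rel_upto M a b -> weval (letter_map X) a = weval (letter_map X) b.
Proof.
move=> XD XR XI a b [[i j h x y|i j k hij hjk hik x y|i j k l hij hkl x y jk il]].
- rewrite weval_cat !weval_gen /= => /and3P [/andP [iM jM] _ _] _.
  exact: XD.
- rewrite weval_comm !weval_gen /= => /and4P [/andP [iM jM] /andP [_ kM] _ _] _.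
  exact: XR.
- rewrite weval_comm !weval_gen /= => /and4P [/andP [iM jM] /andP [kM lM] _ _] _.
  exact: comm1P (XI _ _ _ _ _ _ _ _ _ _ hij hkl jk il).
Qed.

Lemma KM_weval (x : KM 2 F) : exists w, x = weval (@milnor F) w.
Proof.
exists (prepr (qrepr x)); rewrite -{1}(qreprK x) -{1}(preprK (qrepr x)).
by rewrite -weval_pgen weval_hom.
Qed.

Lemma ext_f1 (A : zmodType) (G : groupType) (t : potential A G) y :
  ext_f (1 : ext t) y = 0%R.
Proof. by []. Qed.

(* The states detect the value in K^M_2 of a product of symbols of K_2.       *)
Lemma symb_weval_ext n (X : nat -> nat -> F -> ext (symbol_potential (@km_symbol F) n)) w :
  (5 <= n)%N ->
  (forall i j a, (i < n)%N -> (j < n)%N -> i != j ->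
     ext_gl (@km_symbol F) n (X i j a) = gl_X i j a) ->
  let s := weval (fun f : {ffun 'I_2 -> ustar F} =>
    symb X 0 1 2 (val (f ord0)) (val (f ord_max))) w in
  ext_g s = 1 /\ forall y, ext_f s y = (- (weval (@milnor F) w : KM_add F))%R.
Proof.
move=> n5 pX /=; elim: w => [|[b f] w [IHg IHf]] /=.
  by split=> [|y]; rewrite ?ext_f1 ?oppr0.
have [sg sf] := symb_ext (@km_symbolP F) n5 pX (ustar_neq0 (f ord0)) (ustar_neq0 (f ord_max)).
rewrite -milnor_symbol in sf.
set s := symb _ _ _ _ _ _ in sg sf *.
have [tg tf] : ext_g (if b then s^-1 else s) = 1 /\
    forall y, ext_f (if b then s^-1 else s) y =
      (- (((if b then (milnor f)^-1 else milnor f)%g) : KM_add F))%R.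
  case: b; last by [].
  split=> [|y]; first by rewrite -[LHS]/((ext_g s)^-1) sg invg1.
  have := ext_fM s^-1 s y; rewrite mulVg ext_f1 sg pt_act1 sf => /esym/eqP.
  by rewrite addr_eq0 => /eqP ->.
split=> [|y]; first by rewrite tg IHg mulg1.
by rewrite tf IHf -opprD.
Qed.

(** A product of symbols trivial in St(F) is so by a derivation with bounded indices. The same
    derivation is valid in the extension of a large size [M], where the product is the constant
    [- x]. *)
Lemma matsumoto_inj (x : KM 2 F) : matsumoto F x = 1 -> x = 1.
Proof.
have [w ->] := KM_weval x => mx.
pose sy (H : groupType) (X : nat -> nat -> F -> H) (f : {ffun 'I_2 -> ustar F}) :=
  symb X 0 1 2 (val (f ord0)) (val (f ord_max)).
pose k := weval (sy St5 X5) w.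
have stR a b : st_rel_upto 5 a b ->
    weval (letter_map (@st_X F)) a = weval (letter_map (@st_X F)) b.
  have [D R I] := st_X_family F.
  apply: bounded_rel => // *; first exact: D.
    by rewrite /comm R ?mulgK.
  exact: I.
have k1 : St5_lift stR k = 1.
  rewrite weval_hom (eq_weval _ (g := fun f => incl (K2symb f))); last first.
    by move=> f; exact: St5_lift_symb.
  have <- : incl (matsumoto F (weval (@milnor F) w)) = 1 by rewrite mx hom1.
  by rewrite (weval_hom (matsumoto F)) (eq_weval _ (@matsumotoE F)) weval_hom.
have [N hN] : exists N, forall M, (N <= M)%N -> forall (H : groupType) (f : letter -> H),
    (forall a b, st_rel_upto M a b -> weval f a = weval f b) -> weval f (prepr k) = 1.
  apply: (@presP_bounded F (prepr k) [::]); apply/ppiP.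
  rewrite -[RHS]k1 St5_liftE -weval_pgen; apply: eq_weval => -[q a].
  by rewrite /letter_map /= -st_genE.
pose M := maxn N 5; have M5 : (5 <= M)%N by rewrite leq_maxr.
pose c := @km_symbol F; have cP : steinberg_symbol c := km_symbolP F.
pose L := ext (symbol_potential c M).
have [s sP] : exists s : nat -> nat -> F -> L, forall i j a, (i < M)%N -> (j < M)%N ->
    i != j -> ext_gl c M (s i j a) = gl_X i j a.
  have /choice [s sP] (t : nat * nat * F) : exists y : L, (t.1.1 < M)%N ->
      (t.1.2 < M)%N -> t.1.1 != t.1.2 -> ext_gl c M y = gl_X t.1.1 t.1.2 t.2.
    have [/and3P [iM jM ij]|h] := boolP [&& t.1.1 < M, t.1.2 < M & t.1.1 != t.1.2]%N.
      by have [y yE] := gl_lift cP t.2 iM jM ij; exists y.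
    by exists 1 => iM jM ij; rewrite iM jM ij in h.
  by exists (fun i j a => s (i, j, a)) => i j a; exact: (sP (i, j, a)).
have [X [pX XD XR XI]] := steinberg_lift (@ext_gl_central _ _ c M) M5
  (@gl_XD F) (@gl_XR F) (@gl_XI F) sP.
have XM := bounded_rel XD XR XI.
have X5R a b : st_rel_upto 5 a b -> weval (letter_map X) a = weval (letter_map X) b.
  by case=> ab a5 b5; apply: XM; split=> //; apply: wboundW M5 _.
have kL : St5_lift X5R k = 1.
  by rewrite St5_liftE; apply: (hN M); rewrite ?leq_maxl.
have [_ /(_ (pt_base _)) kf] := symb_weval_ext w M5 pX.
have /esym/eqP : (0 = - (weval (@milnor F) w : KM_add F))%R.
  rewrite -kf -(ext_f1 (pt_base (symbol_potential c M))) -kL weval_hom; congr ext_f.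
  by apply: eq_weval => f; rewrite -(St5_lift_symb X5R).
by rewrite oppr_eq0 => /eqP.
Qed.

End Injectivity.

(** * Coinvariants *)

Section Coinvariants.
Variables (Gam G H : groupType) (a : gaction Gam G) (b : gaction Gam H).
Variable f : {multiplicative G -> H}.
Hypothesis fab : forall g x, f (a g x) = b g (f x).

Lemma coinv_mapE x : coinv_map fab (qpi _ x) = qpi _ (f x).
Proof. exact: (qliftE (coinv_pre_ker fab)). Qed.

(** Generators and their conjugates lift one by one. This gives both injectivity on coinvariants and
    surjectivity onto [K2_Gam]. *)
Lemma Gamma_sub_lift : (forall y, exists x, f x = y) ->
  forall y, y \in Gamma_sub b -> exists2 x, x \in Gamma_sub a & f x = y.
Proof.
move=> fsurj y; rewrite genE => /asboolP.
elim=> {y} [_ [_ [z [[g [y ->]] ->]]]||y y' _ [x xa <-] _ [x' x'a <-]|y _ [x xa <-]].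
- have [[x <-] [t <-]] := (fsurj y, fsurj z).
  exists ((a g x * x^-1) ^ t); first by apply: nsubJ; apply: mem_ncl; exists g, x.
  by rewrite homJ gmulfM homV fab.
- by exists 1; rewrite ?gpred1 ?hom1.
- by exists (x * x'); rewrite ?gpredM ?gmulfM.
- by exists x^-1; rewrite ?gpredV ?homV.
Qed.

Lemma coinv_map_surj : (forall y, exists x, f x = y) ->
  forall v, exists u, coinv_map fab u = v.
Proof.
move=> fsurj v; have [x xv] := fsurj (qrepr v).
by exists (qpi _ x); rewrite coinv_mapE xv qreprK.
Qed.

Lemma coinv_map_inj : (forall x, f x = 1 -> x = 1) ->
  (forall y, exists x, f x = y) -> injective (coinv_map fab).
Proof.
move=> finj fsurj; suff ker u : coinv_map fab u = 1 -> u = 1.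
  move=> u v uv; apply: (@mulgI _ v^-1); rewrite mulVg; apply: ker.
  by rewrite gmulfM homV uv mulVg.
rewrite -(qreprK u) coinv_mapE => /qpi_eq1 /(Gamma_sub_lift fsurj) [x xa fx].
apply/qpi_eq1; suff -> : qrepr u = x by [].
by apply: (@mulgI _ x^-1); rewrite mulVg; apply: finj; rewrite gmulfM homV fx mulVg.
Qed.

End Coinvariants.

Lemma inverse_hom (G H : groupType) (f : {multiplicative G -> H}) :
  injective f -> (forall y, exists x, f x = y) ->
  exists2 g : {multiplicative H -> G}, cancel f g & cancel g f.
Proof.
move=> finj /choice [g gK].
have gM : {morph g : x y / x * y} by move=> x y; apply: finj; rewrite gmulfM !gK.
exists (HB.pack_for {multiplicative H -> G} g (isMultiplicative.Build H G g gM)).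
  by move=> x; apply: finj; rewrite /= gK.
exact: gK.
Qed.

Lemma phi_surj (F : fieldType) (y : E F) : exists x, phi F x = y.
Proof.
have := valP y; rewrite [_ \in _]genE => /asboolP.
suff h z : genP [set x | exists p a, x = elem_GL p a]%classic z ->
    exists x, incl (phi F x) = z by move=> /h [x xy]; exists x; apply: incl_inj.
elim=> {z} [_ [q [a ->]]||z z' _ [x <-] _ [x' <-]|z _ [x <-]].
- by exists (st_gen q a); rewrite phiE.
- by exists 1; rewrite !hom1.
- by exists (x * x'); rewrite !gmulfM.
- by exists x^-1; rewrite !homV.
Qed.

Section MilnorSequence.
Variables (Gam : groupType) (F : fieldType) (r : raction Gam F).

Definition K2_cap_pre (x : K2_cap r) : coinv (K2_act r) := qpi _ (incl x).
Fact K2_cap_preM : {morph K2_cap_pre : x y / x * y}.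
Proof. by move=> x y; rewrite -qpiM -gmulfM. Qed.
HB.instance Definition _ := isMultiplicative.Build _ _ K2_cap_pre K2_cap_preM.
Fact K2_cap_pre_ker x : x \in Gamma_K2_in_cap r -> K2_cap_pre x = 1.
Proof. by rewrite hom_preimE => xG; apply/qpi_eq1. Qed.
Definition K2_cap_coinv : {multiplicative quo (Gamma_K2_in_cap r) -> coinv (K2_act r)} :=
  quo_lift K2_cap_pre_ker.

Lemma K2_cap_coinvE x : K2_cap_coinv (qpi _ x) = qpi _ (incl x).
Proof. exact: (qliftE K2_cap_pre_ker). Qed.

Lemma K2_cap_coinv_inj : injective K2_cap_coinv.
Proof.
move=> u v; rewrite -(qreprK u) -(qreprK v) !K2_cap_coinvE => /qpiP uv.
by apply/qpiP; rewrite hom_preimE gmulfM homV.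
Qed.

Fact incl_K2_equiv g (k : K2 F) : incl (K2_act r g k) = St_act r g (incl k).
Proof. by []. Qed.

Definition K2_coinv_St : {multiplicative coinv (K2_act r) -> coinv (St_act r)} :=
  coinv_map incl_K2_equiv.

Lemma K2_coinv_StE k : K2_coinv_St (qpi _ k) = qpi _ (incl k).
Proof. exact: coinv_mapE. Qed.

Fact K2_coinv_St_ker u : K2_coinv_St u \in hom_ker (phi_Gam r).
Proof.
rewrite -(qreprK u) K2_coinv_StE hom_kerE [phi_Gam r _]coinv_mapE.
by have /eqP -> : phi F (incl (qrepr u)) == 1; rewrite ?hom1 // -hom_kerE; exact: (valP (qrepr u)).
Qed.

Definition K2_Gam_of (u : coinv (K2_act r)) : K2_Gam r :=
  Sub (K2_coinv_St u) (K2_coinv_St_ker u).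

Lemma incl_K2_Gam_of u : incl (K2_Gam_of u) = K2_coinv_St u. Proof. by []. Qed.

Fact K2_Gam_ofM : {morph K2_Gam_of : u v / u * v}.
Proof. by move=> u v; apply: incl_inj; rewrite !gmulfM /= !incl_K2_Gam_of gmulfM. Qed.
HB.instance Definition _ := isMultiplicative.Build _ _ K2_Gam_of K2_Gam_ofM.

Lemma K2_Gam_of_eq1 u : K2_Gam_of u = 1 <-> exists x, K2_cap_coinv x = u.
Proof.
split=> [u1|[x <-]]; last first.
  apply: incl_inj; rewrite -(qreprK x) K2_cap_coinvE incl_K2_Gam_of K2_coinv_StE hom1.
  by apply/qpi_eq1; exact: (valP (qrepr x)).
have kS : qrepr u \in hom_preim (@incl _ (K2_sub F)) (Gamma_sub (St_act r)).
  by rewrite hom_preimE; apply/qpi_eq1; rewrite -K2_coinv_StE qreprK -incl_K2_Gam_of u1 hom1.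
by exists (qpi _ (Sub (qrepr u) kS : K2_cap r)); rewrite K2_cap_coinvE [incl _]/= qreprK.
Qed.

Lemma K2_Gam_of_surj z : exists u, K2_Gam_of u = z.
Proof.
pose s := qrepr (incl z); have sz : qpi _ s = incl z by exact: qreprK.
have : phi F s \in Gamma_sub (E_act r).
  apply/qpi_eq1; rewrite -(coinv_mapE (phi_equiv r)) sz; apply/eqP.
  by rewrite -hom_kerE; exact: (valP z).
(* The representative [s] need not lie in [K2_sub F]; dividing it by a lift [t] of [phi F s] taken
   in [Gamma_sub (St_act r)] corrects this within its class. *)
move=> /(Gamma_sub_lift (phi_equiv r) (@phi_surj F)) [t tG ts].
have ks : s * t^-1 \in K2_sub F by rewrite hom_kerE gmulfM homV ts mulgV.
exists (qpi _ (Sub (s * t^-1) ks : K2 F)); apply: incl_inj.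
rewrite incl_K2_Gam_of K2_coinv_StE -sz; apply/qpiP.
by rewrite [incl _]/= invgM invgK mulgVK.
Qed.

End MilnorSequence.

Theorem theorem5p18 (Gam : groupType) (F : fieldType) (r : raction Gam F) :
  exists theta : {multiplicative KM_Gam 2%N r -> coinv (K2_act r)},
    bijective theta /\
    exists (i : {multiplicative quo (Gamma_K2_in_cap r) -> KM_Gam 2%N r})
           (p : {multiplicative KM_Gam 2%N r -> K2_Gam r}),
      [/\ forall x : K2_cap r,
            theta (i (qpi (Gamma_K2_in_cap r) x)) =
            qpi (Gamma_sub (K2_act r)) (incl x),
          forall (u : KM_Gam 2%N r) (k : K2 F),
            theta u = qpi (Gamma_sub (K2_act r)) k ->
            incl (p u) = qpi (Gamma_sub (St_act r)) (incl k) &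
          short_exact i p].
Proof.
pose theta := coinv_map (matsumoto_equiv r); exists theta.
have thS := coinv_map_surj (matsumoto_equiv r) (@matsumoto_surj F).
have thI := coinv_map_inj (fab := matsumoto_equiv r) (@matsumoto_inj F) (@matsumoto_surj F).
have [ti thK tiK] : exists2 ti : {multiplicative _ -> _}, cancel theta ti & cancel ti theta.
  exact: inverse_hom thI thS.
split; first by exists ti.
(* The natural sequence for the coinvariants of K_2 is transported along [theta]. *)
pose i : {multiplicative quo (Gamma_K2_in_cap r) -> KM_Gam 2%N r} :=
  ti \o @K2_cap_coinv Gam F r.
pose p : {multiplicative KM_Gam 2%N r -> K2_Gam r} := @K2_Gam_of Gam F r \o theta.
have iE v : theta (i v) = K2_cap_coinv r v := tiK _.
have pE u : p u = K2_Gam_of (theta u) by [].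
exists i, p.
split=> [x|u k uk|]; first by rewrite iE K2_cap_coinvE.
  by rewrite pE incl_K2_Gam_of uk K2_coinv_StE.
split=> [u v uv|u|z].
- by apply: (@K2_cap_coinv_inj _ _ r); rewrite -!iE uv.
- rewrite pE K2_Gam_of_eq1; split=> -[x xu]; exists x; last by rewrite -xu iE.
  by apply: (can_inj thK); rewrite iE.
- by have [u <-] := K2_Gam_of_surj z; exists (ti u); rewrite pE tiK.
Qed.
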